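(* Let $\mathfrak g=\mathfrak{su}(2)$, let $\mathcal O\subset C$ be a $G$-orbit in the critical set of $\Phi$, let $\mathcal F$ be any frame (of the fixed orientation), and let $\mathcal O_{12}$ be the adjoint orbit in $\mathfrak g^{\mathbb C}=\mathfrak{sl}(2,\mathbb C)$ containing $(pr_{12}\circ\Psi_{\mathcal F})(\mathcal O)$. If $\mathcal O_{12}$ is a regular orbit in $\mathfrak g^{\mathbb C}$, then $(pr_{12}\circ\Psi_{\mathcal F})(S_{\mathcal O})=\mathcal O_{12}$. In fact $pr_{12}\circ\Psi_{\mathcal F}:S_{\mathcal O}\to\mathcal O_{12}$ is a symplectic diffeomorphism, where $S_{\mathcal O}$ is equipped with the symplectic structure induced from the Poisson structure $\pi_{\mathcal F}$ and $\mathcal O_{12}$ with the (co)adjoint orbit symplectic structure.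
   Context: $\mathfrak g=\mathfrak{su}(2)$ carries the Ad-invariant positive-definite inner product $\langle\cdot,\cdot\rangle$ (a multiple of the Killing form) normalized so that positively oriented orthonormal bases of $\mathfrak g$ satisfy $[e_1,e_2]=e_3$, $[e_2,e_3]=e_1$, $[e_3,e_1]=e_2$; it identifies $\mathfrak g^*$ with $\mathfrak g$. $G=SU(2)$. $M=L(\mathfrak g,\mathfrak{su}(2))$ is the space of linear maps, the target being regarded as an oriented Euclidean space. A frame is an orthonormal basis $\mathcal F=\{e_1,e_2,e_3\}$ of the target (of a fixed orientation); it identifies $M$ with $\mathfrak g\times\mathfrak g\times\mathfrak g$ via $\Psi_{\mathcal F}:\phi\mapsto(a,b,c)$, $\phi(x)=\langle a,x\rangle e_1+\langle b,x\rangle e_2+\langle c,x\rangle e_3$. $pr_{12}:\mathfrak g\times\mathfrak g\times\mathfrak g\to\mathfrak g^{\mathbb C}$ is $pr_{12}(a,b,c)=a+ib$. $G$ acts on $M$ by the diagonal adjoint action. $\Phi(a,b,c)=\langle a,[b,c]\rangle$ (independent of the frame), $C$ is its critical set ($[a,b]=[b,c]=[c,a]=0$), and $X=([b,c],[c,a],[a,b])$ its gradient, with flow $\phi_t$. $S$ is the set of $x\in M$ such that $\phi_t(x)$ converges as $t\to-\infty$; $S_{\mathcal O}$ is the set of $x\in S$ with $\lim_{t\to-\infty}\phi_t(x)\in\mathcal O$. One has $S\setminus C\subset\{\Phi>0\}$. The function $A:S\to S^2(\mathfrak g)$ is $A=\frac1\Phi([a,b]\otimes[a,b]+[b,c]\otimes[b,c]+[c,a]\otimes[c,a])$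 on $S\setminus C$ and, at a nonzero point of $C$ written as $(a_0,0,0)$ in a suitable frame (one always exists), $A=\|a_0\|\sum_iI_i\otimes I_i-\frac1{\|a_0\|}a_0\otimes a_0$ with $\{I_i\}$ an orthonormal basis of $\mathfrak g$. $A_{\xi,\eta}$ is its contraction with $\xi,\eta$. With $l^1_\xi(a,b,c)=\langle\xi,a\rangle$, $l^2_\xi(a,b,c)=\langle\xi,b\rangle$, $l^3_\xi(a,b,c)=\langle\xi,c\rangle$, $\pi_{\mathcal F}$ is given at points of $S$, under $\Psi_{\mathcal F}$, by $$\{l^1_\xi,l^1_\eta\}=l^1_{[\xi,\eta]},\quad \{l^1_\xi,l^2_\eta\}=\{l^2_\xi,l^1_\eta\}=l^2_{[\xi,\eta]},\quad \{l^2_\xi,l^2_\eta\}=-l^1_{[\xi,\eta]},$$ $$\{l^1_\xi,l^3_\eta\}=\{l^3_\xi,l^1_\eta\}=l^3_{[\xi,\eta]},\quad \{l^3_\xi,l^3_\eta\}=-l^1_{[\xi,\eta]},\quad \{l^2_\xi,l^3_\eta\}=-\{l^3_\xi,l^2_\eta\}=A_{\xi,\eta}.$$ For $\mathcal O\ne\{0\}$, $\pi_{\mathcal F}$ is tangent to the 4-manifold $S_{\mathcal O}$ and nondegenerate on it, hence defines a symplectic form there. $\mathfrak g^{\mathbb C}$, as a real Lie algebra, is identified with its dual by the real part of the complex-bilinear extension of $\langle\cdot,\cdot\rangle$ and carries the Lie–Poisson structure (bracket of linear functions $l^1_\xi(a+ib)=\langle\xi,a\rangle$, $l^2_\xi(a+ib)=\langle\xi,b\rangle$: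 $\{l^1_\xi,l^1_\eta\}=l^1_{[\xi,\eta]}$, $\{l^1_\xi,l^2_\eta\}=l^2_{[\xi,\eta]}$, $\{l^2_\xi,l^2_\eta\}=-l^1_{[\xi,\eta]}$); its symplectic leaves are the adjoint orbits with their (co)adjoint orbit symplectic structures. An orbit is regular if it has maximal dimension. *)

(* Defs.v *)
From HB Require Import structures.
From mathcomp Require Import all_boot all_order all_algebra.
From mathcomp Require Import all_classical all_reals all_analysis.
From mathcomp Require Import complex.
From mathcomp Require Import ring lra.

Set Implicit Arguments.
Unset Strict Implicit.
Unset Printing Implicit Defensive.

Import Order.TTheory GRing.Theory Num.Theory.
Import numFieldNormedType.Exports.

Local Open Scope classical_set_scope.
Local Open Scope ring_scope.

Section SmoothSubsets.
Variable R : realType.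
Implicit Types V W : normedModType R.

(* [Ck k U f] and [smooth_on U f] are meant for [U] open and [V], [W] of
   finite dimension. *)
Fixpoint Ck V W (k : nat) (U : set V) (f : V -> W) : Prop :=
  match k with
  | 0 => forall x, U x -> {for x, continuous f}
  | k'.+1 => (forall x, U x -> differentiable f x) /\
             (forall v, Ck k' U ('D_v f))
  end.

Definition smooth_on V W (U : set V) (f : V -> W) : Prop :=
  forall k, Ck k U f.

(* Smoothness of a map on an arbitrary subset of a vector space: existence of
   local smooth extensions. On embedded submanifolds this is the usual
   notion. *)
Definition smooth_map V W (X : set V) (f : V -> W) : Prop :=
  forall x, X x -> exists U (f' : V -> W),
    [/\ open U, U x, smooth_on U f' & forall y, U y -> X y -> f' y = f y].

Definition diffeomorphism V W (X : set V) (Y : set W) (f : V -> W) : Prop :=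
  [/\ set_bij X Y f, smooth_map X f &
      exists g : W -> V, (forall x, X x -> g (f x) = x) /\ smooth_map Y g].

(* Tangent vectors at [p] of an embedded submanifold [X]: velocities of smooth
   curves in [X]. *)
Definition tangent V (X : set V) (p v : V) : Prop :=
  exists (gamma : R -> V) (e : R),
    [/\ 0 < e, smooth_on `]- e, e[ gamma, gamma 0 = p,
        (forall t, -e < t < e -> X (gamma t)) & is_derive (0 : R) 1 gamma v].

Definition has_dim V (X : set V) (d : nat) : Prop :=
  forall p, X p -> exists b : 'I_d -> V,
    (forall c : 'I_d -> R, \sum_i c i *: b i = 0 -> forall i, c i = 0) /\
    (forall v, tangent X p v <-> exists c : 'I_d -> R, v = \sum_i c i *: b i).

(* A Poisson tensor [pi] on [V] is given on covectors indexed by a type [K]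
   through the evaluation [ev : K -> V -> R]. *)
Definition hamiltonian_vector V K (ev : K -> V -> R) (pi : V -> K -> K -> R)
    (p : V) (k : K) (v : V) : Prop :=
  forall k', ev k' v = pi p k k'.

(* The first part says that [pi] is tangent to [X] and nondegenerate on it. *)
Definition induced_symplectic_form V K (ev : K -> V -> R)
    (pi : V -> K -> K -> R) (X : set V) (omega : V -> V -> V -> R) : Prop :=
  forall p, X p ->
    (forall v, tangent X p v <-> exists k, hamiltonian_vector ev pi p k v) /\
    (forall k k' u v, hamiltonian_vector ev pi p k u ->
       hamiltonian_vector ev pi p k' v -> omega p u v = pi p k k').

Definition symplectic_map V W (X : set V)
    (omX : V -> V -> V -> R) (omY : W -> W -> W -> R) (f : V -> W) : Prop :=
  forall p u v, X p -> tangent X p u -> tangent X p v ->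
    omY (f p) ('D_u f p) ('D_v f p) = omX p u v.

End SmoothSubsets.

(* su(2) in the coordinates given by a positively oriented orthonormal basis,
   and its complexification sl(2,C), where the pair (a, b) stands for a + ib;
   [su2_mx] and [sl2_mx] below give the matrices. *)
Notation su2 R := ('rV[R]_3).
Notation sl2 R := (su2 R * su2 R)%type.
Notation su2_cube R := (su2 R * su2 R * su2 R)%type.

(* L(su(2), su(2)): the linear map phi is x |-> x *m phi. *)
Notation Hom_su2 R := ('M[R]_3).

Section LieAlgebras.
Variable R : realType.

Local Notation g := (su2 R).
Local Notation gC := (sl2 R).

Definition dot (x y : g) : R := \sum_i x 0 i * y 0 i.

Definition vec3 (x y z : R) : g := \row_i [:: x; y; z]`_i.

Definition bracket (x y : g) : g :=
  vec3 (x 0 1 * y 0 2 - x 0 2 * y 0 1)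
       (x 0 2 * y 0 0 - x 0 0 * y 0 2)
       (x 0 0 * y 0 1 - x 0 1 * y 0 0).

Definition bracketC (z w : gC) : gC :=
  (bracket z.1 w.1 - bracket z.2 w.2, bracket z.1 w.2 + bracket z.2 w.1).

(* real part of the complex-bilinear extension of [dot] *)
Definition dotC (z w : gC) : R := dot z.1 w.1 - dot z.2 w.2.

Definition mx2 (p q r s : R[i]) : 'M[R[i]]_2 :=
  \matrix_(i, j) nth 0 (nth [::] [:: [:: p; q]; [:: r; s]] i) j.

(* z |-> - (i/2) (z_1 sigma_1 + z_2 sigma_2 + z_3 sigma_3),
   with sigma_k the Pauli matrices *)
Definition sl2_mx (z : gC) : 'M[R[i]]_2 :=
  let z1 := (z.1 0 0 +i* z.2 0 0)%C in
  let z2 := (z.1 0 1 +i* z.2 0 1)%C in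
  let z3 := (z.1 0 2 +i* z.2 0 2)%C in
  let i := (0 +i* 1)%C : R[i] in
  (- i / 2) *: mx2 z3 (z1 - i * z2) (z1 + i * z2) (- z3).

Definition su2_mx (x : g) : 'M[R[i]]_2 := sl2_mx (x, 0).

Lemma sl2_mx_bracket (z w : sl2 R) :
  sl2_mx (bracketC z w) = sl2_mx z *m sl2_mx w - sl2_mx w *m sl2_mx z.
Proof.
case: z w => [a b] [c d]; apply/matrixP => i j; rewrite !mxE !big_ord_recl !big_ord0 !mxE.
case: i => [[|[|i]] Hi] //; case: j => [[|[|j]] Hj] //=;
  rewrite ?mxE /=;
 apply/eqP; rewrite eq_complex /=; apply/andP; split; apply/eqP; rewrite ?mxE /=; by field.
Qed.

Definition adjmx (U : 'M[R[i]]_2) : 'M[R[i]]_2 := map_mx conjc U^T.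

Lemma su2_mxP (m : 'M[R[i]]_2) :
  (adjmx m = - m /\ \tr m = 0) <-> exists x, m = su2_mx x.
Proof.
split; last first.
  case=> x ->; split.
    apply/matrixP => i j; rewrite !mxE.
    case: i => [[|[|i]] Hi] //; case: j => [[|[|j]] Hj] //=; rewrite ?mxE /=;
    apply/eqP; rewrite eq_complex /= ?mxE /=; apply/andP; split; apply/eqP; by field.
  rewrite /mxtrace !big_ord_recl big_ord0 !mxE /=.
  apply/eqP; rewrite eq_complex /= ?mxE /=; apply/andP; split; apply/eqP; by field.
case=> hm ht.
have e00 := congr1 (fun A : 'M[R[i]]_2 => A 0 0) hm.
have e01 := congr1 (fun A : 'M[R[i]]_2 => A 0 1) hm.
have e11 := congr1 (fun A : 'M[R[i]]_2 => A 1 1) hm.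
exists (vec3 (- 2 * complex.Im (m 0 1)) (- 2 * complex.Re (m 0 1)) (- 2 * complex.Im (m 0 0))).
move: e00 e01 e11 ht; rewrite /mxtrace !big_ord_recl big_ord0 !mxE.
have -> : lift ord0 ord0 = 1 :> 'I_2 by apply/val_inj.
have -> : ord0 = 0 :> 'I_2 by apply/val_inj.
have E : m = \matrix_(i, j) nth 0 (nth [::] [:: [:: m 0 0; m 0 1]; [:: m 1 0; m 1 1]] i) j.
  apply/matrixP => i j; rewrite !mxE.
  by case: i => [[|[|i]] Hi] //; case: j => [[|[|j]] Hj] //=; congr (m _ _); apply/val_inj.
move: E.
case: (m 0 0) => p p'; case: (m 0 1) => q q'; case: (m 1 0) => r r'; case: (m 1 1) => s s' ->.
move=> /eqP; rewrite eq_complex /= => /andP[/eqP h1 /eqP h2].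
move=> /eqP; rewrite eq_complex /= => /andP[/eqP h3 /eqP h4].
move=> /eqP; rewrite eq_complex /= => /andP[/eqP h5 /eqP h6].
move=> /eqP; rewrite eq_complex /= => /andP[/eqP h7 /eqP h8].
have p0 : p = 0 by lra.
have s0 : s = 0 by lra.
have rq : r' = q' by lra.
have sp : s' = - p' by lra.
rewrite p0 s0 h3 rq sp.
apply/matrixP => i j; rewrite !mxE.
case: i => [[|[|i]] Hi] //; case: j => [[|[|j]] Hj] //=; rewrite ?mxE /=;
    apply/eqP; rewrite eq_complex /= ?mxE /=; apply/andP; split; apply/eqP; by field.
Qed.

Lemma vec3_eta (x : su2 R) : x = vec3 (x 0 0) (x 0 1) (x 0 2).
Proof.
apply/rowP => i; rewrite mxE.
by case: i => [[|[|[|i]]] Hi] //=; congr (x _ _); apply/val_inj.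
Qed.

Lemma dotE (x y : su2 R) :
  dot x y = x 0 0 * y 0 0 + x 0 1 * y 0 1 + x 0 2 * y 0 2.
Proof.
rewrite /dot !big_ord_recl big_ord0 addr0 addrA.
by congr (_ * _ + _ * _ + _ * _); congr (_ _ _); apply/val_inj.
Qed.

Definition SU2 : set 'M[R[i]]_2 :=
  [set U | U *m adjmx U = 1%:M /\ \det U = 1].

Definition SL2C : set 'M[R[i]]_2 := [set U | \det U = 1].

(* [y = Ad_U x], and [w = Ad_U z] *)
Definition Ad (U : 'M[R[i]]_2) (x y : g) : Prop :=
  su2_mx y = U *m su2_mx x *m invmx U.

Definition AdC (U : 'M[R[i]]_2) (z w : gC) : Prop :=
  sl2_mx w = U *m sl2_mx z *m invmx U.

Definition adjoint_orbit (O : set gC) : Prop :=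
  exists z, O = [set w | exists2 U, SL2C U & AdC U z w].

Definition regular_orbit (O : set gC) : Prop :=
  exists d, has_dim O d /\
    forall O' d', adjoint_orbit O' -> has_dim O' d' -> (d' <= d)%N.

(* Lie-Poisson structure of g^C, a covector being written as [dotC xi] *)
Definition lie_poisson (z xi eta : gC) : R := dotC z (bracketC xi eta).

Lemma lie_poisson_hamiltonian (z xi v : sl2 R) :
  hamiltonian_vector dotC lie_poisson z xi v <-> v = bracketC z xi.
Proof.
have ad (x y w : sl2 R) : dotC x (bracketC y w) = dotC w (bracketC x y).
  by rewrite /dotC /bracketC /= !dotE !mxE /=; ring.
split=> [h|-> k']; last by rewrite ad.
have {}h k' : dotC k' v = dotC k' (bracketC z xi) by rewrite h -ad.
move: v (bracketC z xi) h => [a b] [c d] h.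
have ev x y t (u : su2 R) : dot (vec3 x y t) u = x * u 0 0 + y * u 0 1 + t * u 0 2.
  by rewrite dotE !mxE.
have ev0 (u : su2 R) : dot 0 u = 0 by rewrite dotE !mxE; ring.
have h1 x y t := h (vec3 x y t, 0).
have h2 x y t := h (0, vec3 x y t).
rewrite (vec3_eta a) (vec3_eta b) (vec3_eta c) (vec3_eta d).
congr (vec3 _ _ _, vec3 _ _ _).
- by have := h1 1 0 0; rewrite /dotC /= !ev !ev0; lra.
- by have := h1 0 1 0; rewrite /dotC /= !ev !ev0; lra.
- by have := h1 0 0 1; rewrite /dotC /= !ev !ev0; lra.
- by have := h2 1 0 0; rewrite /dotC /= !ev !ev0; lra.
- by have := h2 0 1 0; rewrite /dotC /= !ev !ev0; lra.
- by have := h2 0 0 1; rewrite /dotC /= !ev !ev0; lra.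
Qed.

(* The form induced on an adjoint orbit is thus its (co)adjoint orbit form. *)
Lemma lie_poisson_KKS (O : set (sl2 R)) omega (z xi eta : sl2 R) :
  induced_symplectic_form dotC lie_poisson O omega -> O z ->
  omega z (bracketC z xi) (bracketC z eta) = dotC z (bracketC xi eta).
Proof.
by move=> h /h [_]; apply; apply/lie_poisson_hamiltonian.
Qed.

End LieAlgebras.

Section PoissonStructure.
Variable R : realType.
Local Notation g := (su2 R).
Local Notation gC := (sl2 R).
Local Notation g3 := (su2_cube R).
Local Notation M := (Hom_su2 R).

(* The rows of F are e_1, e_2, e_3; the boolean [o] is the fixed orientation
   of the target ([false] for the orientation of su(2) used above). *)
Definition frame (o : bool) (F : 'M[R]_3) : Prop :=
  F *m F^T = 1%:M /\ \det F = (-1) ^+ o.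

Definition Psi (F : 'M[R]_3) (phi : M) : g3 :=
  (row 0 F *m phi^T, row 1 F *m phi^T, row 2 F *m phi^T).

Definition Psi_inv (F : 'M[R]_3) (abc : g3) : M :=
  let: (a, b, c) := abc in
  a^T *m row 0 F + b^T *m row 1 F + c^T *m row 2 F.

Lemma dotEmx (x y : su2 R) : dot x y = (x *m y^T) 0 0.
Proof. by rewrite mxE; apply: eq_bigr => i _; rewrite mxE. Qed.

Lemma sum_rows (F : 'M[R]_3) (u : 'rV[R]_3) :
 u *m F = u 0 0 *: row 0 F + u 0 1 *: row 1 F + u 0 2 *: row 2 F.
Proof.
rewrite mulmx_sum_row !big_ord_recl big_ord0 addr0 addrA.
by congr (_ *: _ + _ *: _ + _ *: _); congr (_ _ _); apply/val_inj.
Qed.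

Lemma Psi_invE F (phi : Hom_su2 R) o : frame o F ->
  Psi_inv F (Psi F phi) = phi.
Proof.
move=> [hF _]; have hF' := mulmx1C hF.
rewrite /Psi_inv /Psi !trmx_mul !trmxK.
rewrite -!mulmxA -!mulmxDr.
suff -> : (row 0 F)^T *m row 0 F + (row 1 F)^T *m row 1 F + (row 2 F)^T *m row 2 F = 1%:M.
  by rewrite mulmx1.
rewrite -hF'; apply/row_matrixP => k.
rewrite row_mul sum_rows !raddfD /= !row_mul.
congr (_ + _ + _); apply/rowP => j; rewrite !mxE big_ord1 !mxE.
all: by [].
Qed.

Lemma PsiP o (F : 'M[R]_3) (phi : Hom_su2 R) (x : su2 R) : frame o F ->
  let: (a, b, c) := Psi F phi in
  x *m phi = dot a x *: row 0 F + dot b x *: row 1 F + dot c x *: row 2 F.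
Proof.
move=> fF; rewrite -{2}(Psi_invE phi fF) /= !mulmxDr !mulmxA.
have h (a e : su2 R) : x *m a^T *m e = dot a x *: e.
  have -> : dot a x = dot x a by apply: eq_bigr => i _; rewrite mulrC.
  by rewrite (mx11_scalar (x *m a^T)) mul_scalar_mx -dotEmx.
by rewrite !h.
Qed.

Definition pr12 (abc : g3) : gC := abc.1.

(* A frame of orientation [o]; the objects defined with it below do not depend
   on this choice. *)
Definition frame0 (o : bool) : 'M[R]_3 := (-1) ^+ o *: 1%:M.

Definition G_orbit (O : set M) : Prop :=
  exists phi, O = [set phi' | exists2 U, SU2 U &
    let: (a, b, c) := Psi 1%:M phi in
    let: (a', b', c') := Psi 1%:M phi' in
    [/\ Ad U a a', Ad U b b' & Ad U c c']].

Definition Phi3 (abc : g3) : R :=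
  let: (a, b, c) := abc in dot a (bracket b c).

Definition X3 (abc : g3) : g3 :=
  let: (a, b, c) := abc in (bracket b c, bracket c a, bracket a b).

Definition Phi (o : bool) (phi : M) : R := Phi3 (Psi (frame0 o) phi).

Lemma det2 (B : 'M[R]_2) : \det B = B 0 0 * B 1 1 - B 0 1 * B 1 0.
Proof.
rewrite (expand_det_row _ 0) !big_ord_recl big_ord0 /cofactor !det_mx11 !mxE /=.
have e00 : lift ord0 ord0 = 1 :> 'I_2 by apply/val_inj.
have e1 : lift 0 0 = 1 :> 'I_2 by apply/val_inj.
have e3 : lift 1 0 = 0 :> 'I_2 by apply/val_inj.
have e0 : ord0 = 0 :> 'I_2 by apply/val_inj.
rewrite ?(e00, e0, e1, e3) /=.
ring.
Qed.

Lemma det3 (B : 'M[R]_3) : \det B = Phi3 (row 0 B, row 1 B, row 2 B).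
Proof.
rewrite (expand_det_row _ 0) !big_ord_recl big_ord0 /cofactor !det2 /= dotE !mxE /=.
have e00 : lift ord0 ord0 = 1 :> 'I_3 by apply/val_inj.
have e01 : lift ord0 (lift ord0 ord0) = 2 :> 'I_3 by apply/val_inj.
have e1 : lift 0 0 = 1 :> 'I_3 by apply/val_inj.
have e2 : lift 0 1 = 2 :> 'I_3 by apply/val_inj.
have e3 : lift 1 0 = 0 :> 'I_3 by apply/val_inj.
have e4 : lift 1 1 = 2 :> 'I_3 by apply/val_inj.
have e5 : lift 2 0 = 0 :> 'I_3 by apply/val_inj.
have e6 : lift 2 1 = 1 :> 'I_3 by apply/val_inj.
have e0 : ord0 = 0 :> 'I_3 by apply/val_inj.
rewrite ?(e01, e00, e0, e1, e2, e3, e4, e5, e6).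
ring.
Qed.

Lemma Phi_det F (phi : Hom_su2 R) : Phi3 (Psi F phi) = \det F * \det phi.
Proof.
by rewrite -[\det phi]det_tr -det_mulmx det3 !row_mul.
Qed.

Lemma Phi_frame o F (phi : Hom_su2 R) : frame o F ->
  Phi3 (Psi F phi) = Phi o phi.
Proof.
move=> [_ hF]; rewrite /Phi !Phi_det hF; congr (_ * _).
by rewrite detZ det1 mulr1; case: (o) => //=; rewrite ?expr0 ?expr1n // expr1 -signr_odd.
Qed.

Definition X_field (o : bool) (phi : M) : M :=
  Psi_inv (frame0 o) (X3 (Psi (frame0 o) phi)).

Definition critical_set (o : bool) : set M :=
  [set phi | forall v, is_derive phi v (Phi o) 0].

(* The flow line of [X_field] through [phi] is defined on ]-oo, 0] and tends
   to [l] at -oo; [e] makes room for the derivative at time 0. *)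
Definition backward_limit (o : bool) (phi l : M) : Prop :=
  exists (gamma : R -> M) (e : R),
    [/\ 0 < e, gamma 0 = phi,
        (forall t, t < e -> is_derive t 1 gamma (X_field o (gamma t))) &
        gamma t @[t --> -oo] --> l].

Definition S_set (o : bool) : set M :=
  [set phi | exists l, backward_limit o phi l].

Definition S_orb (o : bool) (O : set M) : set M :=
  [set phi | S_set o phi /\ exists2 l, O l & backward_limit o phi l].

(* The contraction A_{xi,eta}. At critical points [a0] is chosen; another
   choice could only be [- a0], with the same A. At 0 this gives 0. The norm of
   the library on ['rV_3] is the sup norm, hence the [sqrt]. *)
Definition A_tensor (o : bool) (phi : M) (xi eta : g) : R :=
  if `[< critical_set o phi >] then
    let a0 := xget 0 [set a | exists F, frame o F /\ Psi F phi = (a, 0, 0)] in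
    let n := Num.sqrt (dot a0 a0) in
    n * dot xi eta - n^-1 * (dot a0 xi * dot a0 eta)
  else
    let: (a, b, c) := Psi (frame0 o) phi in
    (Phi o phi)^-1 *
    (dot (bracket a b) xi * dot (bracket a b) eta +
     dot (bracket b c) xi * dot (bracket b c) eta +
     dot (bracket c a) xi * dot (bracket c a) eta).

(* The linear function l^1_{xi1} + l^2_{xi2} + l^3_{xi3}, read through
   [Psi F]. *)
Definition lin3 (F : 'M[R]_3) (xi : g3) (phi : M) : R :=
  let: (xi1, xi2, xi3) := xi in
  let: (a, b, c) := Psi F phi in
  dot xi1 a + dot xi2 b + dot xi3 c.

(* [pi_ o F phi xi eta] is the bracket of [lin3 F xi] and [lin3 F eta] at
   [phi]; the summands are {l^i_{xi i}, l^j_{eta j}}. *)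
Definition pi_ (o : bool) (F : 'M[R]_3) (phi : M) (xi eta : g3) : R :=
  let: (a, b, c) := Psi F phi in
  let: (xi1, xi2, xi3) := xi in
  let: (eta1, eta2, eta3) := eta in
  dot a (bracket xi1 eta1)
  + dot b (bracket xi1 eta2) + dot b (bracket xi2 eta1)
  - dot a (bracket xi2 eta2)
  + dot c (bracket xi1 eta3) + dot c (bracket xi3 eta1)
  - dot a (bracket xi3 eta3)
  + A_tensor o phi xi2 eta3 - A_tensor o phi xi3 eta2.

End PoissonStructure.

(* Main.v *)
From HB Require Import structures.
Require Import Defs.
From mathcomp Require Import all_boot all_order all_algebra.
From mathcomp Require Import all_classical all_reals all_analysis.
From mathcomp Require Import complex ring lra.

(* A point of L(su(2), su(2)) is read in the frame F as a triple (a, b, c). Along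
   the gradient flow of Phi the Gram matrix of (a, b, c) only changes by a
   multiple of the identity, so a point whose backward limit is
   (al w, be w, ga w), |w| = 1, has Gram matrix u u^T + s I with
   u = (al, be, ga), s >= 0 and Phi = s sqrt(s + |u|^2) >= 0. Conversely the flow
   through such a point is explicit (coth and 1/sinh) and converges to a point of
   this form. These equations determine c from (a, b): if al^2 + be^2 > 0, which
   is what regularity of O12 means, they say that a + ib lies on the complex
   quadric z.z = (al + i be)^2, which is O12, and that c is a function of (a, b)
   that is smooth on all of g^C. So S_O is a graph over O12.

   For the symplectic part, A maps a, b, c to [b,c], [c,a], [a,b], so that
   Hamiltonian vectors satisfy the linearized Gram equations; when s > 0 this
   makes them tangent, and critical points are treated directly. The vectors of
   the l^1 and l^2 functions project to those of g^C and already span the tangent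
   space of the graph, on which the two forms therefore agree. *)

Set Implicit Arguments.
Unset Strict Implicit.
Unset Printing Implicit Defensive.

Import Order.TTheory GRing.Theory Num.Theory.
Import numFieldNormedType.Exports.

Local Open Scope classical_set_scope.
Local Open Scope ring_scope.

(** * Smooth maps and derivatives *)

(** The obstacle is the critical orbit itself, where s = 0. There a, b, c are proportional, A is
    given by its other formula, and the linearized Gram equations, which only control pairings with
    a, b, c, do not determine a vector. So a Hamiltonian vector is not shown to be tangent by
    integrating it. It is compared with the tangent vector that has the same first two components,
    obtained by lifting a curve of O12 through the smooth graph; only the third components remain to
    be matched. For s > 0 their pairings with a, b, c decide; for s = 0 both satisfy the derivative
    of p c = ga (al a + be b) + sg [a, b], where p = s + al^2 + be^2 and sg^2 = s + |u|^2. The lift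
    needs a curve in O12 with any prescribed velocity [z, xi]. Since sl(2,C) is spanned by isotropic
    elements, whose adjoint action is nilpotent, such curves can be taken polynomial in t. *)

Section Smoothness.
Variable R : realType.
Implicit Types V W Z : normedModType R.

(** Only a directional derivative of [f] is given, so the chain rule for differentials does not
    apply; instead [L] commutes with the difference quotients and passes to their limit. *)
Lemma is_derive_linear V W Z (L : W -> Z) (f : V -> W) x v df :
  linear L -> continuous L -> is_derive x v f df ->
  is_derive x v (L \o f) (L df).
Proof.
move=> linL cL [/cvg_ex [l fl] fdf].
have {fdf} ldf : l = df by rewrite -fdf; apply/esym/cvg_lim.
subst l.
pose M := GRing.isLinear.Build _ _ _ _ _ linL.
pose L' : {linear W -> Z} := HB.pack L M.
have LB k u w : L (k *: (u - w)) = k *: (L u - L w).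
  by have : L' (k *: (u - w)) = k *: (L' u - L' w) by rewrite linearZ linearB.
have h : h^-1 *: (((L \o f) \o shift x) (h *: v) - (L \o f) x) @[h --> 0^']
    --> L df.
  have -> : (fun h : R => h^-1 *: (((L \o f) \o shift x) (h *: v) - (L \o f) x))
     = L \o (fun h : R => h^-1 *: ((f \o shift x) (h *: v) - f x)).
    by apply/funext => h; rewrite /= LB.
  by apply: continuous_cvg; [exact: cL|exact: fl].
by split; [apply/cvg_ex; exists (L df)|apply/cvg_lim].
Qed.

Lemma continuous_linear_diff V W (L : V -> W) x :
  linear L -> continuous L -> differentiable L x.
Proof.
move=> linL cL.
pose M := GRing.isLinear.Build _ _ _ _ _ linL.
pose L' : {linear V -> W} := HB.pack L M.
exact: (@linear_differentiable _ _ _ L').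
Qed.

Lemma derive_linear V W (L : V -> W) x v :
  linear L -> continuous L -> 'D_v L x = L v.
Proof.
move=> linL cL.
have h : is_derive x v (L \o id) (L v) by apply: is_derive_linear.
exact: (@derive_val _ _ _ _ _ _ _ h).
Qed.

Lemma Ck_S V W k (U : set V) (f : V -> W) : Ck k.+1 U f -> Ck k U f.
Proof.
elim: k f => [|k IH] f [h1 h2].
  by move=> x Ux; apply: differentiable_continuous; apply: h1.
by split=> // v; apply: IH.
Qed.

Lemma Ck_subset V W k (U U' : set V) (f : V -> W) :
  U' `<=` U -> Ck k U f -> Ck k U' f.
Proof.
move=> UU'; elim: k f => [|k IH] f; first by move=> h x /UU' /h.
by move=> [h1 h2]; split=> [x /UU' /h1 //|v]; apply: IH; apply: h2.
Qed.

Lemma smooth_cst V W (c : W) : smooth_on setT (fun _ : V => c).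
Proof.
move=> k; elim: k c => [|k IH] c; first by move=> x _; apply: cst_continuous.
split=> [x _|v]; first exact: differentiable_cst.
have -> : 'D_v (fun _ : V => c) = fun _ => 0.
  by apply/funext => x; apply: derive_cst.
exact: IH.
Qed.

Lemma smooth_linear V W (L : V -> W) :
  linear L -> continuous L -> smooth_on setT L.
Proof.
move=> linL cL [|k]; first by move=> x _; apply: cL.
split=> [x _|v]; first exact: continuous_linear_diff.
have -> : 'D_v L = fun _ => L v by apply/funext => x; apply: derive_linear.
exact: smooth_cst.
Qed.

Lemma Ck_linear_comp V W Z (L : W -> Z) k (f : V -> W) :
  linear L -> continuous L -> Ck k setT f -> Ck k setT (L \o f).
Proof.
move=> linL cL; elim: k f => [|k IH] f.
  by move=> h x _; apply: (@continuous_comp _ _ _ f L); [exact: h|exact: cL].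
move=> [h1 h2]; split=> [x _|v].
  by apply: differentiable_comp; [apply: h1|apply: continuous_linear_diff].
have -> : 'D_v (L \o f) = L \o 'D_v f; last exact/IH/h2.
apply/funext => x.
have h : is_derive x v (L \o f) (L ('D_v f x)).
  by apply: is_derive_linear => //; apply/derivableP/diff_derivable/h1.
exact: (@derive_val _ _ _ _ _ _ _ h).
Qed.

Lemma CkD V W k (f g : V -> W) :
  Ck k setT f -> Ck k setT g -> Ck k setT (f + g).
Proof.
elim: k f g => [|k IH] f g.
  by move=> hf hg x _; apply: continuousD; [apply: hf|apply: hg].
move=> [f1 f2] [g1 g2]; split=> [x _|v].
  by apply: differentiableD; [apply: f1|apply: g1].
have -> : 'D_v (f + g) = 'D_v f + 'D_v g; last by apply: IH; [apply: f2|apply: g2].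
by apply/funext => x; apply: deriveD; apply: diff_derivable; [apply: f1|apply: g1].
Qed.

Lemma CkM V k (f g : V -> R) :
  Ck k setT f -> Ck k setT g -> Ck k setT (f * g).
Proof.
elim: k f g => [|k IH] f g.
  by move=> hf hg x _; apply: continuousM; [apply: hf|apply: hg].
move=> hf hg; have [f1 f2] := hf; have [g1 g2] := hg; split=> [x _|v].
  by apply: differentiableM; [apply: f1|apply: g1].
have -> : 'D_v (f * g) = f * 'D_v g + g * 'D_v f.
  by apply/funext => x; apply: deriveM; apply: diff_derivable; [apply: f1|apply: g1].
by apply: CkD; apply: IH; [exact: Ck_S|exact: g2|exact: Ck_S|exact: f2].
Qed.

(** The derivative -(1/f)^2 D f contains 1/f itself, which is one order less smooth by the induction
    hypothesis, and that is enough. *)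
Lemma CkV V k (f : V -> R) : (forall x, f x != 0) ->
  Ck k setT f -> Ck k setT (fun x => (f x)^-1).
Proof.
move=> f0; elim: k => [|k IH].
  by move=> hf x _; apply: continuousV; [apply: f0|apply: hf].
move=> hf; have [f1 f2] := hf; split=> [x _|v].
  by apply: differentiableV; [apply: f1|apply: f0].
have -> : 'D_v (fun x => (f x)^-1) =
    (fun=> -1) * ((fun x => (f x)^-1) * (fun x => (f x)^-1)) * 'D_v f.
  apply/funext => x; rewrite deriveV //; last exact/diff_derivable/f1.
  rewrite expr2.
  rewrite invfM.
  by transitivity (-1 * ((f x)^-1 * (f x)^-1) * 'D_v f x); first rewrite mulN1r.
have h := IH (Ck_S hf).
by apply: CkM; [apply: CkM; [exact: smooth_cst|exact: CkM]|exact: f2].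
Qed.

(** Same induction as for the inverse, with derivative (1/2) (1/sqrt f) D f; positivity of [f]
    avoids the point where the root is not differentiable. *)
Lemma Ck_sqrt V k (f : V -> R) : (forall x, 0 < f x) ->
  Ck k setT f -> Ck k setT (fun x => Num.sqrt (f x)).
Proof.
move=> f0; elim: k => [|k IH].
  move=> hf x _; apply: (@continuous_comp _ _ _ f); first exact: hf.
  exact: sqrt_continuous.
move=> hf; have [f1 f2] := hf.
have df x : is_diff (f x) Num.sqrt ( *:%R^~ (2 * Num.sqrt (f x))^-1).
  have h := is_derive1_sqrt (f0 x).
  have d1 : differentiable Num.sqrt (f x) by apply/derivable1_diffP; case: h.
  by apply: DiffDef => //; rewrite diff1E // derive1E (@derive_val _ _ _ _ _ _ _ h).
have ds x : differentiable (fun x => Num.sqrt (f x)) x.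
  by apply: (@differentiable_comp _ _ _ _ f); [apply: f1|case: (df x)].
split=> // v.
have -> : 'D_v (fun x => Num.sqrt (f x)) =
    (fun=> 2^-1) * (fun x => (Num.sqrt (f x))^-1) * 'D_v f.
  apply/funext => x; rewrite deriveE //.
  have [d1 d2] := df x.
  rewrite (diff_comp (f1 x I) d1) /= d2 -deriveE ?[LHS]/(_ * _); last exact: f1.
  by rewrite mulrC invfM.
apply: CkM; last exact: f2.
apply: CkM; first exact: smooth_cst.
apply: CkV; last exact: IH (Ck_S hf).
by move=> x; rewrite gt_eqF // sqrtr_gt0.
Qed.

End Smoothness.

(** * Smoothness and derivatives in coordinates; limits at -oo *)

Section Coordinates.
Variable R : realType.
Implicit Types V W : normedModType R.

Lemma smoothD V W (f g : V -> W) : smooth_on setT f -> smooth_on setT g ->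
  smooth_on setT (fun x => f x + g x).
Proof. by move=> hf hg k; apply: CkD; [apply: hf|apply: hg]. Qed.

Lemma smoothB V W (f h : V -> W) : smooth_on setT f -> smooth_on setT h ->
  smooth_on setT (fun x => f x - h x).
Proof.
move=> hf hh; apply: smoothD => // k.
apply: (@Ck_linear_comp _ _ _ _ (fun w : W => - w)); last exact: hh.
  by move=> r x y; rewrite scalerN opprD.
exact: opp_continuous.
Qed.

Lemma smoothM V (f g : V -> R) : smooth_on setT f -> smooth_on setT g ->
  smooth_on setT (fun x => f x * g x).
Proof. by move=> hf hg k; apply: CkM; [apply: hf|apply: hg]. Qed.

Lemma smooth_sum V W (I : Type) (r : seq I) (f : I -> V -> W) :
  (forall i, smooth_on setT (f i)) -> smooth_on setT (fun x => \sum_(i <- r) f i x).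
Proof.
move=> hf; elim: r => [|i r IH].
  have -> : (fun x => \sum_(i <- [::]) f i x) = fun _ => 0.
    by apply/funext => x; rewrite big_nil.
  exact: smooth_cst.
have -> : (fun x => \sum_(j <- i :: r) f j x) =
    fun x => f i x + \sum_(j <- r) f j x.
  by apply/funext => x; rewrite big_cons.
exact: smoothD.
Qed.

Lemma linear_mx_continuous m n W (L : 'M[R]_(m.+1, n.+1) -> W) :
  linear L -> continuous L.
Proof.
move=> linL.
pose M := GRing.isLinear.Build _ _ _ _ _ linL.
pose L' : {linear 'M[R]_(m.+1, n.+1) -> W} := HB.pack L M.
have -> : L = \sum_i \sum_j (fun A : 'M[R]_(m.+1, n.+1) => A i j *: L (delta_mx i j)).
  apply/funext => A; rewrite -[LHS]/(L' A) [in LHS](matrix_sum_delta A).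
  rewrite linear_sum fct_sumE; apply: eq_bigr => i _.
  by rewrite linear_sum fct_sumE; apply: eq_bigr => j _; rewrite linearZ.
move=> A; apply: differentiable_continuous.
do 2 (apply: differentiable_sum => ?).
exact/differentiableZl/differentiable_coord.
Qed.

Lemma smooth_linear_mx m n W (L : 'M[R]_(m.+1, n.+1) -> W) :
  linear L -> smooth_on setT L.
Proof. by move=> linL; apply: smooth_linear => //; apply: linear_mx_continuous. Qed.

Lemma smooth_scalel V W (f : V -> R) (w : W) : smooth_on setT f ->
  smooth_on setT (fun x => f x *: w).
Proof.
move=> hf k.
apply: (@Ck_linear_comp _ _ _ _ (fun r : R => r *: w)); last exact: hf.
  by move=> a x y; rewrite scalerDl scalerA.
exact: scalel_continuous.
Qed.

Lemma smooth_mx V m n (f : V -> 'M[R]_(m.+1, n.+1)) :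
  (forall i j, smooth_on setT (fun x => f x i j)) -> smooth_on setT f.
Proof.
move=> hf.
have -> : f = fun x => \sum_i \sum_j f x i j *: delta_mx i j.
  by apply/funext => x; apply: matrix_sum_delta.
by apply: smooth_sum => i; apply: smooth_sum => j; apply: smooth_scalel.
Qed.

Lemma smooth_coord V m n (f : V -> 'M[R]_(m.+1, n.+1)) i j :
  smooth_on setT f -> smooth_on setT (fun x => f x i j).
Proof.
move=> hf k.
apply: (@Ck_linear_comp _ _ _ _ (fun A : 'M[R]_(m.+1, n.+1) => A i j)); last exact: hf.
  by move=> a x y; rewrite !mxE.
exact: coord_continuous.
Qed.

Lemma smooth_pair V W1 W2 (f : V -> W1) (g : V -> W2) :
  smooth_on setT f -> smooth_on setT g -> smooth_on setT (fun x => (f x, g x)).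
Proof.
move=> hf hg.
have -> : (fun x => (f x, g x)) = (fun x => (f x, 0) + (0, g x)).
  by apply/funext => x; rewrite -[RHS]/(f x + 0, 0 + g x) addr0 add0r.
apply: smoothD => k.
  apply: (@Ck_linear_comp _ _ _ _ (fun w : W1 => (w, 0 : W2))); last exact: hf.
    by move=> a x y; rewrite -[RHS]/(a *: x + y, a *: 0 + 0) scaler0 addr0.
  by move=> w; apply: cvg_pair; [exact: cvg_id|exact: cvg_cst].
apply: (@Ck_linear_comp _ _ _ _ (fun w : W2 => (0 : W1, w))); last exact: hg.
  by move=> a x y; rewrite -[RHS]/(a *: 0 + 0, a *: x + y) scaler0 addr0.
by move=> w; apply: cvg_pair; [exact: cvg_cst|exact: cvg_id].
Qed.

Lemma is_derive_mx V m n (f : V -> 'M[R]_(m.+1, n.+1)) x v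
  (df : 'M[R]_(m.+1, n.+1)) :
  (forall i j, is_derive x v (fun y => f y i j) (df i j)) -> is_derive x v f df.
Proof.
move=> h.
have d : derivable f x v by apply/derivable_mxP => i j; case: (h i j).
apply: DeriveDef => //; rewrite derive_mx //.
by apply/matrixP => i j; rewrite mxE; case: (h i j).
Qed.

Lemma is_derive_coord V m n (f : V -> 'M[R]_(m.+1, n.+1)) x v
  (df : 'M[R]_(m.+1, n.+1)) i j :
  is_derive x v f df -> is_derive x v (fun y => f y i j) (df i j).
Proof.
apply: (@is_derive_linear _ _ _ _ (fun A : 'M[R]_(m.+1, n.+1) => A i j)).
  by move=> a A B; rewrite !mxE.
exact: coord_continuous.
Qed.

Lemma is_derive_pair V W1 W2 (f : V -> W1) (g : V -> W2) x v df dg :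
  is_derive x v f df -> is_derive x v g dg ->
  is_derive x v (fun y => (f y, g y)) (df, dg).
Proof.
move=> hf hg.
have -> : (fun x => (f x, g x)) = (fun x => (f x, 0)) + (fun x => (0, g x)).
  by apply/funext => y; rewrite -[RHS]/(f y + 0, 0 + g y) addr0 add0r.
have -> : (df, dg) = (df, 0) + (0, dg).
  by rewrite -[RHS]/(df + 0, 0 + dg) addr0 add0r.
apply: is_deriveD.
  apply: (@is_derive_linear _ _ _ _ (fun w : W1 => (w, 0 : W2))).
    by move=> a u w; rewrite -[RHS]/(a *: u + w, a *: 0 + 0) scaler0 addr0.
  by move=> w; apply: cvg_pair; [exact: cvg_id|exact: cvg_cst].
apply: (@is_derive_linear _ _ _ _ (fun w : W2 => (0 : W1, w))).
  by move=> a u w; rewrite -[RHS]/(a *: 0 + 0, a *: u + w) scaler0 addr0.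
by move=> w; apply: cvg_pair; [exact: cvg_cst|exact: cvg_id].
Qed.

(* By the mean value theorem, [f t <= f 0] for [t <= 0]. *)
Lemma ge0_derive_lim_ninfty_le (f f' : R -> R) (e l : R) : 0 < e ->
  (forall t, t < e -> is_derive t 1 f (f' t)) ->
  (forall t, t < e -> 0 <= f' t) ->
  f t @[t --> -oo] --> l -> l <= f 0.
Proof.
move=> e0 df f'0 fl; apply: (cvgr_to_le fl).
exists 0; split => // t t0.
have D x : x \in `]t, 0[%R -> is_derive x 1 f (f' x).
  by rewrite in_itv /= => /andP[_ x0]; apply: df; apply: lt_trans e0.
have C : {within `[t, 0], continuous f}.
  apply: derivable_within_continuous => x; rewrite in_itv /= => /andP[_ x0].
  by apply: ex_derive; apply: df; apply: le_lt_trans e0.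
have [c] := MVT t0 D C.
rewrite in_itv /= => /andP[_ c0] h; rewrite -subr_ge0 h.
by apply: mulr_ge0; [apply: f'0; lra|lra].
Qed.

Lemma derive0_lim_ninfty (f : R -> R) (e l : R) : 0 < e ->
  (forall t, t < e -> is_derive t 1 f 0) ->
  f t @[t --> -oo] --> l -> f 0 = l.
Proof.
move=> e0 df fl; apply/eqP; rewrite eq_le; apply/andP; split.
  rewrite -lerN2; apply: (@ge0_derive_lim_ninfty_le (- f) (fun _ => 0) e) => //.
    by move=> t te; rewrite -oppr0; apply: is_deriveN; apply: df.
  exact: cvgN.
exact: (@ge0_derive_lim_ninfty_le f (fun _ => 0) e).
Qed.

End Coordinates.

(** * Frames, the function Phi and the tensor A *)

Section Su2Algebra.
Variable R : realType.
Local Notation g := (su2 R).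
Local Notation g3 := (su2_cube R).
Local Notation M := (Hom_su2 R).
Implicit Types (a b c x y z : g) (F : 'M[R]_3) (phi : M) (o : bool).

Lemma su2_eq x y :
  x 0 0 = y 0 0 -> x 0 1 = y 0 1 -> x 0 2 = y 0 2 -> x = y.
Proof. by move=> h0 h1 h2; rewrite (vec3_eta x) h0 h1 h2 -vec3_eta. Qed.

Lemma dot_comm x y : dot x y = dot y x.
Proof. by rewrite !dotE; ring. Qed.

Lemma dotDl x y z : dot (x + y) z = dot x z + dot y z.
Proof. by rewrite !dotE !mxE; ring. Qed.

Lemma dotZl k x y : dot (k *: x) y = k * dot x y.
Proof. by rewrite !dotE !mxE; ring. Qed.

Lemma dotDr x y z : dot x (y + z) = dot x y + dot x z.
Proof. by rewrite !dotE !mxE; ring. Qed.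

Lemma dotBr x y z : dot x (y - z) = dot x y - dot x z.
Proof. by rewrite !dotE !mxE; ring. Qed.

Lemma dotZr k x y : dot x (k *: y) = k * dot x y.
Proof. by rewrite !dotE !mxE; ring. Qed.

Lemma dot0l x : dot 0 x = 0.
Proof. by rewrite !dotE !mxE; ring. Qed.

Lemma dot0r x : dot x 0 = 0.
Proof. by rewrite !dotE !mxE; ring. Qed.

Lemma dot_ge0 x : 0 <= dot x x.
Proof. by rewrite dotE -!expr2 !addr_ge0 ?sqr_ge0. Qed.

Lemma dot_eq0 x : dot x x = 0 -> x = 0.
Proof.
rewrite dotE -!expr2 => h.
have := sqr_ge0 (x 0 0); have := sqr_ge0 (x 0 1); have := sqr_ge0 (x 0 2).
move=> h2 h1 h0.
by apply: su2_eq; rewrite mxE; apply/eqP; rewrite -sqrf_eq0; apply/eqP; lra.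
Qed.

Lemma dot_inj x y : (forall z, dot z x = dot z y) -> x = y.
Proof.
move=> h; apply/subr0_eq/dot_eq0.
by rewrite dotBr h subrr.
Qed.

(** Cramer's rule: up to the factor Phi, [b,c], [c,a], [a,b] is the dual basis of a, b, c. *)
Lemma cross_basis a b c x : Phi3 (a, b, c) *: x =
  dot a x *: bracket b c + dot b x *: bracket c a + dot c x *: bracket a b.
Proof.
by apply: su2_eq; rewrite /Phi3 !(dotE, mxE) /=; ring.
Qed.

Lemma dot_triple_eq0 a b c x : Phi3 (a, b, c) != 0 ->
  dot a x = 0 -> dot b x = 0 -> dot c x = 0 -> x = 0.
Proof.
move=> P0 h1 h2 h3; have := cross_basis a b c x.
rewrite h1 h2 h3 !scale0r !addr0 => /eqP; rewrite scaler_eq0 (negPf P0) /=.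
by move/eqP.
Qed.

Lemma bracket_lagrange a b c d : dot (bracket a b) (bracket c d) =
  dot a c * dot b d - dot a d * dot b c.
Proof. by rewrite !(dotE, mxE) /=; ring. Qed.

Lemma dot_bracketl a b c : dot (bracket a b) c = dot a (bracket b c).
Proof. by rewrite !(dotE, mxE) /=; ring. Qed.

Lemma dot_bracket_cyc a b c : dot a (bracket b c) = dot b (bracket c a).
Proof. by rewrite !(dotE, mxE) /=; ring. Qed.

Lemma bracket_anti a b : bracket a b = - bracket b a.
Proof. by apply: su2_eq; rewrite !mxE /=; ring. Qed.

Lemma PsiE F phi : Psi F phi =
  (row 0 F *m phi^T, row 1 F *m phi^T, row 2 F *m phi^T).
Proof. by []. Qed.

Lemma row_mul3 (i : 'I_3) F (B : 'M[R]_3) : row i F *m B =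
  F i 0 *: row 0 B + F i 1 *: row 1 B + F i 2 *: row 2 B.
Proof. by rewrite sum_rows !mxE. Qed.

Lemma frame_dot o F (i j : 'I_3) : frame o F ->
  dot (row i F) (row j F) = (i == j)%:R.
Proof.
move=> [h _]; rewrite dotEmx; have := congr1 (fun A : 'M[R]_3 => A i j) h.
by rewrite -[row j F]/(row j F) tr_row !mxE => <-; apply: eq_bigr => k _; rewrite !mxE.
Qed.

Lemma frame_Phi3 o F : frame o F ->
  Phi3 (row 0 F, row 1 F, row 2 F) = (-1) ^+ o.
Proof. by move=> [_ <-]; rewrite det3. Qed.

Lemma signK o : (-1) ^+ o * (-1) ^+ o = 1 :> R.
Proof. by case: o => /=; rewrite ?expr0 ?mulr1 // expr1 mulrNN mulr1. Qed.

(** The squared norm of the difference is 1 - 2 e^2 + e^2 = 0, by Lagrange's identity. *)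
Lemma unit_cross a b c (e : R) : e * e = 1 ->
  dot a a = 1 -> dot b b = 1 -> dot c c = 1 -> dot b c = 0 ->
  Phi3 (a, b, c) = e -> bracket b c = e *: a.
Proof.
rewrite /Phi3 => ee aa bb cc bc abc; apply/subr0_eq/dot_eq0.
have -> : dot (bracket b c - e *: a) (bracket b c - e *: a) =
    dot b b * dot c c - dot b c * dot b c - 2 * e * dot a (bracket b c)
    + e * e * dot a a by rewrite !(dotE, mxE) /=; ring.
by rewrite abc aa bb cc bc -mulrA ee; ring.
Qed.

Lemma frame_cross o F : frame o F ->
  [/\ bracket (row 1 F) (row 2 F) = (-1) ^+ o *: row 0 F,
      bracket (row 2 F) (row 0 F) = (-1) ^+ o *: row 1 F &
      bracket (row 0 F) (row 1 F) = (-1) ^+ o *: row 2 F].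
Proof.
move=> fF; have d := frame_dot _ _ fF; have P := frame_Phi3 fF.
split; apply: unit_cross; rewrite ?d ?signK //= -P /Phi3 //.
  by rewrite -dot_bracket_cyc.
by rewrite dot_bracket_cyc.
Qed.

(** The brackets of combinations of the rows of [B] have the 2 x 2 minors of [F] as coefficients,
    and the cofactor matrix of an orthogonal [F] is (det F) F. *)
Lemma X3_frame o F (B : 'M[R]_3) : frame o F ->
  let K := [:: bracket (row 1 B) (row 2 B); bracket (row 2 B) (row 0 B);
               bracket (row 0 B) (row 1 B)] in
  let L i := (-1) ^+ o *: (F i 0 *: K`_0 + F i 1 *: K`_1 + F i 2 *: K`_2) in
  X3 (row 0 F *m B, row 1 F *m B, row 2 F *m B) = (L 0, L 1, L 2).
Proof.
move=> fF /=; have [h0 h1 h2] := frame_cross fF.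
have E (i j k : 'I_3) : bracket (row i F) (row j F) = (-1) ^+ o *: row k F ->
  bracket (row i F *m B) (row j F *m B) =
  (-1) ^+ o *: (F k 0 *: bracket (row 1 B) (row 2 B) +
    F k 1 *: bracket (row 2 B) (row 0 B) + F k 2 *: bracket (row 0 B) (row 1 B)).
  move=> h.
  have e0 := congr1 (fun x : g => x 0 0) h.
  have e1 := congr1 (fun x : g => x 0 1) h.
  have e2 := congr1 (fun x : g => x 0 2) h.
  rewrite !mxE /= in e0 e1 e2.
  rewrite !row_mul3 !scalerDr !scalerA -e0 -e1 -e2.
  by apply: su2_eq; rewrite !mxE /=; ring.
by rewrite /X3 (E _ _ _ h0) (E _ _ _ h1) (E _ _ _ h2).
Qed.

Lemma Psi_invK o F (abc : g3) : frame o F -> Psi F (Psi_inv F abc) = abc.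
Proof.
move=> fF; case: abc => [[a b] c]; rewrite /Psi /Psi_inv !linearD /= !trmx_mul !trmxK.
rewrite !mulmxA.
have h i j : row i F *m (row j F)^T = (i == j)%:R%:M.
  by rewrite [LHS]mx11_scalar -dotEmx (frame_dot _ _ fF).
by rewrite !h /= !mul_scalar_mx !scale1r !scale0r !addr0 !add0r.
Qed.

Lemma Psi_inj o F phi psi : frame o F -> Psi F phi = Psi F psi -> phi = psi.
Proof. by move=> fF h; rewrite -(Psi_invE phi fF) h (Psi_invE _ fF). Qed.

Lemma frame0_frame o : frame o (frame0 R o).
Proof.
split.
  by rewrite /frame0 linearZ /= -scalemxAl -scalemxAr scalerA signK scale1r mul1mx trmx1.
rewrite /frame0 detZ det1 mulr1.
by case: o => //=; rewrite ?expr0 ?expr1n // expr1 -signr_odd.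
Qed.

Lemma row_frame0 o (i : 'I_3) (B : 'M[R]_3) : row i (frame0 R o) *m B = (-1) ^+ o *: row i B.
Proof. by rewrite /frame0 -row_mul -scalemxAl mul1mx linearZ. Qed.

Lemma Psi_frame0 o phi : Psi (frame0 R o) phi =
  ((-1) ^+ o *: row 0 phi^T, (-1) ^+ o *: row 1 phi^T, (-1) ^+ o *: row 2 phi^T).
Proof. by rewrite PsiE !row_frame0. Qed.

Lemma bracketZ (k l : R) x y : bracket (k *: x) (l *: y) = (k * l) *: bracket x y.
Proof. by apply: su2_eq; rewrite !mxE /=; ring. Qed.

(** Since [X3] is quadratic, the sign of [frame0] disappears inside it and enters once, through
    [Psi_inv]; there it matches the sign of [X3_frame]. *)
Lemma Psi_X_field o F phi : frame o F -> Psi F (X_field o phi) = X3 (Psi F phi).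
Proof.
move=> fF; rewrite [RHS](X3_frame phi^T fF) /X_field Psi_frame0 /= !bracketZ signK !scale1r.
have E i (a b c : g) : row i F *m
   (a^T *m row 0 (frame0 R o) + b^T *m row 1 (frame0 R o) + c^T *m row 2 (frame0 R o))^T =
   (-1) ^+ o *: (F i 0 *: a + F i 1 *: b + F i 2 *: c).
  rewrite !linearD /= !trmx_mul !trmxK !mulmxA.
  have e j : row i F *m (row j (frame0 R o))^T = ((-1) ^+ o * F i j)%:M.
    rewrite [LHS]mx11_scalar -dotEmx /frame0; congr (_%:M).
    rewrite linearZ /= dotZr row1; congr (_ * _).
    rewrite /dot (bigD1 j) //= big1 ?addr0 ?mxE ?eqxx ?mulr1 //.
    by move=> k kj; rewrite !mxE eqxx (negPf kj) mulr0.
  by rewrite !e !mul_scalar_mx !scalerA.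
by rewrite /Psi !E.
Qed.

End Su2Algebra.

(** * The gradient of Phi and the tensor A in an arbitrary frame *)

Section Tensor.
Variable R : realType.
Local Notation g := (su2 R).
Local Notation M := (Hom_su2 R).
Implicit Types (a b c w : g) (F : 'M[R]_3) (phi : M) (o : bool).
Implicit Types V W : normedModType R.

Lemma is_derive_mul V (f h : V -> R) x v df dh :
  is_derive x v f df -> is_derive x v h dh ->
  is_derive x v (fun y => f y * h y) (df * h x + f x * dh).
Proof.
by move=> hf hh; apply: is_derive_eq; rewrite addrC [h x *: df]mulrC.
Qed.

Lemma is_derive_add V W (f h : V -> W) x v (df dh : W) :
  is_derive x v f df -> is_derive x v h dh ->
  is_derive x v (fun y => f y + h y : W) (df + dh).
Proof. by move=> hf hh; apply: is_deriveD. Qed.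

Lemma is_derive_sub V W (f h : V -> W) x v (df dh : W) :
  is_derive x v f df -> is_derive x v h dh ->
  is_derive x v (fun y => f y - h y : W) (df - dh).
Proof. by move=> hf hh; apply: is_deriveB. Qed.

Lemma is_derive_scale V (f : V -> R) (h : V -> g) x v df (dh : g) :
  is_derive x v f df -> is_derive x v h dh ->
  is_derive x v (fun y => f y *: h y) (df *: h x + f x *: dh).
Proof.
move=> hf hh; apply: is_derive_mx => i j; rewrite !mxE.
have := is_derive_mul hf (is_derive_coord i j hh).
by congr is_derive; apply/funext => y; rewrite !mxE.
Qed.

Lemma is_derive_dot V (f h : V -> g) x v (df dh : g) :
  is_derive x v f df -> is_derive x v h dh ->
  is_derive x v (fun y => dot (f y) (h y)) (dot df (h x) + dot (f x) dh).
Proof.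
move=> hf hh.
have E i := is_derive_mul (is_derive_coord 0 i hf) (is_derive_coord 0 i hh).
have := is_derive_add (is_derive_add (E 0) (E 1)) (E 2).
congr is_derive; last by rewrite !dotE; ring.
by apply/funext => y; rewrite dotE.
Qed.

Lemma is_derive_bracket V (f h : V -> g) x v (df dh : g) :
  is_derive x v f df -> is_derive x v h dh ->
  is_derive x v (fun y => bracket (f y) (h y))
    (bracket df (h x) + bracket (f x) dh).
Proof.
move=> hf hh.
have E i j := is_derive_mul (is_derive_coord 0 i hf) (is_derive_coord 0 j hh).
have E' i j := is_derive_sub (E i j) (E j i).
apply: is_derive_mx => i j; rewrite (ord1 i).
by case: j => [[|[|[|j]]] hj] //=; [have := E' 1 2|have := E' 2 0|have := E' 0 1];
  congr is_derive; rewrite ?mxE /=; try ring;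
  apply/funext => y; rewrite mxE /=; ring.
Qed.

Lemma Psi_linear F : linear (Psi F).
Proof.
move=> k phi psi; rewrite /Psi linearP /= !mulmxDr -!scalemxAr.
by [].
Qed.

Lemma is_derive_Psi V F (f : V -> M) x v (df : M) da db dc :
  is_derive x v f df -> Psi F df = (da, db, dc) ->
  [/\ is_derive x v (fun y => (Psi F (f y)).1.1) da,
      is_derive x v (fun y => (Psi F (f y)).1.2) db &
      is_derive x v (fun y => (Psi F (f y)).2) dc].
Proof.
move=> hf [<- <- <-].
have E (i : 'I_3) : is_derive x v (fun y => row i F *m (f y)^T : g) (row i F *m df^T).
  apply: (@is_derive_linear _ _ _ _ (fun A : M => row i F *m A^T : g)) => //.
    by move=> k A B; rewrite linearP /= mulmxDr scalemxAr.
  by apply: linear_mx_continuous => k A B; rewrite linearP /= mulmxDr scalemxAr.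
by split; apply: E.
Qed.

Lemma is_derive_Phi o F phi v a b c da db dc : frame o F ->
  Psi F phi = (a, b, c) -> Psi F v = (da, db, dc) ->
  is_derive phi v (Phi o)
    (dot da (bracket b c) + dot db (bracket c a) + dot dc (bracket a b)).
Proof.
move=> fF phiE vE.
have -> : Phi o = fun psi => dot (Psi F psi).1.1 (bracket (Psi F psi).1.2 (Psi F psi).2).
  by apply/funext => psi; rewrite -(Phi_frame psi fF).
have [ha hb hc] := is_derive_Psi (is_derive_id phi v) vE.
have := is_derive_dot ha (is_derive_bracket hb hc).
congr is_derive; rewrite phiE /= dotDr -addrA; congr (_ + (_ + _)).
  exact: dot_bracket_cyc.
by rewrite -dot_bracket_cyc.
Qed.

Lemma critical_setP o F phi : frame o F ->
  critical_set o phi <-> X3 (Psi F phi) = (0, 0, 0).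
Proof.
move=> fF; split=> [h|h v].
  case E : (Psi F phi) => [[a b] c].
  have H x y z : dot x (bracket b c) + dot y (bracket c a) + dot z (bracket a b) = 0.
    have h1 := is_derive_Phi fF E (Psi_invK (x, y, z) fF).
    by rewrite -(@derive_val _ _ _ _ _ _ _ h1); case: (h (Psi_inv F (x, y, z))).
  congr (_, _, _); apply: dot_eq0.
  - by have := H (bracket b c) 0 0; rewrite !dot0l !addr0.
  - by have := H 0 (bracket c a) 0; rewrite !dot0l addr0 add0r.
  - by have := H 0 0 (bracket a b); rewrite !dot0l !add0r.
case phiE : (Psi F phi) h => [[a b] c] [h0 h1 h2].
case vE : (Psi F v) => [[x y] z].
by have := is_derive_Phi fF phiE vE; rewrite h0 h1 h2 !dot0r !addr0.
Qed.

(** The tensor a(x)a + b(x)b + c(x)c is the pullback of the inner product of the target by phi,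
    hence the same in all frames. This gives access to the [a0] chosen in [A_tensor]. *)
Lemma frame_gram o F phi xi eta a b c : frame o F -> Psi F phi = (a, b, c) ->
  dot a xi * dot a eta + dot b xi * dot b eta + dot c xi * dot c eta =
  dot (xi *m phi) (eta *m phi).
Proof.
move=> fF [aE bE cE].
have -> := PsiP phi xi fF; have -> := PsiP phi eta fF; rewrite aE bE cE.
by rewrite !(dotDl, dotDr, dotZl, dotZr) !(frame_dot _ _ fF) /=; ring.
Qed.

Lemma unit_normal (u : g) : exists v, dot v v = 1 /\ dot u v = 0.
Proof.
have [/eqP u01|u01] := boolP (u 0 0 ^+ 2 + u 0 1 ^+ 2 == 0).
  have h0 := sqr_ge0 (u 0 0); have h1 := sqr_ge0 (u 0 1).
  have /eqP : u 0 0 ^+ 2 = 0 by lra.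
  rewrite sqrf_eq0 => /eqP z0.
  by exists (vec3 1 0 0); rewrite !dotE !mxE /= z0; split; ring.
set q := _ + _ in u01.
have q0 : 0 <= q by rewrite addr_ge0 ?sqr_ge0.
exists ((Num.sqrt q)^-1 *: vec3 (- u 0 1) (u 0 0) 0).
rewrite !(dotZl, dotZr) !dotE !mxE /=; split; last by ring.
have -> : - u 0 1 * - u 0 1 + u 0 0 * u 0 0 + 0 * 0 = q by rewrite /q; ring.
by rewrite mulrA -expr2 exprVn sqr_sqrtr // mulVf.
Qed.

Lemma unit_frame (u : g) : dot u u = 1 ->
  exists H : 'M[R]_3, frame false H /\ row 0 H = u.
Proof.
move=> uu; have [v [vv uv]] := unit_normal u.
pose H : 'M[R]_3 := \matrix_i [:: u; v; bracket u v]`_i.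
have r0 : row 0 H = u by rewrite rowK.
have r1 : row 1 H = v by rewrite rowK.
have r2 : row 2 H = bracket u v by rewrite rowK.
have vu : dot v u = 0 by rewrite dot_comm.
have d22 : dot (bracket u v) (bracket u v) = 1.
  by rewrite bracket_lagrange uu vv uv mulr1 mul0r subr0.
have d02 : dot u (bracket u v) = 0 by rewrite !dotE !mxE /=; ring.
have d12 : dot v (bracket u v) = 0 by rewrite !dotE !mxE /=; ring.
exists H; split; last exact: r0.
split; last by rewrite det3 r0 r1 r2 /Phi3 -dot_bracketl d22.
have HE (i j : 'I_3) : (H *m H^T) i j = dot (row i H) (row j H).
  by rewrite mxE; apply: eq_bigr => k _; rewrite !mxE.
have e0 (h : (0 < 3)%N) : Ordinal h = 0 :> 'I_3 by apply/val_inj.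
have e1 (h : (1 < 3)%N) : Ordinal h = 1 :> 'I_3 by apply/val_inj.
have e2 (h : (2 < 3)%N) : Ordinal h = 2 :> 'I_3 by apply/val_inj.
apply/matrixP => i j; rewrite HE mxE.
by case: i => [[|[|[|i]]] hi] //; case: j => [[|[|[|j]]] hj] //=;
  rewrite ?e0 ?e1 ?e2 ?r0 ?r1 ?r2 //; rewrite dot_comm.
Qed.

Lemma A_tensor_rank1 o F phi (al be ga n : R) w : frame o F -> 0 < n ->
  n ^+ 2 = al ^+ 2 + be ^+ 2 + ga ^+ 2 -> dot w w = 1 ->
  Psi F phi = (al *: w, be *: w, ga *: w) ->
  forall xi eta, A_tensor o phi xi eta = n * (dot xi eta - dot w xi * dot w eta).
Proof.
move=> fF n0 nE ww PE xi eta.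
have cr : critical_set o phi.
  by apply/(critical_setP _ fF); rewrite PE /=; congr (_, _, _);
     apply: su2_eq; rewrite !mxE /=; ring.
rewrite /A_tensor; case: asboolP => [_|/(_ cr)//].
set P := [set a | _].
(* A rotation with first row (al, be, ga) / n turns [F] into a frame in which phi is (n w, 0, 0), so
   the set [P] is not empty. *)
have [H [fH rH]] : exists H : 'M[R]_3, frame false H /\ row 0 H = n^-1 *: vec3 al be ga.
  apply: unit_frame; rewrite dotZl dotZr dotE !mxE /=.
  have -> : al * al + be * be + ga * ga = n ^+ 2 by rewrite nE; ring.
  by field; rewrite gt_eqF.
have nN : n != 0 by rewrite gt_eqF.
have ab : vec3 al be ga = n *: row 0 H by rewrite rH scalerA mulfV // scale1r.
have Pn : P (n *: w).
  exists (H *m F); split.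
    case: fH => hH dH; case: fF => hF dF; split; last by rewrite det_mulmx dH dF mul1r.
    by rewrite trmx_mul mulmxA -(mulmxA H) hF mulmx1 hH.
  move: PE; rewrite !PsiE => -[Pa Pb Pc].
  have E (i : 'I_3) : row i (H *m F) *m phi^T = dot (row i H) (vec3 al be ga) *: w.
    rewrite row_mul -mulmxA row_mul3 !row_mul Pa Pb Pc dotE !mxE /= !scalerA.
    by rewrite !scalerDl.
  by rewrite !E ab !dotZr !(frame_dot _ _ fH) /= mulr1 !mulr0 !scale0r.
have : P (xget 0 P) by apply: (xgetI _ Pn).
move: (xget 0 P) => a0 [F' [fF' PE']] /=.
(* The chosen [a0] is known only up to sign, but A depends on it through a0(x)a0 and its norm. *)
have K x y : dot a0 x * dot a0 y = n ^+ 2 * (dot w x * dot w y).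
  have := frame_gram x y fF' PE'; rewrite -(frame_gram x y fF PE) nE.
  by rewrite !dotZl !dot0l !mul0r !addr0 => ->; ring.
have Ka : dot a0 a0 = n ^+ 2.
  have e (x : g) : dot x x = dot x (vec3 1 0 0) * dot x (vec3 1 0 0) +
      dot x (vec3 0 1 0) * dot x (vec3 0 1 0) + dot x (vec3 0 0 1) * dot x (vec3 0 0 1).
    by rewrite !dotE !mxE /=; ring.
  by rewrite e !K -!mulrDr -e ww mulr1.
by rewrite Ka K sqrtr_sqr ger0_norm ?ltW //; field.
Qed.

(** Contraction with a kills the terms in [a,b] and [c,a], and the factor <a,[b,c]> left over
    cancels 1/Phi. This is done for combinations of the rows of [phi^T], in which A is written, and
    [X3_frame] recognizes the results as brackets in the frame [F]. *)
Lemma A_tensor_generic o F phi a b c eta : frame o F -> Phi o phi != 0 ->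
  Psi F phi = (a, b, c) ->
  [/\ A_tensor o phi a eta = dot (bracket b c) eta,
      A_tensor o phi b eta = dot (bracket c a) eta &
      A_tensor o phi c eta = dot (bracket a b) eta].
Proof.
move=> fF P0.
have ncr : ~ critical_set o phi.
  move=> /(critical_setP _ fF) h; move/eqP: P0; apply; rewrite -(Phi_frame _ fF).
  by move: h; case: (Psi F phi) => [[? ?] ?] [h1 _ _]; rewrite /Phi3 h1 dot0r.
have := X3_frame phi^T fF; rewrite /= => -[K0 K1 K2] [<- <- <-].
rewrite K0 K1 K2 /A_tensor Psi_frame0 /=; case: asboolP => // _.
have PE : Phi o phi = (-1) ^+ o * Phi3 (row 0 phi^T, row 1 phi^T, row 2 phi^T).
  by rewrite /Phi Phi_det -[\det phi]det_tr [\det phi^T]det3; case: (frame0_frame R o) => _ ->.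
rewrite PE in P0 *.
move: P0; rewrite !row_mul3.
move: (row 0 phi^T) (row 1 phi^T) (row 2 phi^T) => r0 r1 r2 P0.
rewrite !bracketZ signK !scale1r.
have s0 : (-1) ^+ o != 0 :> R by rewrite signr_eq0.
have T0 : Phi3 (r0, r1, r2) != 0 by move: P0; rewrite mulf_eq0 negb_or => /andP[].
have E (x y z : R) : ((-1) ^+ o * Phi3 (r0, r1, r2))^-1 *
  (dot (bracket r0 r1) (x *: r0 + y *: r1 + z *: r2) * dot (bracket r0 r1) eta +
   dot (bracket r1 r2) (x *: r0 + y *: r1 + z *: r2) * dot (bracket r1 r2) eta +
   dot (bracket r2 r0) (x *: r0 + y *: r1 + z *: r2) * dot (bracket r2 r0) eta) =
  dot ((-1) ^+ o *: (x *: bracket r1 r2 + y *: bracket r2 r0 + z *: bracket r0 r1)) eta.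
  have -> : dot (bracket r0 r1) (x *: r0 + y *: r1 + z *: r2) = z * Phi3 (r0, r1, r2).
    by rewrite /Phi3 !(dotE, mxE) /=; ring.
  have -> : dot (bracket r1 r2) (x *: r0 + y *: r1 + z *: r2) = x * Phi3 (r0, r1, r2).
    by rewrite /Phi3 !(dotE, mxE) /=; ring.
  have -> : dot (bracket r2 r0) (x *: r0 + y *: r1 + z *: r2) = y * Phi3 (r0, r1, r2).
    by rewrite /Phi3 !(dotE, mxE) /=; ring.
  have sV : ((-1) ^+ o)^-1 = (-1) ^+ o :> R by rewrite -exprVn invrN1.
  by rewrite invfM sV !(dotZl, dotDl); field.
by rewrite !E.
Qed.

Definition A_op o phi (xi : g) : g :=
  vec3 (A_tensor o phi xi (vec3 1 0 0)) (A_tensor o phi xi (vec3 0 1 0))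
       (A_tensor o phi xi (vec3 0 0 1)).

Lemma A_tensor_op o phi xi eta : A_tensor o phi xi eta = dot (A_op o phi xi) eta.
Proof.
rewrite /A_op /A_tensor; case: asboolP => _.
  by rewrite /= !(dotE, mxE) /=; ring.
rewrite Psi_frame0 /=.
move: (bracket _ _) => u; move: (bracket _ _) => v; move: (bracket _ _) => w.
by rewrite !(dotE, mxE) /=; ring.
Qed.

Lemma A_tensor_sym o phi xi eta : A_tensor o phi xi eta = A_tensor o phi eta xi.
Proof.
rewrite /A_tensor; case: asboolP => _ /=.
  by rewrite (dot_comm xi) [X in _ - _ * X]mulrC.
by congr (_ * (_ + _ + _)); rewrite mulrC.
Qed.

End Tensor.

(** * The unstable manifolds of the gradient flow *)

Section NahmFlow.
Variable R : realType.
Local Notation g := (su2 R).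
Local Notation M := (Hom_su2 R).
Implicit Types (a b c w : g) (F : 'M[R]_3) (phi : M) (o : bool).
Implicit Types V W : normedModType R.

Lemma smooth_dot V (f h : V -> g) : smooth_on setT f -> smooth_on setT h ->
  smooth_on setT (fun x => dot (f x) (h x)).
Proof.
move=> hf hh; have -> : (fun x => dot (f x) (h x)) =
  fun x => f x 0 0 * h x 0 0 + f x 0 1 * h x 0 1 + f x 0 2 * h x 0 2.
  by apply/funext => x; rewrite dotE.
by apply: smoothD; [apply: smoothD|]; apply: smoothM; apply: smooth_coord.
Qed.

Lemma smooth_bracket V (f h : V -> g) : smooth_on setT f -> smooth_on setT h ->
  smooth_on setT (fun x => bracket (f x) (h x)).
Proof.
move=> hf hh.
have E i j : smooth_on setT (fun x => f x 0 i * h x 0 j - f x 0 j * h x 0 i).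
  by apply: smoothB; apply: smoothM; apply: smooth_coord.
apply: smooth_mx => i j; rewrite (ord1 i).
by case: j => [[|[|[|j]]] hj] //=; [have := E 1 2|have := E 2 0|have := E 0 1];
  congr smooth_on; apply/funext => x; rewrite mxE.
Qed.

Lemma smooth_scale V m n (f : V -> R) (h : V -> 'M[R]_(m.+1, n.+1)) :
  smooth_on setT f -> smooth_on setT h -> smooth_on setT (fun x => f x *: h x).
Proof.
move=> hf hh; apply: smooth_mx => i j.
have -> : (fun x => (f x *: h x) i j) = fun x => f x * h x i j.
  by apply/funext => x; rewrite mxE.
by apply: smoothM => //; apply: smooth_coord.
Qed.

Lemma smooth_row F (i : 'I_3) : smooth_on setT (fun phi : M => row i F *m phi^T : g).
Proof.
by apply: smooth_linear_mx => k A B; rewrite linearP /= mulmxDr scalemxAr.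
Qed.

Lemma smooth_cvg V W (f : V -> W) (T : Type) (D : set_system T) (FF : Filter D)
    (h : T -> V) l : smooth_on setT f -> h @ D --> l -> (f \o h) @ D --> f l.
Proof. by move=> hf hl; apply: continuous_cvg hl; apply: (hf 0). Qed.

(* The Gram matrix of a point on the unstable manifold of
   [(al *: w, be *: w, ga *: w)], [w] a unit vector: the flow of the gradient of
   Phi only changes the multiple [s] of the identity. *)
Definition gram_shift (al be ga s sg : R) a b c : Prop :=
  [/\ [/\ dot a a = al ^+ 2 + s, dot b b = be ^+ 2 + s & dot c c = ga ^+ 2 + s],
      [/\ dot a b = al * be, dot b c = be * ga & dot c a = ga * al],
      0 <= s, 0 < sg /\ sg ^+ 2 = s + (al ^+ 2 + be ^+ 2 + ga ^+ 2) &
      Phi3 (a, b, c) = s * sg].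

Lemma gram_shift_cyc al be ga s sg a b c :
  gram_shift al be ga s sg a b c -> gram_shift be ga al s sg b c a.
Proof.
case=> [[aa bb cc] [ab bc ca] s0 [sg0 sgE] P].
split=> //; first by split=> //; rewrite sgE; ring.
by rewrite -P /Phi3 -dot_bracket_cyc.
Qed.

(** Let N have rows a, b, c. Its cofactor matrix is det N (N N^T)^-1 N, and the inverse of u u^T + s
    I is (I - u u^T / sg^2) / s, so the factor s of det N = s sg cancels. The result persists at s =
    0, where nothing can be inverted; hence the proof by a vanishing squared norm. *)
Lemma gram_shift_bracket al be ga s sg a b c :
  gram_shift al be ga s sg a b c ->
  sg *: bracket b c = sg ^+ 2 *: a - al *: (al *: a + be *: b + ga *: c).
Proof.
case=> [[aa bb cc] [ab bc ca] s0 [sg0 sgE] P]; apply/subr0_eq/dot_eq0.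
set v := _ - _.
have -> : dot v v = sg ^+ 2 * (dot b b * dot c c - dot b c ^+ 2)
    + sg ^+ 4 * dot a a + al ^+ 2 * (al ^+ 2 * dot a a + be ^+ 2 * dot b b
      + ga ^+ 2 * dot c c + 2 * al * be * dot a b + 2 * be * ga * dot b c
      + 2 * ga * al * dot c a)
    - 2 * sg ^+ 3 * Phi3 (a, b, c) + 2 * sg * al ^+ 2 * Phi3 (a, b, c)
    - 2 * sg ^+ 2 * al * (al * dot a a + be * dot a b + ga * dot c a).
  by rewrite /v /Phi3 !(dotE, mxE) /=; ring.
have {}sgE : s = sg ^+ 2 - (al ^+ 2 + be ^+ 2 + ga ^+ 2) by rewrite sgE; ring.
rewrite P aa bb cc ab bc ca sgE; ring.
Qed.

(** The third of the bracket equations, solved for c: sg^2 - ga^2 = s + al^2 + be^2. *)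
Lemma gram_shift_third al be ga s sg a b c :
  gram_shift al be ga s sg a b c ->
  (s + al ^+ 2 + be ^+ 2) *: c = ga *: (al *: a + be *: b) + sg *: bracket a b.
Proof.
move=> h; have := gram_shift_bracket (gram_shift_cyc (gram_shift_cyc h)).
case: h => _ _ _ [_ sgE] _ ->.
by apply: su2_eq; rewrite !mxE sgE; ring.
Qed.

(** The triple (a, b, c) is split as sg P + Q, with P proportional to the limit point and Q the
    remainder. By this lemma and its cyclic versions, x P + y Q solves the flow equation as soon as
    x' = s y^2 and y' = x y. *)
Lemma gram_shift_flow al be ga s sg n a b c x y :
  gram_shift al be ga s sg a b c -> n != 0 -> n ^+ 2 = al ^+ 2 + be ^+ 2 + ga ^+ 2 ->
  let W := al *: a + be *: b + ga *: c in
  let P k := (k / (n ^+ 2 * sg)) *: W in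
  let Q k v := v - sg *: P k in
  bracket (x *: P be + y *: Q be b) (x *: P ga + y *: Q ga c) =
  (s * y ^+ 2) *: P al + (x * y) *: Q al a.
Proof.
move=> h n0 nE W P Q.
have Ka := gram_shift_bracket h.
have Kb := gram_shift_bracket (gram_shift_cyc h).
have Kc := gram_shift_bracket (gram_shift_cyc (gram_shift_cyc h)).
have [_ _ _ [sg0 sgE] _] := h.
have sgN : sg != 0 by rewrite gt_eqF.
pose k := (x - y * sg) / (n ^+ 2 * sg).
have PQ j v : x *: P j + y *: Q j v = y *: v + (k * j) *: W.
  by rewrite /Q /P /k; apply: su2_eq; rewrite !mxE; field; rewrite ?n0 ?sgN.
rewrite !PQ.
have -> : bracket (y *: b + (k * be) *: W) (y *: c + (k * ga) *: W) =
    sg^-1 *: ((y ^+ 2 + y * k * (be ^+ 2 + ga ^+ 2)) *: (sg *: bracket b c)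
      - (y * k * al * ga) *: (sg *: bracket a b)
      - (y * k * al * be) *: (sg *: bracket c a)).
  by apply: su2_eq; rewrite !mxE /=; field.
rewrite Ka Kb Kc.
have -> : s = sg ^+ 2 - n ^+ 2 by rewrite sgE nE; ring.
have -> : be ^+ 2 + ga ^+ 2 = n ^+ 2 - al ^+ 2 by rewrite nE; ring.
rewrite /Q /P.
have -> : be *: b + ga *: c + al *: a = W by rewrite /W addrC addrA.
have -> : ga *: c + al *: a + be *: b = W by rewrite /W [RHS]addrC addrA.
have WE i : W 0 i = al * a 0 i + be * b 0 i + ga * c 0 i by rewrite !mxE.
have E i : sg^-1 * ((y ^+ 2 + y * k * (n ^+ 2 - al ^+ 2)) *
    (sg ^+ 2 * a 0 i - al * W 0 i)
    - y * k * al * ga * (sg ^+ 2 * c 0 i - ga * W 0 i)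
    - y * k * al * be * (sg ^+ 2 * b 0 i - be * W 0 i)) =
    (sg ^+ 2 - n ^+ 2) * y ^+ 2 * (al / (n ^+ 2 * sg) * W 0 i)
    + x * y * (a 0 i - sg * (al / (n ^+ 2 * sg) * W 0 i)).
  (* Eliminating ga c by [WE] and ga^2 by [nE] leaves an identity between independent quantities. *)
  have -> : y * k * al * ga * (sg ^+ 2 * c 0 i - ga * W 0 i) =
     y * k * al * (sg ^+ 2 * (W 0 i - al * a 0 i - be * b 0 i)
       - (n ^+ 2 - al ^+ 2 - be ^+ 2) * W 0 i) by rewrite WE nE; ring.
  by rewrite /k; field; rewrite ?n0 ?sgN.
by apply: su2_eq; move: (E 0) (E 1) (E 2); rewrite !mxE.
Qed.

End NahmFlow.

(** * The explicit solution of x' = s y^2, y' = x y *)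

Section BackwardLimits.
Variable R : realType.
Local Notation g := (su2 R).
Local Notation M := (Hom_su2 R).
Implicit Types (a b c w : g) (F : 'M[R]_3) (phi : M) (o : bool).

Lemma is_derive_inv (f : R -> R) (t df : R) : f t != 0 ->
  is_derive t 1 f df -> is_derive t 1 (fun u => (f u)^-1) (- df / f t ^+ 2).
Proof.
move=> f0 hf; have d : derivable f t 1 by case: hf.
apply: DeriveDef; first exact: derivableV.
by rewrite deriveV // (@derive_val _ _ _ _ _ _ _ hf) [_ *: _]mulrC mulrN mulNr.
Qed.

(* [x = n coth (n (T - t))] and [y = sinh (n T) / sinh (n (T - t))], with [T]
   such that [x 0 = sg]; written with [E = exp (n t)] they also make sense for
   [sg = n], that is for [T] infinite. *)
Lemma coth_sinh_flow (n sg : R) : 0 < n -> n <= sg ->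
  exists (x y : R -> R) (e : R), [/\ 0 < e, x 0 = sg, y 0 = 1 &
    [/\ forall t, t < e -> is_derive t 1 x ((sg ^+ 2 - n ^+ 2) * y t ^+ 2),
        forall t, t < e -> is_derive t 1 y (x t * y t),
        x t @[t --> -oo] --> n & y t @[t --> -oo] --> 0]].
Proof.
move=> n0 nsg; have nN : n != 0 by rewrite gt_eqF.
have sg0 : 0 < sg by apply: lt_le_trans nsg.
pose E t := expR (n * t).
pose D t := (sg + n) - (sg - n) * (E t * E t).
pose N t := (sg + n) + (sg - n) * (E t * E t).
have E0 : E 0 = 1 by rewrite /E mulr0 expR0.
have cst (k t : R) : is_derive t 1 (fun _ : R => k) 0 by apply: is_derive_cst.
have dE (t : R) : is_derive t 1 E (n * E t).
  have h : is_derive t 1 (fun u : R => n * u) n.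
    have := is_derive_mul (cst n t) (is_derive_id t 1).
    by rewrite mul0r add0r mulr1.
  have := @is_derive1_comp _ expR (fun u => n * u) t _ _ (is_derive_expR _) h.
  by rewrite mulrC.
have dEE (t : R) : is_derive t 1 (fun u => E u * E u) (2 * n * (E t * E t)).
  by have := is_derive_mul (dE t) (dE t); congr is_derive; ring.
have dc (t k l : R) : is_derive t 1 (fun u => k + l * (E u * E u)) (2 * n * l * (E t * E t)).
  have := is_derive_add (cst k t)
     (is_derive_mul (cst l t) (dEE t)).
  by congr is_derive; ring.
have dD (t : R) : is_derive t 1 D (- (2 * n * (sg - n) * (E t * E t))).
  have := dc t (sg + n) (- (sg - n)); congr is_derive; last by ring.
  by apply/funext => u; rewrite /D; ring.
have dN (t : R) : is_derive t 1 N (2 * n * (sg - n) * (E t * E t)) by apply: dc.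
(* The denominator [D] vanishes where E^2 = (sg + n) / (sg - n). The smaller bound (sg + n) / sg
   also makes sense for sg = n and still exceeds 1, so that e > 0. *)
pose e := ln ((sg + n) / sg) / (2 * n).
have q1 : 1 < (sg + n) / sg by rewrite ltr_pdivlMr // mul1r ltrDl.
have e0 : 0 < e by rewrite divr_gt0 ?ln_gt0 // mulr_gt0.
have D0 (t : R) : t < e -> 0 < D t.
  rewrite /e ltr_pdivlMr ?mulr_gt0 // => te.
  have EE : E t * E t < (sg + n) / sg.
    rewrite -expRD -[ltRHS]lnK ?posrE ?ltr_expR; last exact: lt_trans q1.
    by apply: le_lt_trans te; rewrite le_eqVlt; apply/orP; left; apply/eqP; ring.
  have : sg * (E t * E t) < sg + n by rewrite mulrC -ltr_pdivlMr.
  have : 0 <= n * (E t * E t) by rewrite !mulr_ge0 ?expR_ge0 ?ltW.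
  by rewrite /D mulrBl => h1 h2; lra.
have D00 : D 0 = 2 * n by rewrite /D E0; ring.
have N00 : N 0 = 2 * sg by rewrite /N E0; ring.
exists (fun t => n * (N t * (D t)^-1)), (fun t => 2 * n * (E t * (D t)^-1)), e.
split; first exact: e0.
- by rewrite N00 D00; field.
- by rewrite E0 D00; field.
have snN : sg + n != 0 by rewrite gt_eqF // addr_gt0.
have E_lim : E t @[t --> -oo] --> 0.
  have h : (n * t) @[t --> -oo] --> -oo.
    by apply: gt0_cvgMrNy => //; apply: cvg_id.
  by apply: (cvg_comp _ _ h); apply/cvgNy_compNP/cvgr_expR.
have EE_lim : E t * E t @[t --> -oo] --> 0.
  by have := cvgM E_lim E_lim; rewrite mulr0; apply.
have D_lim : (D t)^-1 @[t --> -oo] --> (sg + n)^-1.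
  apply: (cvgV snN).
  have := cvgB (cvg_cst (sg + n)) (cvgM (cvg_cst (sg - n)) EE_lim).
  by rewrite mulr0 subr0; apply.
have N_lim : N t @[t --> -oo] --> sg + n.
  have := cvgD (cvg_cst (sg + n)) (cvgM (cvg_cst (sg - n)) EE_lim).
  by rewrite mulr0 addr0; apply.
split=> [t te|t te||].
- have DN : D t != 0 by rewrite gt_eqF ?D0.
  have := is_derive_mul (cst n t)
    (is_derive_mul (dN t) (is_derive_inv DN (dD t))).
  by congr is_derive; rewrite /N /D in DN *; field.
- have DN : D t != 0 by rewrite gt_eqF ?D0.
  have := is_derive_mul (cst (2 * n) t)
    (is_derive_mul (dE t) (is_derive_inv DN (dD t))).
  by congr is_derive; rewrite /N /D in DN *; field.
- have := cvgM (cvg_cst n) (cvgM N_lim D_lim).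
  by rewrite divff // mulr1; apply.
- have := cvgM (cvg_cst (2 * n)) (cvgM E_lim D_lim).
  by rewrite mul0r mulr0; apply.
Qed.

End BackwardLimits.

(** * Backward limits and the Gram equations *)

Section UnstableManifold.
Variable R : realType.
Local Notation g := (su2 R).
Local Notation g3 := (su2_cube R).
Local Notation M := (Hom_su2 R).
Implicit Types (a b c w : g) (F : 'M[R]_3) (phi : M) (o : bool).

Lemma is_derive_scalel (f : R -> R) (W : normedModType R) (w : W) (t df : R) :
  is_derive t 1 f df -> is_derive t 1 (fun u => f u *: w) (df *: w).
Proof.
apply: (@is_derive_linear _ _ _ _ (fun r : R => r *: w)).
  by move=> k x y; rewrite scalerDl scalerA.
exact: scalel_continuous.
Qed.

(** u = (al, be, ga) is an eigenvector of the Gram matrix u u^T + s I, with eigenvalue s + |u|^2 =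
    sg^2. *)
Lemma gram_shift_norm al be ga s sg a b c :
  gram_shift al be ga s sg a b c ->
  let W := al *: a + be *: b + ga *: c in
  dot W W = (al ^+ 2 + be ^+ 2 + ga ^+ 2) * sg ^+ 2.
Proof.
case=> [[aa bb cc] [ab bc ca] _ [_ sgE] _] W.
have -> : dot W W = al ^+ 2 * dot a a + be ^+ 2 * dot b b + ga ^+ 2 * dot c c
   + 2 * al * be * dot a b + 2 * be * ga * dot b c + 2 * ga * al * dot c a.
  by rewrite /W !(dotE, mxE); ring.
by rewrite aa bb cc ab bc ca sgE; ring.
Qed.

Lemma gram_shift_backward_limit o F phi al be ga s sg a b c :
  frame o F -> Psi F phi = (a, b, c) -> gram_shift al be ga s sg a b c ->
  0 < al ^+ 2 + be ^+ 2 + ga ^+ 2 ->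
  exists w, dot w w = 1 /\
    backward_limit o phi (Psi_inv F (al *: w, be *: w, ga *: w)).
Proof.
move=> fF phiE h; set q := (X in 0 < X) => q0.
pose n := Num.sqrt q.
have n0 : 0 < n by rewrite sqrtr_gt0.
have nN : n != 0 by rewrite gt_eqF.
have nE : n ^+ 2 = al ^+ 2 + be ^+ 2 + ga ^+ 2 by rewrite sqr_sqrtr // ltW.
have [_ _ s0 [sg0 sgE] _] := h.
have sgN : sg != 0 by rewrite gt_eqF.
have nsg : n <= sg.
  have : n ^+ 2 <= sg ^+ 2 by rewrite sgE nE; lra.
  by rewrite ler_pXn2r // nnegrE ltW.
have sE : sg ^+ 2 - n ^+ 2 = s by rewrite sgE nE; ring.
have [x [y [e [e0 x0 y0 [dx dy xl yl]]]]] := coth_sinh_flow n0 nsg.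
pose W := al *: a + be *: b + ga *: c.
pose P k := (k / (n ^+ 2 * sg)) *: W.
pose Q k v := v - sg *: P k.
pose M1 := Psi_inv F (P al, P be, P ga).
pose M2 := Psi_inv F (Q al a, Q be b, Q ga c).
(* At time 0 this is sg M1 + M2 = phi; at -oo it tends to n M1, whose components are al w, be w, ga
   w for w = W / (n sg). *)
pose gamma t := x t *: M1 + y t *: M2.
have PsiM k l : Psi F (k *: M1 + l *: M2) =
    (k *: P al + l *: Q al a, k *: P be + l *: Q be b, k *: P ga + l *: Q ga c).
  have := Psi_linear F l M2 0; have P0 : Psi F 0 = 0 by rewrite /Psi !trmx0 !mulmx0.
  rewrite addr0 P0 addr0 => lE; rewrite Psi_linear lE.
  by rewrite !(Psi_invK _ fF).
exists ((n * sg)^-1 *: W); split.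
  rewrite !(dotZl, dotZr) (gram_shift_norm h) -nE; field.
  by rewrite nN sgN.
have WE : be *: b + ga *: c + al *: a = W by rewrite /W addrC addrA.
have WE' : ga *: c + al *: a + be *: b = W by rewrite /W [RHS]addrC addrA.
exists gamma, e; split=> //.
- apply: (Psi_inj fF); rewrite /gamma PsiM x0 y0 phiE /Q.
  by rewrite !scale1r ![_ + (_ - _)]addrC !subrK.
- move=> t te.
  have := is_derive_add (is_derive_scalel M1 (dx t te)) (is_derive_scalel M2 (dy t te)).
  congr is_derive; apply: (Psi_inj fF); rewrite (Psi_X_field _ fF) /gamma !PsiM /= sE.
  have nE1 : n ^+ 2 = be ^+ 2 + ga ^+ 2 + al ^+ 2 by rewrite nE; ring.
  have nE2 : n ^+ 2 = ga ^+ 2 + al ^+ 2 + be ^+ 2 by rewrite nE; ring.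
  have E0 := gram_shift_flow (x t) (y t) h nN nE.
  have E1 := gram_shift_flow (x t) (y t) (gram_shift_cyc h) nN nE1.
  have E2 := gram_shift_flow (x t) (y t) (gram_shift_cyc (gram_shift_cyc h)) nN nE2.
  by rewrite /= WE in E1; rewrite /= WE' in E2; rewrite E0 E1 E2.
have -> : Psi_inv F (al *: ((n * sg)^-1 *: W), be *: ((n * sg)^-1 *: W),
    ga *: ((n * sg)^-1 *: W)) = n *: M1 + 0 *: M2.
  apply: (Psi_inj fF); rewrite PsiM (Psi_invK _ fF) !scale0r !addr0 /P !scalerA.
  by congr (_ *: _, _ *: _, _ *: _); field; rewrite nN sgN.
apply: cvgD.
  by apply: cvgZ; [exact: xl|exact: cvg_cst].
by apply: cvgZ; [exact: yl|exact: cvg_cst].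
Qed.

Lemma backward_limit_gram_shift o F phi l al be ga w a b c :
  frame o F -> backward_limit o phi l -> Psi F l = (al *: w, be *: w, ga *: w) ->
  dot w w = 1 -> Psi F phi = (a, b, c) -> 0 < al ^+ 2 + be ^+ 2 ->
  exists s sg, gram_shift al be ga s sg a b c.
Proof.
move=> fF [gamma [e [e0 g0 dg gl]]] lE ww phiE m0.
have D t : t < e -> let: (x, y, z) := Psi F (gamma t) in
   [/\ is_derive t 1 (fun u => (Psi F (gamma u)).1.1) (bracket y z),
       is_derive t 1 (fun u => (Psi F (gamma u)).1.2) (bracket z x) &
       is_derive t 1 (fun u => (Psi F (gamma u)).2) (bracket x y)].
  move=> te; case E : (Psi F (gamma t)) => [[x y] z].
  by apply: (is_derive_Psi (dg t te)); rewrite (Psi_X_field _ fF) E.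
(* A conserved quantity takes the same value at phi and at the limit. The derivative of the Gram
   matrix is 2 Phi I, so this applies to its off-diagonal entries and to the differences of its
   diagonal ones. *)
have cst (Q : g3 -> R) : smooth_on setT (Q \o Psi F) ->
    (forall t, t < e -> is_derive t 1 (fun u => Q (Psi F (gamma u))) 0) ->
    Q (a, b, c) = Q (al *: w, be *: w, ga *: w).
  move=> sQ dQ; rewrite -phiE -g0 -lE.
  apply: (derive0_lim_ninfty e0 dQ); exact: (smooth_cvg _ sQ gl).
have S i := smooth_row F i.
have ab : dot a b = al * be.
  transitivity (dot (al *: w) (be *: w)); last by rewrite dotZl dotZr ww mulr1.
  apply: (cst (fun x : g3 => dot x.1.1 x.1.2)).
    by apply: smooth_dot; apply: S.
  move=> t te; have [da db dc] := D t te.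
  have := is_derive_dot da db; congr is_derive.
  by rewrite /= !(dotE, mxE) /=; ring.
have bc : dot b c = be * ga.
  transitivity (dot (be *: w) (ga *: w)); last by rewrite dotZl dotZr ww mulr1.
  apply: (cst (fun x : g3 => dot x.1.2 x.2)).
    by apply: smooth_dot; apply: S.
  move=> t te; have [da db dc] := D t te.
  have := is_derive_dot db dc; congr is_derive.
  by rewrite /= !(dotE, mxE) /=; ring.
have ca : dot c a = ga * al.
  transitivity (dot (ga *: w) (al *: w)); last by rewrite dotZl dotZr ww mulr1.
  apply: (cst (fun x : g3 => dot x.2 x.1.1)).
    by apply: smooth_dot; apply: S.
  move=> t te; have [da db dc] := D t te.
  have := is_derive_dot dc da; congr is_derive.
  by rewrite /= !(dotE, mxE) /=; ring.
have aabb : dot a a - dot b b = al ^+ 2 - be ^+ 2.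
  transitivity (dot (al *: w) (al *: w) - dot (be *: w) (be *: w));
    last by rewrite !(dotZl, dotZr) ww; ring.
  apply: (cst (fun x : g3 => dot x.1.1 x.1.1 - dot x.1.2 x.1.2)).
    by apply: smoothB; apply: smooth_dot; apply: S.
  move=> t te; have [da db dc] := D t te.
  have := is_derive_sub (is_derive_dot da da) (is_derive_dot db db).
  by congr is_derive; rewrite /= !(dotE, mxE) /=; ring.
have bbcc : dot b b - dot c c = be ^+ 2 - ga ^+ 2.
  transitivity (dot (be *: w) (be *: w) - dot (ga *: w) (ga *: w));
    last by rewrite !(dotZl, dotZr) ww; ring.
  apply: (cst (fun x : g3 => dot x.1.2 x.1.2 - dot x.2 x.2)).
    by apply: smoothB; apply: smooth_dot; apply: S.
  move=> t te; have [da db dc] := D t te.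
  have := is_derive_sub (is_derive_dot db db) (is_derive_dot dc dc).
  by congr is_derive; rewrite /= !(dotE, mxE) /=; ring.
(* Phi grows along its gradient flow and vanishes at the limit. This sign selects the root s sg of
   Phi^2 = s^2 sg^2. *)
have P0 : 0 <= Phi3 (a, b, c).
  have -> : 0 = Phi3 (Psi F l) by rewrite lE /Phi3 !(dotE, mxE) /=; ring.
  rewrite -phiE -g0.
  have sP : smooth_on setT (@Phi3 R \o Psi F).
    by apply: smooth_dot; [|apply: smooth_bracket]; apply: S.
  apply: (@ge0_derive_lim_ninfty_le _ (fun t => Phi3 (Psi F (gamma t)))
    (fun t => let: (x, y, z) := X3 (Psi F (gamma t)) in dot x x + dot y y + dot z z) e).
  - exact: e0.
  - move=> t te; have [da db dc] := D t te.
    have := is_derive_dot da (is_derive_bracket db dc); congr is_derive.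
    rewrite /= dotDr addrA; congr (_ + _ + _); first exact: dot_bracket_cyc.
    by rewrite dot_bracket_cyc; apply: dot_bracket_cyc.
  - by move=> t _ /=; rewrite !addr_ge0 ?dot_ge0.
  - exact: (smooth_cvg _ sP gl).
pose s := dot a a - al ^+ 2.
have aa : dot a a = al ^+ 2 + s by rewrite /s; ring.
have bb : dot b b = be ^+ 2 + s by rewrite /s; lra.
have cc : dot c c = ga ^+ 2 + s by rewrite /s; lra.
(* If s < 0, then |[a,b]|^2 = s (s + al^2 + be^2) >= 0 forces s + al^2 + be^2 <= 0, whereas |a|^2 +
   |b|^2 >= 0 gives s + al^2 + be^2 >= - s > 0. *)
have s0 : 0 <= s.
  have := dot_ge0 (bracket a b); rewrite bracket_lagrange aa bb (dot_comm b a) ab.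
  have -> : (al ^+ 2 + s) * (be ^+ 2 + s) - al * be * (al * be) =
    s * (s + al ^+ 2 + be ^+ 2) by ring.
  have := dot_ge0 a; have := dot_ge0 b; rewrite aa bb => hb ha hab.
  rewrite leNgt; apply/negP => sneg.
  by move: hab; rewrite nmulr_rge0 // => ?; lra.
have q0 : 0 < s + (al ^+ 2 + be ^+ 2 + ga ^+ 2).
  by have := sqr_ge0 ga; lra.
exists s, (Num.sqrt (s + (al ^+ 2 + be ^+ 2 + ga ^+ 2))).
have sgE := sqr_sqrtr (ltW q0).
split=> //; first by rewrite sqrtr_gt0.
(* Both sides being nonnegative, squares are compared: Phi^2 is the Gram determinant det (u u^T + s
   I) = s^2 (s + |u|^2). *)
apply/eqP; rewrite -(eqrXn2 (_ : (0 < 2)%N)) ?mulr_ge0 ?sqrtr_ge0 //.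
apply/eqP; rewrite exprMn sgE.
have -> : Phi3 (a, b, c) ^+ 2 = dot a a * dot b b * dot c c
   + 2 * dot a b * dot b c * dot c a - dot a a * dot b c ^+ 2
   - dot b b * dot c a ^+ 2 - dot c c * dot a b ^+ 2.
  by rewrite /Phi3 !(dotE, mxE) /=; ring.
by rewrite aa bb cc ab bc ca; ring.
Qed.

End UnstableManifold.

(** * Adjoint orbits *)

Section ConjugationMatrices.
Variable K : fieldType.
Implicit Types (A B P Q X Z : 'M[K]_2).

(** Q P^-1 conjugates A to B, and dividing a 2 x 2 matrix by a square root of its determinant makes
    the determinant 1. *)
Lemma similar_det1 A B D P Q (k : K) : \det P != 0 -> \det Q != 0 ->
  k ^+ 2 = \det Q / \det P -> A *m P = P *m D -> B *m Q = Q *m D ->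
  exists2 U, \det U = 1 & B = U *m A *m invmx U.
Proof.
move=> P0 Q0 kE hP hQ.
have uP : P \in unitmx by rewrite unitmxE unitfE.
pose U := k^-1 *: (Q *m invmx P).
have dU : \det U = 1.
  rewrite detZ det_mulmx det_inv exprVn kE mulVf //.
  by rewrite mulf_neq0 // invr_eq0.
have uU : U \in unitmx by rewrite unitmxE dU unitr1.
exists U => //; apply: (can_inj (mulmxK uU)); rewrite mulmxKV // /U.
rewrite -scalemxAr -scalemxAl; congr (_ *: _).
rewrite mulmxA hQ -!mulmxA; congr (_ *m _).
apply: (can_inj (mulmxK uP)).
by rewrite mulmxKV // -mulmxA hP mulKmx.
Qed.

Lemma conjmx_linear P Q (k : K) A B :
  P *m (k *: A + B) *m Q = k *: (P *m A *m Q) + P *m B *m Q.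
Proof. by rewrite mulmxDr mulmxDl -scalemxAr -scalemxAl. Qed.

(** For X^2 = 0 one has exp X = 1 + X and ad_X^3 = 0, so this is exp (ad_X) = Ad (exp X). *)
Lemma exp_ad_mx (k : K) A Z : let X := k *: A in (2 : K) != 0 -> X *m X = 0 ->
  Z + k *: (A *m Z - Z *m A) + (2^-1 * k * k) *:
    (A *m (A *m Z - Z *m A) - (A *m Z - Z *m A) *m A) =
  (1%:M + X) *m Z *m (1%:M - X).
Proof.
move=> X n2 XX.
have E : k *: (A *m Z - Z *m A) = X *m Z - Z *m X.
  by rewrite /X -scalemxAl -scalemxAr scalerBr.
rewrite -!scalerA.
have -> : k *: (k *: (A *m (A *m Z - Z *m A) - (A *m Z - Z *m A) *m A)) =
    X *m (X *m Z - Z *m X) - (X *m Z - Z *m X) *m X.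
  rewrite -E; move: (A *m Z - Z *m A) => Y; rewrite !scalerBr /X.
  by congr (_ - _); rewrite -scalemxAl -scalemxAr.
rewrite E mulmxBr mulmxBl !mulmxA XX mul0mx -(mulmxA Z) XX mulmx0 subr0 sub0r.
rewrite mulmxDl mul1mx mulmxDl !mulmxBr !mulmx1 -opprD scalerN.
have -> : 2^-1 *: (X *m Z *m X + X *m Z *m X) = X *m Z *m X.
  by move: (X *m Z *m X) => Y; rewrite -mulr2n -[Y *+ 2]scaler_nat scalerA mulVf ?scale1r.
by rewrite !addrA; congr (_ - _); rewrite addrAC.
Qed.

Lemma invmx_unipotent X : X *m X = 0 -> \det (1%:M + X) = 1 ->
  invmx (1%:M + X) = 1%:M - X.
Proof.
move=> XX dU; have uU : 1%:M + X \in unitmx by rewrite unitmxE dU unitr1.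
apply: (can_inj (mulKmx uU)); rewrite mulmxV // mulmxDl mul1mx mulmxBr mulmx1 XX.
by rewrite subr0 subrK.
Qed.

End ConjugationMatrices.

Section Orbits.
Variable R : realType.
Local Notation C := R[i].
Local Notation g := (su2 R).
Local Notation gC := (sl2 R).
Local Notation M := (Hom_su2 R).
Implicit Types (a b c x y : g) (F : 'M[R]_3) (phi : M) (o : bool) (z w : gC).
Implicit Types (U V m : 'M[C]_2).

Lemma mx2_eta m : m = mx2 (m 0 0) (m 0 1) (m 1 0) (m 1 1).
Proof.
apply/matrixP => i j; rewrite mxE.
by case: i => [[|[|i]] hi] //; case: j => [[|[|j]] hj] //=;
  congr (m _ _); apply/val_inj.
Qed.

Lemma mx2_mul (p q r s p' q' r' s' : C) : mx2 p q r s *m mx2 p' q' r' s' =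
  mx2 (p * p' + q * r') (p * q' + q * s') (r * p' + s * r') (r * q' + s * s').
Proof.
apply/matrixP => i j; rewrite !mxE !big_ord_recl big_ord0 addr0 !mxE.
by case: i => [[|[|i]] hi] //; case: j => [[|[|j]] hj].
Qed.

Lemma mx2_det (p q r s : C) : \det (mx2 p q r s) = p * s - q * r.
Proof.
rewrite (expand_det_row _ 0) !big_ord_recl big_ord0 /cofactor !det_mx11 !mxE /=.
by rewrite !expr0 /= expr1; ring.
Qed.

Lemma mx2_scale (k p q r s : C) : k *: mx2 p q r s = mx2 (k * p) (k * q) (k * r) (k * s).
Proof.
apply/matrixP => i j; rewrite !mxE.
by case: i => [[|[|i]] hi] //; case: j => [[|[|j]] hj].
Qed.

Definition sl2_entry (z : gC) (j : 'I_3) : C := (z.1 0 j +i* z.2 0 j)%C.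

Lemma sl2_mxE z : let k : C := (0 +i* - 2^-1)%C in
  sl2_mx z = mx2 (k * sl2_entry z 2)
    (k * (sl2_entry z 0 - (0 +i* 1)%C * sl2_entry z 1))
    (k * (sl2_entry z 0 + (0 +i* 1)%C * sl2_entry z 1)) (- (k * sl2_entry z 2)).
Proof.
move=> k; rewrite /sl2_mx -/(sl2_entry z 0) -/(sl2_entry z 1) -/(sl2_entry z 2).
rewrite mx2_scale mulrN.
have -> : - (0 +i* 1)%C / 2 = k :> C; last by [].
have -> : (2 : C)^-1 = (2^-1 +i* 0)%C.
  have h : (2 : C) * (2^-1 +i* 0)%C = 1.
    by apply/eqP; rewrite eq_complex /=; apply/andP; split; apply/eqP; field.
  have n2 : (2 : C) != 0 by rewrite pnatr_eq0.
  by apply: (mulfI n2); rewrite h mulfV.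
by apply/eqP; rewrite eq_complex /=; apply/andP; split; apply/eqP; field.
Qed.

(** The right-hand side is z.z / 4 for the complex-bilinear form, so the level sets of the
    determinant are complex quadrics. *)
Lemma sl2_mx_det z : \det (sl2_mx z) =
  ((dot z.1 z.1 - dot z.2 z.2) / 4 +i* (dot z.1 z.2 / 2))%C.
Proof.
rewrite sl2_mxE mx2_det /sl2_entry !dotE.
by apply/eqP; rewrite eq_complex /=; apply/andP; split; apply/eqP; field.
Qed.

Lemma sl2_mx_inj : injective (@sl2_mx R).
Proof.
move=> z w; rewrite !sl2_mxE => h.
have e00 := congr1 (fun m => m 0 0) h; have e01 := congr1 (fun m => m 0 1) h.
have e10 := congr1 (fun m => m 1 0) h.
move: e00 e01 e10; rewrite !mxE /= /sl2_entry.
move=> /eqP; rewrite eq_complex /= => /andP[/eqP h1 /eqP h2].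
move=> /eqP; rewrite eq_complex /= => /andP[/eqP h3 /eqP h4].
move=> /eqP; rewrite eq_complex /= => /andP[/eqP h5 /eqP h6].
by case: z w {h} h1 h2 h3 h4 h5 h6 => [a b] [c d] /= *; congr (_, _);
  apply: su2_eq; lra.
Qed.

Lemma sl2_mx_linear (k : R) z w :
  sl2_mx (k *: z + w) = (k +i* 0)%C *: sl2_mx z + sl2_mx w.
Proof.
rewrite !sl2_mxE mx2_scale; apply/matrixP => i j; rewrite !mxE.
by case: i => [[|[|i]] hi] //; case: j => [[|[|j]] hj] //=;
  rewrite /sl2_entry ?mxE /=; apply/eqP; rewrite eq_complex /= ?mxE;
  apply/andP; split; apply/eqP; ring.
Qed.

Lemma sl2_mx0 : sl2_mx (0 : gC) = 0.
Proof.
rewrite sl2_mxE; apply/matrixP => i j; rewrite !mxE.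
by case: i => [[|[|i]] hi] //; case: j => [[|[|j]] hj] //=;
  rewrite /sl2_entry ?mxE /=; apply/eqP; rewrite eq_complex /= ?mxE;
  apply/andP; split; apply/eqP; ring.
Qed.

Lemma det1_unit U : \det U = 1 -> U \in unitmx.
Proof. by rewrite unitmxE => ->; rewrite unitr1. Qed.

(* The last matrix is the companion matrix; a nonzero traceless matrix is not
   scalar, hence conjugate to it. *)
Lemma traceless_companion (p q r : C) : mx2 p q r (- p) != 0 ->
  exists2 P : 'M[C]_2, \det P != 0 &
    mx2 p q r (- p) *m P = P *m mx2 0 (p * p + q * r) 1 0.
Proof.
move=> m0; have [r0|r0] := eqVneq r 0; last first.
  exists (mx2 1 p 0 r); first by rewrite mx2_det mul1r mulr0 subr0.
  by rewrite !mx2_mul; congr mx2; ring.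
have [q0|q0] := eqVneq q 0; last first.
  exists (mx2 0 q 1 (- p)).
    by rewrite mx2_det mul0r mulr1 sub0r oppr_eq0.
  by rewrite !mx2_mul; congr mx2; ring.
have [p0|p0] := eqVneq p 0.
  case/eqP: m0; rewrite p0 q0 r0 oppr0; apply/matrixP => i j; rewrite !mxE.
  by case: i => [[|[|i]] hi] //; case: j => [[|[|j]] hj].
exists (mx2 1 p 1 (- p)).
  rewrite mx2_det (_ : _ - _ = - (2 * p)); last by ring.
  by rewrite oppr_eq0 mulf_neq0 // pnatr_eq0.
by rewrite q0 r0 !mx2_mul; congr mx2; ring.
Qed.

(** Both matrices are similar to the same companion matrix, and complex numbers have the square root
    that [similar_det1] asks for. *)
Lemma SL2C_transitive z w : z != 0 -> w != 0 ->
  \det (sl2_mx z) = \det (sl2_mx w) -> exists2 U, SL2C U & AdC U z w.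
Proof.
have comp z' : z' != 0 -> exists2 P : 'M[C]_2, \det P != 0 &
    sl2_mx z' *m P = P *m mx2 0 (- \det (sl2_mx z')) 1 0.
  move=> z0; have : sl2_mx z' != 0.
    by apply: contra_neq z0 => h; apply: sl2_mx_inj; rewrite h sl2_mx0.
  rewrite sl2_mxE => /traceless_companion [P P0 h]; exists P => //.
  by rewrite h mx2_det; congr (_ *m mx2 _ _ _ _); ring.
move=> /comp [P P0 hP] /comp [Q Q0 hQ] dE.
have kE := sqrtCK (\det Q / \det P).
rewrite -dE in hQ.
have [U dU UE] := similar_det1 P0 Q0 kE hP hQ.
by exists U.
Qed.

Lemma AdC_det U z w : SL2C U -> AdC U z w -> \det (sl2_mx w) = \det (sl2_mx z).
Proof. by move=> dU ->; rewrite !det_mulmx det_inv dU invr1 mulr1 mul1r. Qed.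

Lemma AdC_eq0 U z w : SL2C U -> AdC U z w -> (w == 0) = (z == 0).
Proof.
move=> /det1_unit dU; rewrite /AdC => h; apply/eqP/eqP => e; apply: sl2_mx_inj.
  apply: (can_inj (mulKmx dU)).
  by rewrite -[LHS](mulmxKV dU) -h e sl2_mx0 mul0mx mulmx0.
by rewrite h e sl2_mx0 mulmx0 mul0mx.
Qed.

Lemma adjoint_orbitE (O : set gC) z : adjoint_orbit O -> O z -> z != 0 ->
  O = [set w | w != 0 /\ \det (sl2_mx w) = \det (sl2_mx z)].
Proof.
move=> [z0 ->] [U0 hU0 hz] zn; have z0n : z0 != 0 by rewrite -(AdC_eq0 hU0 hz).
apply/seteqP; split=> w /=.
  by move=> [U hU hw]; rewrite (AdC_eq0 hU hw) (AdC_det hU hw) (AdC_det hU0 hz).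
move=> [wn wE].
have dE : \det (sl2_mx z0) = \det (sl2_mx w) by rewrite wE (AdC_det hU0 hz).
exact: SL2C_transitive z0n wn dE.
Qed.

Lemma adjoint_orbit_in (z : gC) : adjoint_orbit [set w | exists2 U, SL2C U & AdC U z w].
Proof. by exists z. Qed.

Lemma SL2C1 : SL2C (1%:M : 'M[C]_2).
Proof. by rewrite /SL2C /= det1. Qed.

Lemma AdC1 z : AdC 1%:M z z.
Proof. by rewrite /AdC mul1mx invmx1 mulmx1. Qed.

End Orbits.

(** * SU(2)-orbits of commuting triples *)

Section SU2Orbits.
Variable R : realType.
Local Notation C := R[i].
Local Notation g := (su2 R).
Local Notation M := (Hom_su2 R).
Implicit Types (a b c w x y : g) (F : 'M[R]_3) (phi : M) (o : bool).
Implicit Types (U V m : 'M[C]_2).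

Lemma adjmxM U V : adjmx (U *m V) = adjmx V *m adjmx U.
Proof. by rewrite /adjmx trmx_mul map_mxM. Qed.

Lemma adjmxK U : adjmx (adjmx U) = U.
Proof. by apply/matrixP => i j; rewrite !mxE conjcK. Qed.

Lemma SU2_unit U : SU2 U -> U \in unitmx /\ invmx U = adjmx U.
Proof.
move=> [h d]; have uU : U \in unitmx by rewrite unitmxE d unitr1.
by split=> //; rewrite -[RHS](mulKmx uU) h mulmx1.
Qed.

Lemma SU2M U V : SU2 U -> SU2 V -> SU2 (U *m V).
Proof.
move=> [hU dU] [hV dV]; split; last by rewrite det_mulmx dU dV mulr1.
by rewrite adjmxM mulmxA -(mulmxA U) hV mulmx1.
Qed.

Lemma SU2V U : SU2 U -> SU2 (invmx U).
Proof.
move=> hU; have [uU e] := SU2_unit hU.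
by split; [rewrite e adjmxK -e mulVmx|rewrite det_inv hU.2 invr1].
Qed.

Lemma SU2_1 : SU2 (1%:M : 'M[C]_2).
Proof. by split; [rewrite mul1mx /adjmx trmx1 map_mx1|rewrite det1]. Qed.

Lemma AdP U x y : SU2 U -> Ad U x y <-> su2_mx y *m U = U *m su2_mx x.
Proof.
move=> /SU2_unit [uU _]; rewrite /Ad; split=> [->|<-]; first by rewrite mulmxKV.
by rewrite mulmxK.
Qed.

Lemma su2_mx_linear (k : R) x y :
  su2_mx (k *: x + y) = (k +i* 0)%C *: su2_mx x + su2_mx y.
Proof.
rewrite /su2_mx -sl2_mx_linear; congr sl2_mx.
by rewrite -[RHS]/(k *: x + y, k *: 0 + 0) scaler0 addr0.
Qed.

Lemma Ad_linear U (k : R) x y x' y' :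
  Ad U x y -> Ad U x' y' -> Ad U (k *: x + x') (k *: y + y').
Proof.
rewrite /Ad => h h'; rewrite (su2_mx_linear k x x') conjmx_linear -h -h'.
exact: su2_mx_linear.
Qed.

Lemma Ad0 U : Ad U 0 0.
Proof. by rewrite /Ad /su2_mx sl2_mx0 mulmx0 mul0mx. Qed.

Lemma AdZ U (k : R) x y : Ad U x y -> Ad U (k *: x) (k *: y).
Proof. by move=> h; have := Ad_linear k h (Ad0 U); rewrite !addr0. Qed.

Lemma AdD U x y x' y' : Ad U x y -> Ad U x' y' -> Ad U (x + x') (y + y').
Proof. by move=> h h'; have := Ad_linear 1 h h'; rewrite !scale1r. Qed.

Lemma Ad_fun U x y y' : Ad U x y -> Ad U x y' -> y = y'.
Proof. by rewrite /Ad => <- /sl2_mx_inj []. Qed.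

Lemma Ad_dot U x y : SU2 U -> Ad U x y -> dot y y = dot x x.
Proof.
move=> [_ dU] h.
have /AdC_det : SL2C U by []; move=> /(_ (x, 0) (y, 0) h); rewrite !sl2_mx_det /=.
move=> /eqP; rewrite eq_complex /= => /andP[/eqP e _]; move: e.
by rewrite !dot0l !subr0; lra.
Qed.

(* The double cover S^3 -> SO(3), restricted to the quaternions
   [p + q i + s j] orthogonal to [k], moves the pole to any given point. *)
Lemma SU2_pole x : dot x x = 1 -> exists2 U, SU2 U & Ad U (vec3 0 0 1) x.
Proof.
rewrite dotE => xx.
suff [p [q [s [N x0 x1 x2]]]] : exists p q s, [/\ p ^+ 2 + q ^+ 2 + s ^+ 2 = 1,
    x 0 0 = 2 * p * q, x 0 1 = 2 * p * s & x 0 2 = p ^+ 2 - q ^+ 2 - s ^+ 2].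
  pose U : 'M[C]_2 := mx2 (p +i* 0)%C ((- q) +i* s)%C (q +i* s)%C (p +i* 0)%C.
  have hU : SU2 U.
    have NE : ((p ^+ 2 + q ^+ 2 + s ^+ 2) +i* 0)%C = 1 :> C by rewrite N.
    split.
      have -> : (1%:M : 'M[C]_2) = mx2 1 0 0 1.
        apply/matrixP => i j; rewrite !mxE.
        by case: i => [[|[|i]] hi] //; case: j => [[|[|j]] hj].
      rewrite -NE (mx2_eta (adjmx U)) /U mx2_mul !mxE /=.
      by congr mx2; apply/eqP; rewrite eq_complex /=; apply/andP; split;
        apply/eqP; ring.
    rewrite mx2_det -NE.
    by apply/eqP; rewrite eq_complex /=; apply/andP; split; apply/eqP; ring.
  exists U => //; apply/(AdP _ _ hU).
  rewrite -N (vec3_eta x) x0 x1 x2 /su2_mx !sl2_mxE /U !mx2_mul /sl2_entry !mxE /=.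
  by congr mx2; apply/eqP; rewrite eq_complex /=; apply/andP; split;
    apply/eqP; ring.
(* The half-angle formulas below divide by a root of 2 (1 + x_3), hence exclude the opposite
   pole. *)
have [e|e] := eqVneq (1 + x 0 2) 0.
  have h2 : x 0 2 = -1 by lra.
  have := sqr_ge0 (x 0 0); have := sqr_ge0 (x 0 1); rewrite !expr2 => h1 h0.
  have /eqP : x 0 0 * x 0 0 = 0 by rewrite h2 in xx; lra.
  have /eqP : x 0 1 * x 0 1 = 0 by rewrite h2 in xx; lra.
  rewrite !mulf_eq0 !orbb => /eqP x1 /eqP x0.
  by exists 0, 1, 0; rewrite x0 x1 h2; split; ring.
have e0 : 0 < 1 + x 0 2.
  rewrite lt_neqAle eq_sym e /= -subr_ge0 subr0.
  have := sqr_ge0 (x 0 0); have := sqr_ge0 (x 0 1); rewrite !expr2 => h1 h0.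
  rewrite leNgt; apply/negP => xneg.
  have : 0 < (1 + x 0 2) * (x 0 2 - 1) by rewrite nmulr_rgt0 //; lra.
  have -> : (1 + x 0 2) * (x 0 2 - 1) = x 0 2 * x 0 2 - 1 by ring.
  by move=> ?; lra.
pose r := Num.sqrt (2 * (1 + x 0 2)).
have r0 : r != 0 by rewrite gt_eqF // sqrtr_gt0 mulr_gt0.
have rE : r ^+ 2 = 2 * (1 + x 0 2) by rewrite sqr_sqrtr // ltW // mulr_gt0.
have E (u : R) : u = r ^+ 2 * u / r ^+ 2 by field.
exists ((1 + x 0 2) / r), (x 0 0 / r), (x 0 1 / r); split.
- have -> : ((1 + x 0 2) / r) ^+ 2 + (x 0 0 / r) ^+ 2 + (x 0 1 / r) ^+ 2 =
    (1 + 2 * x 0 2 + (x 0 0 * x 0 0 + x 0 1 * x 0 1 + x 0 2 * x 0 2)) / r ^+ 2.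
    by field.
  by rewrite xx rE; field.
- by rewrite [LHS]E {1}rE; field.
- by rewrite [LHS]E {1}rE; field.
- rewrite [LHS]E {1}rE.
  have -> : ((1 + x 0 2) / r) ^+ 2 - (x 0 0 / r) ^+ 2 - (x 0 1 / r) ^+ 2 =
    (1 + 2 * x 0 2 + 2 * (x 0 2 * x 0 2)
     - (x 0 0 * x 0 0 + x 0 1 * x 0 1 + x 0 2 * x 0 2)) / r ^+ 2 by field.
  by rewrite xx; congr (_ / _); ring.
Qed.

Lemma SU2_transitive x y : dot x x = 1 -> dot y y = 1 ->
  exists2 U, SU2 U & Ad U x y.
Proof.
move=> /SU2_pole [U hU hx] /SU2_pole [V hV hy].
have hW := SU2M hV (SU2V hU); exists (V *m invmx U) => //.
have [uU _] := SU2_unit hU.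
move: hx hy; rewrite (AdP _ _ hU) (AdP _ _ hV) (AdP _ _ hW) => hx hy.
rewrite mulmxA hy -!mulmxA; congr (_ *m _).
apply: (can_inj (mulmxK uU)).
by rewrite mulmxKV // -mulmxA hx mulKmx.
Qed.

(** By the expansion [w,[w,x]] = <w,x> w - |w|^2 x. *)
Lemma bracket_unit_eq0 w x : dot w w = 1 -> bracket w x = 0 -> x = dot w x *: w.
Proof.
move=> ww wx; rewrite -[LHS]scale1r -ww.
have : bracket w (bracket w x) = dot w x *: w - dot w w *: x.
  by apply: su2_eq; rewrite !(dotE, mxE) /=; ring.
have -> : bracket w (bracket w x) = 0 by rewrite wx; apply: su2_eq; rewrite !mxE /=; ring.
by move/esym/subr0_eq.
Qed.

Lemma commuting_triple a b c : X3 (a, b, c) = (0, 0, 0) -> (a, b) != 0 ->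
  exists al be ga w, [/\ dot w w = 1, 0 < al ^+ 2 + be ^+ 2 &
    (a, b, c) = (al *: w, be *: w, ga *: w)].
Proof.
move=> [bc ca ab] ab0.
have N x : x != 0 -> exists2 w, dot w w = 1 & exists2 k, 0 < k & x = k *: w.
  move=> x0; have d0 : 0 < dot x x.
    by rewrite lt_neqAle dot_ge0 andbT; apply: contra_neq x0 => /esym/dot_eq0.
  have s0 : Num.sqrt (dot x x) != 0 by rewrite gt_eqF // sqrtr_gt0.
  exists ((Num.sqrt (dot x x))^-1 *: x).
    rewrite dotZl dotZr mulrA -expr2 exprVn sqr_sqrtr ?ltW // mulVf //.
    by rewrite gt_eqF.
  by exists (Num.sqrt (dot x x)); rewrite ?sqrtr_gt0 // scalerA mulfV // scale1r.
have B (k : R) w y : 0 < k -> bracket (k *: w) y = 0 -> bracket w y = 0.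
  move=> k0; rewrite -[y]scale1r bracketZ mulr1 => /eqP.
  by rewrite scaler_eq0 gt_eqF //= scale1r => /eqP.
have [a0|a0] := eqVneq a 0; last first.
  have [w ww [k k0 aE]] := N _ a0; subst a.
  have ac : bracket (k *: w) c = 0 by rewrite bracket_anti ca oppr0.
  exists k, (dot w b), (dot w c), w; split=> //.
    by rewrite ltr_pwDl ?sqr_ge0 ?exprn_gt0.
  by rewrite -(bracket_unit_eq0 ww (B _ _ _ k0 ab)) -(bracket_unit_eq0 ww (B _ _ _ k0 ac)).
have b0 : b != 0 by apply: contra_neq ab0 => ->; rewrite a0.
have [w ww [k k0 bE]] := N _ b0; subst b.
exists 0, k, (dot w c), w; split=> //.
  by rewrite ltr_wpDl ?sqr_ge0 ?exprn_gt0.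
by rewrite a0 scale0r -(bracket_unit_eq0 ww (B _ _ _ k0 bc)).
Qed.

(** [G_orbit] is written with the standard basis of the target; Ad being linear, the diagonal action
    is the same in any other basis. *)
Lemma Ad_frame o F U phi psi : frame o F ->
  (forall i : 'I_3, Ad U (row i phi^T) (row i psi^T)) <->
  (forall i : 'I_3, Ad U (row i F *m phi^T) (row i F *m psi^T)).
Proof.
move=> [hF _]; split=> h i.
  by rewrite !row_mul3; apply: AdD; [apply: AdD|]; apply: AdZ; apply: h.
have E (A : M) : row i A^T = row i F^T *m (F *m A^T).
  by rewrite mulmxA -!row_mul (mulmx1C hF) mul1mx.
rewrite (E phi) (E psi) !row_mul3 !row_mul.
by apply: AdD; [apply: AdD|]; apply: AdZ; apply: h.
Qed.

Lemma forall_ord3 (P : 'I_3 -> Prop) : P 0 -> P 1 -> P 2 -> forall i, P i.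
Proof.
move=> h0 h1 h2 [[|[|[|i]]] hi] //.
- by have <- : 0 = Ordinal hi by apply/val_inj.
- by have <- : 1 = Ordinal hi by apply/val_inj.
- by have <- : 2 = Ordinal hi by apply/val_inj.
Qed.

Lemma G_orbitE o F (O : set M) phi al be ga w : frame o F -> G_orbit O -> O phi ->
  Psi F phi = (al *: w, be *: w, ga *: w) -> dot w w = 1 ->
  0 < al ^+ 2 + be ^+ 2 + ga ^+ 2 ->
  O = [set psi | exists2 v, dot v v = 1 & Psi F psi = (al *: v, be *: v, ga *: v)].
Proof.
move=> fF [phi0 OE] Ophi phiE ww n0.
have AdO psi psi' U : Ad U (row 0 psi^T) (row 0 psi'^T) ->
   Ad U (row 1 psi^T) (row 1 psi'^T) -> Ad U (row 2 psi^T) (row 2 psi'^T) ->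
   forall i : 'I_3, Ad U (row i F *m psi^T) (row i F *m psi'^T).
  move=> h0 h1 h2; have [H _] := Ad_frame U psi psi' fF.
  exact: (H (@forall_ord3 (fun i => Ad U (row i psi^T) (row i psi'^T)) h0 h1 h2)).
have OP psi : O psi <-> exists2 U, SU2 U &
    forall i : 'I_3, Ad U (row i F *m phi0^T) (row i F *m psi^T).
  rewrite OE /= -!row_mul !mul1mx; split=> -[U hU].
    by move=> -[h0 h1 h2]; exists U; [exact: hU|exact: AdO h0 h1 h2].
  have [_ H] := Ad_frame U phi0 psi fF; move=> /H h.
  by exists U; [exact: hU|split; [exact: (h 0)|exact: (h 1)|exact: (h 2)]].
have [U0 hU0 h0] := (OP phi).1 Ophi.
case: phiE => pa pb pc.
apply/seteqP; split=> psi /=.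
  move=> /OP [U hU h].
  pose V := U *m invmx U0; have hV : SU2 V := SU2M hU (SU2V hU0).
  have [uU0 _] := SU2_unit hU0.
  have hV' i : Ad V (row i F *m phi^T) (row i F *m psi^T).
    move: (h i) (h0 i); rewrite (AdP _ _ hU) (AdP _ _ hU0) (AdP _ _ hV) => e e0.
    rewrite /V mulmxA e -!mulmxA; congr (_ *m _).
    apply: (can_inj (mulmxK uU0)).
    by rewrite mulmxKV // -mulmxA e0 mulKmx.
  have := hV' 0; have := hV' 1; have := hV' 2; rewrite pa pb pc => hc hb ha.
  (* [Ad] is a relation, so the image of w under V has to be exhibited: it is recovered from the
     images of al w, be w, ga w. *)
  pose v := (al ^+ 2 + be ^+ 2 + ga ^+ 2)^-1 *: (al *: (row 0 F *m psi^T) +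
     be *: (row 1 F *m psi^T) + ga *: (row 2 F *m psi^T)).
  have hv : Ad V w v.
    have := AdZ (al ^+ 2 + be ^+ 2 + ga ^+ 2)^-1
      (AdD (AdD (AdZ al ha) (AdZ be hb)) (AdZ ga hc)).
    rewrite -/v !scalerA -!scalerDl scalerA -!expr2 mulVf ?scale1r //.
    by rewrite gt_eqF.
  exists v; first by rewrite (Ad_dot hV hv).
  rewrite PsiE; congr (_, _, _).
  - exact: Ad_fun ha (AdZ al hv).
  - exact: Ad_fun hb (AdZ be hv).
  - exact: Ad_fun hc (AdZ ga hv).
move=> [v vv [qa qb qc]].
have [V hV wv] := SU2_transitive ww vv.
apply/OP; have hVU := SU2M hV hU0; exists (V *m U0) => // i.
have hVi : Ad V (row i F *m phi^T) (row i F *m psi^T).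
  move: i; apply: forall_ord3; [rewrite pa qa|rewrite pb qb|rewrite pc qc]; exact: AdZ.
move: hVi (h0 i); rewrite (AdP _ _ hU0) (AdP _ _ hVU) (AdP _ _ hV) => e e0.
by rewrite mulmxA e -!mulmxA e0.
Qed.

End SU2Orbits.

(** * Tangent vectors and isotropic motions of adjoint orbits *)

Section OrbitTangents.
Variable R : realType.
Local Notation C := R[i].
Local Notation g := (su2 R).
Local Notation gC := (sl2 R).
Implicit Types (a b c x y : g) (z w v xi eta : gC) (O : set gC).

Lemma is_derive0_cst (f : R -> R) (e k d : R) : 0 < e ->
  (forall t, -e < t < e -> f t = k) -> is_derive (0 : R) 1 f d -> d = 0.
Proof.
move=> e0 fk hf.
have h : is_derive (0 : R) 1 f 0.
  have h0 : is_derive (0 : R) 1 (fun _ : R => k) 0 by apply: is_derive_cst.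
  apply: near_eq_is_derive h0.
  exists e => //= t; rewrite /= sub0r normrN => te.
  by rewrite fk // -ltr_norml.
by rewrite -(@derive_val _ _ _ _ _ _ _ hf) (@derive_val _ _ _ _ _ _ _ h).
Qed.

(** The imaginary part of the complex-bilinear form whose real part is [dotC]. *)
Definition dotC_im z w : R := dot z.1 w.2 + dot z.2 w.1.

Lemma sl2_mx_det_eq z w : \det (sl2_mx z) = \det (sl2_mx w) <->
  dotC z z = dotC w w /\ dot z.1 z.2 = dot w.1 w.2.
Proof.
rewrite !sl2_mx_det /dotC; split=> [/eqP|[-> ->] //].
by rewrite eq_complex /= => /andP[/eqP h1 /eqP h2]; split; lra.
Qed.

Lemma is_derive_fst (f : R -> gC) (t : R) (df : gC) :
  is_derive t 1 f df -> is_derive t 1 (fun u => (f u).1) df.1.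
Proof. by apply: is_derive_linear => // -[x y]; apply: cvg_fst. Qed.

Lemma is_derive_snd (f : R -> gC) (t : R) (df : gC) :
  is_derive t 1 f df -> is_derive t 1 (fun u => (f u).2) df.2.
Proof. by apply: is_derive_linear => // -[x y]; apply: cvg_snd. Qed.

Lemma tangent_orbit_eq O z v : adjoint_orbit O -> O z -> z != 0 ->
  tangent O z v -> dotC z v = 0 /\ dotC_im z v = 0.
Proof.
move=> hO Oz z0 [gamma [e [e0 _ g0 gO dg]]].
rewrite (adjoint_orbitE hO Oz z0) /= in gO.
have G t : -e < t < e -> dotC (gamma t) (gamma t) = dotC z z /\
    dot (gamma t).1 (gamma t).2 = dot z.1 z.2.
  by move=> /gO [_ /sl2_mx_det_eq].
have d1 := is_derive_fst dg; have d2 := is_derive_snd dg.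
split.
  have := is_derive_sub (is_derive_dot d1 d1) (is_derive_dot d2 d2).
  move=> /(is_derive0_cst e0 (fun t ht => (G t ht).1)).
  by rewrite g0 /dotC (dot_comm v.1) (dot_comm v.2); lra.
have := is_derive_dot d1 d2.
move=> /(is_derive0_cst e0 (fun t ht => (G t ht).2)).
by rewrite g0 /dotC_im (dot_comm v.1) addrC.
Qed.

Lemma orthogonal_bracketC z v : z != 0 -> dotC z v = 0 -> dotC_im z v = 0 ->
  exists xi, v = bracketC z xi.
Proof.
case: z v => a b [x y]; rewrite /dotC /dotC_im /= => z0 h1 h2.
have N0 : dot a a + dot b b != 0.
  apply: contra_neq z0 => /eqP; rewrite paddr_eq0 ?dot_ge0 // => /andP[/eqP ha /eqP hb].
  by rewrite (dot_eq0 ha) (dot_eq0 hb).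
set N := dot a a + dot b b in N0.
(* This is [v, conj z] / |z|^2, from [z, [v, conj z]] = |z|^2 v - (z.v) conj z. The conjugate is
   needed because z.z may vanish for z != 0. *)
exists (N^-1 *: (bracket x a + bracket y b), N^-1 *: (bracket y a - bracket x b)).
have E1 : N *: x = bracket a (bracket x a + bracket y b)
   - bracket b (bracket y a - bracket x b) + (dot a x - dot b y) *: a
   + (dot a y + dot b x) *: b.
  by rewrite /N; apply: su2_eq; rewrite !(dotE, mxE) /=; ring.
have E2 : N *: y = bracket a (bracket y a - bracket x b)
   + bracket b (bracket x a + bracket y b) + (dot a y + dot b x) *: a
   - (dot a x - dot b y) *: b.
  by rewrite /N; apply: su2_eq; rewrite !(dotE, mxE) /=; ring.
rewrite h1 h2 !scale0r !addr0 in E1; rewrite h1 h2 !scale0r addr0 subr0 in E2.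
have BZ (k : R) x' y' : bracket x' (k *: y') = k *: bracket x' y'.
  by rewrite -[x' in LHS]scale1r bracketZ mul1r.
rewrite /bracketC /= !BZ -scalerBr -scalerDr -E1 -E2 !scalerA mulVf //.
by rewrite !scale1r.
Qed.

(* For isotropic [xi], ad_xi^3 = 0 on sl(2,C) and this is exp(t ad_xi). *)
Definition exp_ad xi (t : R) z : gC :=
  (z.1 + t *: (bracketC xi z).1 + (t * t / 2) *: (bracketC xi (bracketC xi z)).1,
   z.2 + t *: (bracketC xi z).2 + (t * t / 2) *: (bracketC xi (bracketC xi z)).2).

Lemma exp_adE xi t z : exp_ad xi t z =
  z + t *: bracketC xi z + (t * t / 2) *: bracketC xi (bracketC xi z).
Proof. by []. Qed.

Lemma mx2_traceless_sqr (p q r : C) :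
  mx2 p q r (- p) *m mx2 p q r (- p) = (- \det (mx2 p q r (- p)))%:M.
Proof.
rewrite mx2_mul mx2_det; apply/matrixP => i j; rewrite !mxE.
by case: i => [[|[|i]] hi] //; case: j => [[|[|j]] hj] //=; rewrite ?mulr1n ?mulr0n; ring.
Qed.

Lemma mx2_traceless_det1 (p q r : C) : \det (mx2 p q r (- p)) = 0 ->
  \det (1%:M + mx2 p q r (- p)) = 1.
Proof.
have -> : 1%:M + mx2 p q r (- p) = mx2 (1 + p) q r (1 - p).
  apply/matrixP => i j; rewrite !mxE.
  by case: i => [[|[|i]] hi] //; case: j => [[|[|j]] hj] //=; rewrite add0r.
rewrite !mx2_det => e.
have -> : (1 + p) * (1 - p) - q * r = 1 + (p * - p - q * r) by ring.
by rewrite e addr0.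
Qed.

(** The matrix X of t xi has trace and determinant 0, so X^2 = 0 by Cayley-Hamilton and 1 + X = exp
    X lies in SL(2,C). *)
Lemma exp_ad_AdC xi t z : dotC xi xi = 0 -> dot xi.1 xi.2 = 0 ->
  exists2 U, SL2C U & AdC U z (exp_ad xi t z).
Proof.
move=> h1 h2; pose X := (t +i* 0)%C *: sl2_mx xi; pose U := 1%:M + X.
have Xt : X = sl2_mx (t *: xi).
  by rewrite -[t *: xi]addr0 sl2_mx_linear sl2_mx0 addr0.
have dX : \det X = 0.
  rewrite /X detZ sl2_mx_det h2; rewrite /dotC in h1; rewrite h1 !mul0r.
  by rewrite (_ : (0 +i* 0)%C = 0 :> C) // mulr0.
have XX : X *m X = 0.
  move: dX; rewrite Xt sl2_mxE mx2_traceless_sqr => ->.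
  by rewrite oppr0 raddf0.
have dU : \det U = 1.
  by move: dX; rewrite /U Xt sl2_mxE; apply: mx2_traceless_det1.
exists U; first exact: dU.
have n2 : (2 : C) != 0 by rewrite pnatr_eq0.
rewrite /AdC (invmx_unipotent XX dU) -(exp_ad_mx (sl2_mx z) n2 XX) exp_adE.
have L (k : R) (u v : gC) : sl2_mx (u + k *: v) = sl2_mx u + (k +i* 0)%C *: sl2_mx v.
  by rewrite addrC sl2_mx_linear addrC.
rewrite !L !sl2_mx_bracket; congr (_ + _ *: _).
apply: (mulfI n2); rewrite !mulrA mulfV // mul1r.
by apply/eqP; rewrite eq_complex /=; apply/andP; split; apply/eqP; field.
Qed.

Lemma exp_ad_orbit O xi t z : adjoint_orbit O -> z != 0 -> dotC xi xi = 0 ->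
  dot xi.1 xi.2 = 0 -> O z -> O (exp_ad xi t z).
Proof.
move=> hO z0 h1 h2 Oz; have [U hU hz] := exp_ad_AdC t z h1 h2.
rewrite (adjoint_orbitE hO Oz z0) /=; split; last exact: AdC_det hz.
by rewrite (AdC_eq0 hU hz).
Qed.

End OrbitTangents.

(** * Curves in adjoint orbits, tangent spaces and dimension *)

Section OrbitDimension.
Variable R : realType.
Local Notation C := R[i].
Local Notation g := (su2 R).
Local Notation gC := (sl2 R).
Implicit Types (a b c : g) (z w v xi eta : gC) (O : set gC).
Implicit Types V W : normedModType R.

Lemma smooth_fst V (f : V -> gC) : smooth_on setT f ->
  smooth_on setT (fun x => (f x).1).
Proof.
move=> hf k; apply: (@Ck_linear_comp _ _ _ _ (@fst g g)); last exact: hf.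
  by [].
by move=> -[x y]; apply: cvg_fst.
Qed.

Lemma smooth_snd V (f : V -> gC) : smooth_on setT f ->
  smooth_on setT (fun x => (f x).2).
Proof.
move=> hf k; apply: (@Ck_linear_comp _ _ _ _ (@snd g g)); last exact: hf.
  by [].
by move=> -[x y]; apply: cvg_snd.
Qed.

Lemma smooth_bracketC V xi (f : V -> gC) : smooth_on setT f ->
  smooth_on setT (fun x => bracketC xi (f x)).
Proof.
move=> hf; have c x : smooth_on setT (fun _ : V => x) := @smooth_cst R V g x.
have h1 := smooth_fst hf; have h2 := smooth_snd hf.
by apply: smooth_pair; [apply: smoothB|apply: smoothD]; apply: smooth_bracket.
Qed.

Lemma is_derive_bracketC xi (f : R -> gC) (t : R) (df : gC) :
  is_derive t 1 f df ->
  is_derive t 1 (fun u => bracketC xi (f u)) (bracketC xi df).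
Proof.
move=> hf; have h1 := is_derive_fst hf; have h2 := is_derive_snd hf.
have c (x : g) : is_derive t 1 (fun _ : R => x) 0 by apply: is_derive_cst.
have z0 x : bracket (0 : g) x = 0.
  by apply: su2_eq; rewrite !mxE /=; ring.
have E (x : g) (k : R -> g) dk : is_derive t 1 k dk ->
    is_derive t 1 (fun u => bracket x (k u)) (bracket x dk).
  by move=> hk; have := is_derive_bracket (c x) hk; rewrite z0 add0r.
exact: (is_derive_pair (is_derive_sub (E _ _ _ h1) (E _ _ _ h2))
  (is_derive_add (E _ _ _ h2) (E _ _ _ h1))).
Qed.

Lemma is_derive_quadratic (f A B : R -> g) (df dA dB : g) :
  is_derive (0 : R) 1 f df -> is_derive (0 : R) 1 A dA -> is_derive (0 : R) 1 B dB ->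
  is_derive (0 : R) 1 (fun t => f t + t *: A t + (t * t / 2) *: B t) (df + A 0).
Proof.
move=> hf hA hB; have hi := is_derive_id (0 : R) 1.
have c : is_derive (0 : R) 1 (fun _ : R => 2^-1 : R) 0 by apply: is_derive_cst.
have := is_derive_add (is_derive_add hf (is_derive_scale hi hA))
  (is_derive_scale (is_derive_mul (is_derive_mul hi hi) c) hB).
by congr is_derive; rewrite !(mulr0, mul0r, addr0, scale0r, scale1r).
Qed.

(** The base point [f t] moves too, so that several such motions can be composed; their velocities
    at 0 add up. *)
Lemma exp_ad_curve xi (f : R -> gC) (df : gC) : smooth_on setT f ->
  is_derive (0 : R) 1 f df ->
  smooth_on setT (fun t => exp_ad xi t (f t)) /\
  is_derive (0 : R) 1 (fun t => exp_ad xi t (f t)) (df + bracketC xi (f 0)).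
Proof.
move=> sf hf; split.
  have id_smooth : smooth_on setT (fun t : R => t).
    by apply: smooth_linear => // x; apply: cvg_id.
  have c : smooth_on setT (fun _ : R => 2^-1 : R) := smooth_cst _ _.
  have s1 := smooth_bracketC xi sf; have s2 := smooth_bracketC xi s1.
  by apply: smooth_pair; (apply: smoothD; [apply: smoothD|]);
    try (apply: smooth_scale => //); try (apply: smoothM => //; apply: smoothM => //);
    (apply: smooth_fst || apply: smooth_snd).
have h1 := is_derive_bracketC xi hf; have h2 := is_derive_bracketC xi h1.
apply: (@is_derive_pair _ _ _ _ _ _ _ _ (df.1 + (bracketC xi (f 0)).1)
  (df.2 + (bracketC xi (f 0)).2)).
  exact: (is_derive_quadratic (is_derive_fst hf) (is_derive_fst h1) (is_derive_fst h2)).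
exact: (is_derive_quadratic (is_derive_snd hf) (is_derive_snd h1) (is_derive_snd h2)).
Qed.

Lemma exp_ad0 xi z : exp_ad xi 0 z = z.
Proof. by case: z => a b; rewrite /exp_ad !mul0r !scale0r !addr0. Qed.

(* (1, i, 0), (1, -i, 0) and (0, 1, i) are isotropic and span C^3. *)
Lemma isotropic_sum xi : exists x1 x2 x3 : gC,
  [/\ xi = x1 + x2 + x3, dotC x1 x1 = 0 /\ dot x1.1 x1.2 = 0,
      dotC x2 x2 = 0 /\ dot x2.1 x2.2 = 0 & dotC x3 x3 = 0 /\ dot x3.1 x3.2 = 0].
Proof.
case: xi => x y.
pose p1 := (x 0 0 + x 0 2 + y 0 1) / 2; pose q1 := (y 0 0 + y 0 2 - x 0 1) / 2.
pose p2 := (x 0 0 - x 0 2 - y 0 1) / 2; pose q2 := (y 0 0 - y 0 2 + x 0 1) / 2.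
pose p3 := y 0 2; pose q3 := - x 0 2.
exists (vec3 p1 (- q1) 0, vec3 q1 p1 0), (vec3 p2 q2 0, vec3 q2 (- p2) 0),
  (vec3 0 p3 (- q3), vec3 0 q3 p3).
split; last 3 first.
- by rewrite /dotC !dotE !mxE /=; split; ring.
- by rewrite /dotC !dotE !mxE /=; split; ring.
- by rewrite /dotC !dotE !mxE /=; split; ring.
rewrite -[RHS]/(_ + _ + _, _ + _ + _); congr (_, _); apply: su2_eq;
  rewrite !mxE /= /p1 /q1 /p2 /q2 /p3 /q3; by field.
Qed.

Lemma orbit_curve O z xi : adjoint_orbit O -> O z -> z != 0 ->
  exists gamma : R -> gC, [/\ smooth_on setT gamma, gamma 0 = z,
    forall t, O (gamma t) & is_derive (0 : R) 1 gamma (bracketC z xi)].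
Proof.
move=> hO Oz z0.
have O0 w : O w -> w != 0 by rewrite (adjoint_orbitE hO Oz z0) => -[].
(* The sign: [exp_ad x] moves z with velocity [x,z], and [z,xi] = [- xi,z]. *)
have [x1 [x2 [x3 [xE [i1 j1] [i2 j2] [i3 j3]]]]] := isotropic_sum (- xi).
have s0 : smooth_on setT (fun _ : R => z) := smooth_cst _ z.
have d0 : is_derive (0 : R) 1 (fun _ : R => z) 0 by apply: is_derive_cst.
have [s1 d1] := exp_ad_curve x1 s0 d0.
have [s2 d2] := exp_ad_curve x2 s1 d1.
have [s3 d3] := exp_ad_curve x3 s2 d2.
exists (fun t => exp_ad x3 t (exp_ad x2 t (exp_ad x1 t z))); split.
- exact: s3.
- by rewrite !exp_ad0.
- move=> t; have o1 := exp_ad_orbit t hO z0 i1 j1 Oz.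
  have o2 := exp_ad_orbit t hO (O0 _ o1) i2 j2 o1.
  exact: (exp_ad_orbit t hO (O0 _ o2) i3 j3 o2).
move: d3; rewrite !exp_ad0; congr is_derive.
have -> : bracketC z xi = bracketC (x1 + x2 + x3) z.
  rewrite -xE /bracketC /=; congr (_, _); apply: su2_eq; rewrite !mxE /=; ring.
rewrite add0r /bracketC /=; congr (_, _); apply: su2_eq; rewrite !mxE /=; ring.
Qed.

Lemma tangent_orbitP O z v : adjoint_orbit O -> O z -> z != 0 ->
  tangent O z v <-> exists xi, v = bracketC z xi.
Proof.
move=> hO Oz z0; split.
  by move=> /(tangent_orbit_eq hO Oz z0) [h1 h2]; apply: orthogonal_bracketC.
move=> [xi ->]; have [gamma [s g0 gO dg]] := orbit_curve xi hO Oz z0.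
by exists gamma, 1; split=> // k; apply: Ck_subset (s k) => t _.
Qed.

Lemma tangent_orbit_orthogonalP O z v : adjoint_orbit O -> O z -> z != 0 ->
  tangent O z v <-> dotC z v = 0 /\ dotC_im z v = 0.
Proof.
move=> hO Oz z0; split; first exact: tangent_orbit_eq.
move=> [h1 h2]; apply/(tangent_orbitP v hO Oz z0).
exact: orthogonal_bracketC.
Qed.

Lemma orbit_dim O z : adjoint_orbit O -> O z -> z != 0 -> has_dim O 4%N.
Proof.
move=> hO Oz z0 p Op.
have p0 : p != 0 by move: Op; rewrite (adjoint_orbitE hO Oz z0) => -[].
(* The rows are the real and imaginary parts of v |-> p.v, so the tangent space is the kernel of N,
   of dimension 6 - 2. *)
pose N : 'M[R]_(1 + 1, 3 + 3) := block_mx p.1 (- p.2) p.2 p.1.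
have vN (v : gC) : N *m (row_mx v.1 v.2)^T = 0 <-> dotC p v = 0 /\ dotC_im p v = 0.
  rewrite tr_row_mx mul_block_col /dotC /dotC_im mulNmx.
  rewrite [_ - _]mx11_scalar [X in col_mx _ X]mx11_scalar.
  have E : (p.1 *m v.1^T - p.2 *m v.2^T) 0 0 = dot p.1 v.1 - dot p.2 v.2.
    by rewrite !dotEmx !mxE.
  have E' : (p.2 *m v.1^T + p.1 *m v.2^T) 0 0 = dot p.1 v.2 + dot p.2 v.1.
    by rewrite !dotEmx !mxE addrC.
  rewrite E E'; split=> [h|[-> ->]]; last by rewrite !raddf0 col_mx0.
  have := congr1 usubmx h; have := congr1 dsubmx h; rewrite col_mxKu col_mxKd !linear0.
  move=> /(congr1 (fun A : 'M[R]_1 => A 0 0)) h2 /(congr1 (fun A : 'M[R]_1 => A 0 0)) h1.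
  by move: h1 h2; rewrite !mxE !mulr1n.
have fN : row_free N.
  apply: inj_row_free => u; rewrite -[u]hsubmxK mul_row_block => h.
  set x := lsubmx u 0 0; set y := rsubmx u 0 0.
  have lE : lsubmx u = x%:M by apply: mx11_scalar.
  have rE : rsubmx u = y%:M by apply: mx11_scalar.
  move: h; rewrite lE rE !mul_scalar_mx => h.
  have h1 : x *: p.1 + y *: p.2 = 0.
    by rewrite -(row_mxKl (x *: p.1 + y *: p.2) (x *: - p.2 + y *: p.1)) h linear0.
  have h2 : x *: - p.2 + y *: p.1 = 0.
    by rewrite -(row_mxKr (x *: p.1 + y *: p.2) (x *: - p.2 + y *: p.1)) h linear0.
  (* [h1] and [h2] say (x - iy) p = 0 in complex notation; this multiplies by the conjugate x +
     iy. *)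
  have e1 : (x ^+ 2 + y ^+ 2) *: p.1 = 0.
    transitivity (x *: (x *: p.1 + y *: p.2) + y *: (x *: - p.2 + y *: p.1)).
      by apply: su2_eq; rewrite !mxE; ring.
    by rewrite h1 h2 !scaler0 addr0.
  have e2 : (x ^+ 2 + y ^+ 2) *: p.2 = 0.
    transitivity (y *: (x *: p.1 + y *: p.2) - x *: (x *: - p.2 + y *: p.1)).
      by apply: su2_eq; rewrite !mxE; ring.
    by rewrite h1 h2 !scaler0 subr0.
  have /eqP : x ^+ 2 + y ^+ 2 = 0.
    apply/eqP; apply: contra_neqT p0 => xy.
    move/eqP: e1; rewrite scaler_eq0 (negPf xy) /= => /eqP a0.
    move/eqP: e2; rewrite scaler_eq0 (negPf xy) /= => /eqP b0.
    by rewrite [p]surjective_pairing a0 b0.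
  rewrite paddr_eq0 ?sqr_ge0 // !sqrf_eq0 => /andP[/eqP -> /eqP ->].
  by rewrite !raddf0 row_mx0.
pose K := kermx N^T.
have rK : \rank K = 4%N by rewrite mxrank_ker mxrank_tr (eqP fN).
(* The basis is indexed by the rank, as [row_base K] is. *)
rewrite -rK.
pose b (i : 'I_(\rank K)) : gC := (lsubmx (row i (row_base K)), rsubmx (row i (row_base K))).
have bE (c : 'I_(\rank K) -> R) (v : gC) : v = \sum_i c i *: b i <->
    row_mx v.1 v.2 = (\row_i c i) *m row_base K.
  have S : row_mx (\sum_i c i *: b i).1 (\sum_i c i *: b i).2 = (\row_i c i) *m row_base K.
    rewrite mulmx_sum_row.
    have -> : (\sum_i c i *: b i).1 = \sum_i c i *: (b i).1.
      by apply: (big_morph (@fst g g)).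
    have -> : (\sum_i c i *: b i).2 = \sum_i c i *: (b i).2.
      by apply: (big_morph (@snd g g)).
    set T := (X in _ = X); rewrite -[T]hsubmxK /T !linear_sum /=;
      congr row_mx; apply: eq_bigr => i _;
      by rewrite mxE linearZ.
  split=> [->|h]; first exact: S.
  rewrite -S in h; have [h1 h2] := eq_row_mx h.
  by rewrite [v]surjective_pairing h1 h2 -surjective_pairing.
exists b; split.
  move=> c c0; have := (bE c 0).1 (esym c0).
  rewrite row_mx0 => e i.
  have /(row_free_inj (row_base_free K)) : (\row_i c i) *m row_base K = 0 *m row_base K.
    by rewrite mul0mx -e.
  by move=> /rowP /(_ i); rewrite !mxE.
move=> v; rewrite (tangent_orbit_orthogonalP v hO Op p0) -vN.
have -> : N *m (row_mx v.1 v.2)^T = 0 <-> (row_mx v.1 v.2 <= row_base K)%MS.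
  rewrite eq_row_base; split=> h.
    by apply/sub_kermxP; rewrite -[LHS]trmxK trmx_mul trmxK h linear0.
  by have /sub_kermxP := h; move=> /(congr1 trmx); rewrite trmx_mul trmxK linear0.
split.
  move=> /submxP [D hD]; exists (fun i => D 0 i); apply/bE; rewrite hD.
  by congr (_ *m _); apply/rowP => i; rewrite mxE.
by move=> [c /bE ->]; apply: submxMl.
Qed.

(** The orbit of 0 is a point and all its curves are constant, so a tangent basis is empty there,
    whereas the orbit of any nonzero element forces the maximal dimension to be at least 4. *)
Lemma regular_orbit_neq0 O z : adjoint_orbit O -> regular_orbit O -> O z -> z != 0.
Proof.
move=> [w OE] [d [hd hmax]] Oz; apply/eqP => z0; subst z.
have w0 : w = 0.
  by move: Oz; rewrite OE => -[U hU h]; apply/eqP; rewrite -(AdC_eq0 hU h).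
have O0 v : O v -> v = 0.
  by rewrite OE w0 => -[U hU h]; apply/eqP; rewrite (AdC_eq0 hU h).
pose e : gC := (vec3 1 0 0, 0).
have e0 : e != 0.
  by apply/eqP => /(congr1 (fun x : gC => x.1 0 0)); rewrite !mxE /=; apply/eqP; rewrite oner_eq0.
have d4 : (4 <= d)%N.
  apply: hmax (adjoint_orbit_in e) _; apply: (orbit_dim (adjoint_orbit_in e) _ e0).
  by exists 1%:M; [exact: SL2C1|exact: AdC1].
case: d d4 hd {hmax} => // d _ /(_ 0 Oz) [b [bfree btan]].
pose c (i : 'I_d.+1) : R := (i == ord0)%:R.
have b0 : b ord0 = 0.
  have : tangent O 0 (b ord0).
    apply/btan; exists c; rewrite (bigD1 ord0) //= big1 /c ?eqxx ?scale1r ?addr0 //.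
    by move=> i /negPf ->; rewrite scale0r.
  move=> [gamma [r [r0 _ _ gO dg]]].
  have G t : -r < t < r -> gamma t = 0 by move=> /gO /O0.
  have d1 := is_derive_fst dg; have d2 := is_derive_snd dg.
  rewrite [b ord0]surjective_pairing; congr (_, _); apply/matrixP => i j; rewrite mxE.
    apply: (is_derive0_cst r0 _ (is_derive_coord i j d1)).
    by move=> t /G ->; rewrite mxE.
  apply: (is_derive0_cst r0 _ (is_derive_coord i j d2)).
  by move=> t /G ->; rewrite mxE.
have := bfree c _ ord0; rewrite /c eqxx => h.
have : (1 : R) = 0.
  apply: h; rewrite (bigD1 ord0) //= big1 ?b0 ?scaler0 ?addr0 //.
  by move=> i /negPf ->; rewrite scale0r.
by move/eqP; rewrite oner_eq0.
Qed.

End OrbitDimension.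

(** * The unstable manifold as a graph over an adjoint orbit *)

Section Graph.
Variables (R : realType) (o : bool) (F : 'M[R]_3) (al be ga : R).
Local Notation g := (su2 R).
Local Notation gC := (sl2 R).
Local Notation M := (Hom_su2 R).
Implicit Types (a b c : g) (z w : gC) (phi : M).
Hypotheses (fF : frame o F) (m0 : 0 < al ^+ 2 + be ^+ 2).

(* On the unstable manifold this is [s + al ^+ 2 + be ^+ 2]; the formula for [c]
   solves the equations of [gram_shift] and makes sense for all [a] and [b]. *)
Definition graph_p a b : R := (dot a a + dot b b + (al ^+ 2 + be ^+ 2)) / 2.

Definition graph_third a b : g :=
  (graph_p a b)^-1 *: (ga *: (al *: a + be *: b)
    + Num.sqrt (graph_p a b + ga ^+ 2) *: bracket a b).

Definition graph_map z : M := Psi_inv F (z.1, z.2, graph_third z.1 z.2).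

Lemma graph_p_gt0 a b : 0 < graph_p a b.
Proof. by rewrite divr_gt0 // ltr_wpDl // addr_ge0 ?dot_ge0. Qed.

Lemma graph_q_gt0 a b : 0 < graph_p a b + ga ^+ 2.
Proof. by rewrite ltr_pwDl ?graph_p_gt0 ?sqr_ge0. Qed.

(** Composition with [f] makes this serve both for the inverse diffeomorphism and for lifting
    curves. *)
Lemma smooth_graph_map (V : normedModType R) (f : V -> gC) : smooth_on setT f ->
  smooth_on setT (graph_map \o f).
Proof.
move=> hf; have h1 := smooth_fst hf; have h2 := smooth_snd hf.
have c (W : normedModType R) (k : W) : smooth_on setT (fun _ : V => k) := smooth_cst _ k.
have hp : smooth_on setT (fun x => graph_p (f x).1 (f x).2).
  apply: smoothM (c _ _); apply: smoothD (c _ _).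
  by apply: smoothD; apply: smooth_dot.
have h3 : smooth_on setT (fun x => graph_third (f x).1 (f x).2).
  apply: smooth_scale.
    by move=> k; apply: CkV (hp k) => z; rewrite gt_eqF ?graph_p_gt0.
  apply: smoothD.
    by apply: smooth_scale (c _ _) _; apply: smoothD; apply: smooth_scale.
  apply: smooth_scale (smooth_bracket h1 h2) => k.
  apply: Ck_sqrt; first by move=> z; apply: graph_q_gt0.
  by apply: smoothD hp (c _ _) k.
apply: smooth_mx => i j.
have -> : (fun x => (graph_map \o f) x i j) = fun x => (f x).1 0 i * F 0 j
    + (f x).2 0 i * F 1 j + graph_third (f x).1 (f x).2 0 i * F 2 j.
  by apply/funext => x; rewrite /= /graph_map /Psi_inv !mxE !big_ord1 !mxE.
by do 2?apply: smoothD; apply: smoothM (c _ _); apply: smooth_coord.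
Qed.

Lemma Psi_graph_map z : Psi F (graph_map z) = (z.1, z.2, graph_third z.1 z.2).
Proof. exact: Psi_invK fF. Qed.

Lemma gram_shift_graphP a b c :
  (exists s sg, gram_shift al be ga s sg a b c) <->
  [/\ dotC (a, b) (a, b) = al ^+ 2 - be ^+ 2, dot a b = al * be & c = graph_third a b].
Proof.
split=> [[s [sg h]]|[h1 h2 cE]].
  have T := gram_shift_third h.
  case: h => [[aa bb cc] [ab bc ca] s0 [sg0 sgE] P].
  have pE : graph_p a b = s + al ^+ 2 + be ^+ 2 by rewrite /graph_p aa bb; field.
  split=> //; first by rewrite /dotC /= aa bb; ring.
  have p0 := graph_p_gt0 a b.
  have sE : Num.sqrt (graph_p a b + ga ^+ 2) = sg.
    have -> : graph_p a b + ga ^+ 2 = sg ^+ 2 by rewrite pE sgE; ring.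
    by rewrite sqrtr_sqr ger0_norm // ltW.
  by rewrite /graph_third sE -T -pE scalerA mulVf ?scale1r // gt_eqF.
rewrite /dotC /= in h1.
pose s := dot a a - al ^+ 2.
have aa : dot a a = al ^+ 2 + s by rewrite /s; ring.
have bb : dot b b = be ^+ 2 + s by rewrite /s; lra.
have L : dot (bracket a b) (bracket a b) = s * (s + (al ^+ 2 + be ^+ 2)).
  by rewrite bracket_lagrange (dot_comm b a) aa bb h2; ring.
have s0 : 0 <= s.
  have := dot_ge0 (bracket a b); rewrite L.
  have := dot_ge0 a; have := dot_ge0 b; rewrite aa bb => hb ha hab.
  rewrite leNgt; apply/negP => sneg.
  by move: hab; rewrite nmulr_rge0 // => ?; lra.
have pE : graph_p a b = s + (al ^+ 2 + be ^+ 2) by rewrite /graph_p aa bb; field.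
set sg := Num.sqrt (s + (al ^+ 2 + be ^+ 2 + ga ^+ 2)).
have q0 : 0 < s + (al ^+ 2 + be ^+ 2 + ga ^+ 2).
  by have := graph_q_gt0 a b; rewrite pE; lra.
have sgE : sg ^+ 2 = s + (al ^+ 2 + be ^+ 2 + ga ^+ 2) by rewrite sqr_sqrtr ?ltW.
have sE : Num.sqrt (graph_p a b + ga ^+ 2) = sg by rewrite /sg pE; congr Num.sqrt; ring.
have p0 : s + (al ^+ 2 + be ^+ 2) != 0 by rewrite -pE gt_eqF ?graph_p_gt0.
(* All that is missing of the Gram matrix and of Phi follows from the pairings of c with a, b and
   [a,b]. *)
have cD x : dot c x = (ga * (al * dot a x + be * dot b x) + sg * dot (bracket a b) x)
    / (s + (al ^+ 2 + be ^+ 2)).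
  by rewrite cE /graph_third sE pE !(dotZl, dotDl) mulrC.
have Ba : dot (bracket a b) a = 0 by rewrite !(dotE, mxE) /=; ring.
have Bb : dot (bracket a b) b = 0 by rewrite !(dotE, mxE) /=; ring.
have ca : dot c a = ga * al.
  by rewrite cD Ba aa (dot_comm b a) h2; field.
have cb : dot c b = be * ga by rewrite cD Bb bb h2; field.
have cx : dot c (bracket a b) = s * sg.
  by rewrite cD L (dot_comm a) Ba (dot_comm b) Bb; field.
exists s, sg; split=> //.
- split=> //; rewrite cD (dot_comm a c) (dot_comm b c) (dot_comm _ c) ca cb cx.
  have -> : sg * (s * sg) = s * sg ^+ 2 by ring.
  by rewrite sgE; field.
- by split; rewrite ?(dot_comm b c).
- by split; rewrite ?sqrtr_gt0.
- by rewrite -cx /Phi3 -dot_bracket_cyc -dot_bracket_cyc.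
Qed.

Section Orbit.
Variables (O : set M) (O12 : set gC) (z0 : gC).
Hypothesis OE :
  O = [set phi | exists2 v, dot v v = 1 & Psi F phi = (al *: v, be *: v, ga *: v)].
Hypotheses (hO12 : adjoint_orbit O12) (Oz0 : O12 z0)
  (z0re : dotC z0 z0 = al ^+ 2 - be ^+ 2) (z0im : dot z0.1 z0.2 = al * be).

(** The level (al + i be)^2 is nonzero by [m0]. *)
Lemma level_neq0 w : dotC w w = al ^+ 2 - be ^+ 2 -> dot w.1 w.2 = al * be -> w != 0.
Proof.
move=> h1 h2; apply/eqP => w0; move: h1 h2; rewrite w0 /dotC !dot0l subrr.
move=> /esym/subr0_eq h1 /esym/eqP; rewrite mulf_eq0 -(sqrf_eq0 al) -(sqrf_eq0 be) h1 orbb.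
by move=> /eqP h2; move: m0; rewrite h1 h2 addr0 ltxx.
Qed.

Lemma O12P w : O12 w <-> dotC w w = al ^+ 2 - be ^+ 2 /\ dot w.1 w.2 = al * be.
Proof.
rewrite (adjoint_orbitE hO12 Oz0 (level_neq0 z0re z0im)) /= sl2_mx_det_eq z0re z0im.
by split=> [[]//|[h1 h2]]; split=> //; apply: level_neq0.
Qed.

Lemma S_orb_gramP phi a b c : Psi F phi = (a, b, c) ->
  S_orb o O phi <-> exists s sg, gram_shift al be ga s sg a b c.
Proof.
move=> phiE; split.
  move=> [_ [l]]; rewrite OE /= => -[w ww lE] hl.
  exact: (backward_limit_gram_shift fF hl lE ww phiE m0).
move=> [s [sg h]].
have n0 : 0 < al ^+ 2 + be ^+ 2 + ga ^+ 2 by rewrite ltr_pwDl ?sqr_ge0.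
have [w [ww hl]] := gram_shift_backward_limit fF phiE h n0.
split; first by eexists; exact: hl.
exists (Psi_inv F (al *: w, be *: w, ga *: w)); last exact: hl.
by rewrite OE; exists w; [exact: ww|exact: Psi_invK fF].
Qed.

Lemma S_orb_graphP phi :
  S_orb o O phi <-> O12 (pr12 (Psi F phi)) /\ phi = graph_map (pr12 (Psi F phi)).
Proof.
case phiE : (Psi F phi) => [[a b] c]; rewrite (S_orb_gramP phiE) gram_shift_graphP O12P /=.
split=> [[h1 h2 h3]|[[h1 h2] h3]]; split=> //.
  by apply: (Psi_inj fF); rewrite Psi_graph_map phiE h3.
by move: phiE; rewrite h3 Psi_graph_map => -[].
Qed.

Lemma pr12_graph_map z : pr12 (Psi F (graph_map z)) = z.
Proof. by rewrite Psi_graph_map; case: z. Qed.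

Lemma S_orb_graph_map z : O12 z -> S_orb o O (graph_map z).
Proof. by move=> hz; apply/S_orb_graphP; rewrite pr12_graph_map. Qed.

Lemma pr12_Psi_linear : linear (@pr12 R \o Psi F).
Proof. by move=> k x y; rewrite -[LHS]/(pr12 (Psi F (k *: x + y))) Psi_linear. Qed.

Lemma S_orb_bij : set_bij (S_orb o O) O12 (@pr12 R \o Psi F).
Proof.
split=> [phi /S_orb_graphP [] //|phi psi|z hz].
  rewrite !inE => /S_orb_graphP [_ {2}->] /S_orb_graphP [_ {2}->] /= e.
  by rewrite e.
by exists (graph_map z); [exact: S_orb_graph_map|exact: pr12_graph_map].
Qed.

Lemma S_orb_image : (@pr12 R \o Psi F) @` S_orb o O = O12.
Proof.
have [h _ s] := S_orb_bij; apply/seteqP; split=> [_ [phi hphi <-]|z /s //].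
exact: h.
Qed.

Lemma S_orb_diffeomorphism : diffeomorphism (S_orb o O) O12 (@pr12 R \o Psi F).
Proof.
split; first exact: S_orb_bij.
  move=> x _; exists setT, (@pr12 R \o Psi F); split=> //; first exact: openT.
  exact: smooth_linear_mx pr12_Psi_linear.
exists graph_map; split; first by move=> phi /S_orb_graphP [_ <-].
move=> z _; exists setT, graph_map; split=> //; first exact: openT.
by apply: (smooth_graph_map (f := id)); apply: smooth_linear => // x; apply: cvg_id.
Qed.

End Orbit.
End Graph.

(** * Hamiltonian vectors and induced forms *)

Section HamiltonianVectors.
Variable R : realType.
Local Notation g := (su2 R).
Local Notation gC := (sl2 R).
Local Notation M := (Hom_su2 R).
Implicit Types (a b c : g) (F : 'M[R]_3) (phi : M) (o : bool).

(** If u and v are Hamiltonian for k and k', then pi p k k' = ev k' u depends on k only through u,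
    and by antisymmetry on k' only through v. Any choice made by [xget] is therefore the right
    value. *)
Lemma induced_form_exists (V : normedModType R) (K : Type) (ev : K -> V -> R)
    (pi : V -> K -> K -> R) (X : set V) :
  (forall p v, X p -> tangent X p v <-> exists k, hamiltonian_vector ev pi p k v) ->
  (forall p k k', X p -> pi p k k' = - pi p k' k) ->
  exists om, induced_symplectic_form ev pi X om.
Proof.
move=> tan anti.
pose P p u v := [set r | exists k k', [/\ hamiltonian_vector ev pi p k u,
  hamiltonian_vector ev pi p k' v & r = pi p k k']].
exists (fun p u v => xget 0 (P p u v)) => p Xp; split; first by move=> v; apply: tan.
move=> k k' u v hu hv.
have : P p u v (xget 0 (P p u v)) by apply: (@xgetI _ _ _ (pi p k k')); exists k, k'.
move=> [l [l' [hu' hv' ->]]].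
by rewrite -(hu' l') (hu l') (anti p k l') // -(hv' k) (hv k) -(anti p k k').
Qed.

Lemma A_op0 o phi : A_op o phi 0 = 0.
Proof. by apply: dot_inj => x; rewrite dot_comm -A_tensor_op A_tensor_sym A_tensor_op !dot0r. Qed.

Lemma hamiltonian_vectorP o F phi v x1 x2 x3 a b c : frame o F ->
  Psi F phi = (a, b, c) ->
  hamiltonian_vector (@lin3 R F) (@pi_ R o F) phi (x1, x2, x3) v <->
  Psi F v = (bracket a x1 + bracket b x2 + bracket c x3,
             bracket b x1 - bracket a x2 - A_op o phi x3,
             bracket c x1 - bracket a x3 + A_op o phi x2).
Proof.
move=> fF phiE.
have piE e1 e2 e3 : pi_ o F phi (x1, x2, x3) (e1, e2, e3) =
    dot e1 (bracket a x1 + bracket b x2 + bracket c x3)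
    + dot e2 (bracket b x1 - bracket a x2 - A_op o phi x3)
    + dot e3 (bracket c x1 - bracket a x3 + A_op o phi x2).
  rewrite /pi_ phiE.
  rewrite !A_tensor_op; move: (A_op o phi x2) (A_op o phi x3) => y2 y3.
  by rewrite !(dotE, mxE) /=; ring.
case vE : (Psi F v) => [[da db] dc].
have lE e1 e2 e3 : lin3 F (e1, e2, e3) v = dot e1 da + dot e2 db + dot e3 dc.
  by rewrite /lin3 vE.
split=> [h|[Ea Eb Ec] [[e1 e2] e3]]; last by rewrite piE lE Ea Eb Ec.
have {}h e1 e2 e3 := etrans (esym (lE e1 e2 e3)) (etrans (h (e1, e2, e3)) (piE e1 e2 e3)).
congr (_, _, _); apply: dot_inj => x.
- by have := h x 0 0; rewrite !dot0l !addr0.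
- by have := h 0 x 0; rewrite !dot0l !addr0 !add0r.
- by have := h 0 0 x; rewrite !dot0l !add0r.
Qed.

Lemma pi_anti o F phi k k' : pi_ o F phi k k' = - pi_ o F phi k' k.
Proof.
case: k k' => [[x1 x2] x3] [[y1 y2] y3]; rewrite /pi_; case: (Psi F phi) => [[a b] c].
rewrite (A_tensor_sym o phi x2) (A_tensor_sym o phi x3).
by rewrite !(dotE, mxE) /=; ring.
Qed.

Lemma lie_poisson_anti (z xi eta : gC) : lie_poisson z xi eta = - lie_poisson z eta xi.
Proof. by rewrite /lie_poisson /dotC /bracketC /= !(dotE, mxE) /=; ring. Qed.

Lemma is_derive0_cst_vec (f : R -> g) (e : R) (k d : g) : 0 < e ->
  (forall t, -e < t < e -> f t = k) -> is_derive (0 : R) 1 f d -> d = 0.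
Proof.
move=> e0 fk hf; apply/matrixP => i j; rewrite mxE.
by apply: (is_derive0_cst e0 _ (is_derive_coord i j hf)) => t /fk ->.
Qed.

Lemma is_derive_sqrt_comp (f : R -> R) (t df : R) : 0 < f t -> is_derive t 1 f df ->
  is_derive t 1 (fun u => Num.sqrt (f u)) (df / (2 * Num.sqrt (f t))).
Proof.
move=> f0 hf; rewrite mulrC.
exact: (@is_derive1_comp _ Num.sqrt f t _ _ (is_derive1_sqrt f0) hf).
Qed.

(* At a critical point the Hamiltonian vectors satisfy the linearized equation
   of the graph. *)
Lemma critical_linearized (al be ga n : R) (w x1 x2 x3 : g) : dot w w = 1 ->
  n ^+ 2 = al ^+ 2 + be ^+ 2 + ga ^+ 2 ->
  let T x := x - dot w x *: w in
  let da := bracket w (al *: x1 + be *: x2 + ga *: x3) in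
  let db := bracket w (be *: x1 - al *: x2) - n *: T x3 in
  (al ^+ 2 + be ^+ 2) *: (bracket w (ga *: x1 - al *: x3) + n *: T x2) =
  ga *: (al *: da + be *: db) + n *: (bracket da (be *: w) + bracket (al *: w) db).
Proof.
move=> ww nE T da db.
(* On the plane orthogonal to w, J = [w, .] is a complex structure and T is the projection to that
   plane. *)
have JJ x : bracket w (bracket w x) = - T x.
  have -> : bracket w (bracket w x) = dot w x *: w - dot w w *: x.
    by apply: su2_eq; rewrite !(dotE, mxE) /=; ring.
  by rewrite ww scale1r /T opprB.
have JT x : bracket w (T x) = bracket w x.
  by rewrite /T; apply: su2_eq; rewrite !mxE /=; ring.
have L k x y : bracket w (k *: x + y) = k *: bracket w x + bracket w y.
  by apply: su2_eq; rewrite !mxE /=; ring.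
have daE : da = al *: bracket w x1 + be *: bracket w x2 + ga *: bracket w x3.
  by rewrite /da; apply: su2_eq; rewrite !mxE /=; ring.
have dbE : db = be *: bracket w x1 - al *: bracket w x2 - n *: T x3.
  by rewrite /db; congr (_ - _); apply: su2_eq; rewrite !mxE /=; ring.
clearbody da db.
have wda : bracket w da = - (al *: T x1 + be *: T x2 + ga *: T x3).
  transitivity (al *: bracket w (bracket w x1) + be *: bracket w (bracket w x2)
      + ga *: bracket w (bracket w x3)).
    by rewrite daE; apply: su2_eq; rewrite !mxE /=; ring.
  by rewrite !JJ !scalerN -!opprD.
have wdb : bracket w db = - (be *: T x1) + al *: T x2 - n *: bracket w x3.
  transitivity (be *: bracket w (bracket w x1) - al *: bracket w (bracket w x2)
      - n *: bracket w (T x3)).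
    by rewrite dbE; apply: su2_eq; rewrite !mxE /=; ring.
  by rewrite !JJ JT !scalerN opprK.
have swap x y : bracket x (be *: w) + bracket (al *: w) y =
    al *: bracket w y - be *: bracket w x.
  by apply: su2_eq; rewrite !mxE /=; ring.
rewrite swap.
rewrite wda wdb daE dbE.
have -> : bracket w (ga *: x1 - al *: x3) = ga *: bracket w x1 - al *: bracket w x3.
  by apply: su2_eq; rewrite !mxE /=; ring.
(* From here on the J's and T's are free vectors; the two sides differ by a multiple of the relation
   [nE]. *)
move: (bracket w x1) (bracket w x2) (bracket w x3) (T x1) (T x2) (T x3).
move=> J1 J2 J3 T1 T2 T3; apply/subr0_eq.
transitivity ((n ^+ 2 - (al ^+ 2 + be ^+ 2 + ga ^+ 2)) *: (al *: J3)).
  by apply: su2_eq; rewrite !mxE /=; ring.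
by rewrite nE subrr scale0r.
Qed.

End HamiltonianVectors.

(** * Tangent spaces of the graph and comparison of the two forms *)

Section SymplecticGraph.
Variables (R : realType) (o : bool) (F : 'M[R]_3) (al be ga : R).
Local Notation g := (su2 R).
Local Notation gC := (sl2 R).
Local Notation M := (Hom_su2 R).
Implicit Types (a b c : g) (z w : gC) (phi : M).
Hypotheses (fF : frame o F) (m0 : 0 < al ^+ 2 + be ^+ 2).
Variables (O : set M) (O12 : set gC) (z0 : gC).
Hypothesis OE :
  O = [set phi | exists2 v, dot v v = 1 & Psi F phi = (al *: v, be *: v, ga *: v)].
Hypotheses (hO12 : adjoint_orbit O12) (Oz0 : O12 z0)
  (z0re : dotC z0 z0 = al ^+ 2 - be ^+ 2) (z0im : dot z0.1 z0.2 = al * be).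

Let graphP := S_orb_graphP fF m0 OE hO12 Oz0 z0re z0im.
Let O12E := O12P m0 hO12 Oz0 z0re z0im.
Let gramP := S_orb_gramP fF m0 OE.

(** For s = 0 both sides vanish: a, b, c are multiples of w, which spans the kernel of A, and they
    commute. *)
Lemma A_tensor_S_orb phi a b c eta : S_orb o O phi -> Psi F phi = (a, b, c) ->
  [/\ A_tensor o phi a eta = dot (bracket b c) eta,
      A_tensor o phi b eta = dot (bracket c a) eta &
      A_tensor o phi c eta = dot (bracket a b) eta].
Proof.
move=> Sphi phiE; have [s [sg h]] := (gramP phiE).1 Sphi.
case: (h) => [[aa bb cc] [ab bc ca] s0 [sg0 sgE] P].
have [s0'|sn] := eqVneq s 0; last first.
  apply: (A_tensor_generic _ fF _ phiE).
  by rewrite -(Phi_frame _ fF) phiE P mulf_neq0 // gt_eqF.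
have B x y : dot x x * dot y y = dot x y * dot x y -> bracket x y = 0.
  by move=> e; apply: dot_eq0; rewrite bracket_lagrange (dot_comm y) e subrr.
have Bab : bracket a b = 0 by apply: B; rewrite aa bb ab s0'; ring.
have Bbc : bracket b c = 0 by apply: B; rewrite bb cc bc s0'; ring.
have Bca : bracket c a = 0 by apply: B; rewrite cc aa ca s0'; ring.
have ab0 : (a, b) != 0.
  apply/eqP => -[a0 b0]; move: aa bb m0; rewrite a0 b0 dot0l s0' !addr0.
  by move=> <- <-; rewrite addr0 ltxx.
have X0 : X3 (a, b, c) = (0, 0, 0) by rewrite /= Bab Bbc Bca.
have [al' [be' [ga' [w [ww m' E]]]]] := commuting_triple X0 ab0.
pose q := al' ^+ 2 + be' ^+ 2 + ga' ^+ 2.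
have q0 : 0 < q by rewrite ltr_pwDl ?sqr_ge0.
have n0 : 0 < Num.sqrt q by rewrite sqrtr_gt0.
have nE : Num.sqrt q ^+ 2 = q by rewrite sqr_sqrtr ?ltW.
rewrite !(A_tensor_rank1 fF n0 nE ww (etrans phiE E)) Bab Bbc Bca dot0l.
by case: E => -> -> ->; rewrite !(dotZl, dotZr) ww; split; ring.
Qed.

Lemma tangent_S_orb phi v a b c da db dc : S_orb o O phi -> tangent (S_orb o O) phi v ->
  Psi F phi = (a, b, c) -> Psi F v = (da, db, dc) ->
  [/\ dot b db = dot a da, dot a db + dot b da = 0,
      [/\ dot c dc = dot a da, dot b dc + dot c db = 0 & dot c da + dot a dc = 0] &
      let p := graph_p al be a b in let sg := Num.sqrt (p + ga ^+ 2) in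
      p *: dc + (2 * dot a da) *: c = ga *: (al *: da + be *: db)
        + (dot a da / sg) *: bracket a b + sg *: (bracket da b + bracket a db)].
Proof.
move=> Sphi [gamma [e [e0 _ g0 gS dg]]] phiE vE.
have [ha hb hc] := is_derive_Psi dg vE.
(* The value of s varies along the curve, so only relations free of s are differentiated:
   differences of Gram entries, and the graph equation multiplied by [graph_p]. *)
have G t : -e < t < e -> let x := Psi F (gamma t) in
    [/\ [/\ dot x.1.1 x.1.1 - dot x.1.2 x.1.2 = al ^+ 2 - be ^+ 2,
        dot x.1.1 x.1.2 = al * be, dot x.2 x.2 - dot x.1.1 x.1.1 = ga ^+ 2 - al ^+ 2,
        dot x.1.2 x.2 = be * ga & dot x.2 x.1.1 = ga * al] &
      graph_p al be x.1.1 x.1.2 *: x.2 - (ga *: (al *: x.1.1 + be *: x.1.2)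
      + Num.sqrt (graph_p al be x.1.1 x.1.2 + ga ^+ 2) *: bracket x.1.1 x.1.2) = 0].
  move=> /gS; case xE : (Psi F (gamma t)) => [[x y] z] /(gramP xE) [s [sg h]] /=.
  have [_ _ zE] := (gram_shift_graphP ga m0 x y z).1 (ex_intro _ s (ex_intro _ sg h)).
  case: h => [[aa bb cc] [ab bc ca] s0 _ _]; split.
    by split=> //; rewrite ?aa ?bb ?cc; ring.
  rewrite zE /graph_third scalerA mulfV ?scale1r ?subrr //.
  by rewrite gt_eqF // graph_p_gt0.
have h0 : (Psi F (gamma 0)).1.1 = a by rewrite g0 phiE.
have h1 : (Psi F (gamma 0)).1.2 = b by rewrite g0 phiE.
have h2 : (Psi F (gamma 0)).2 = c by rewrite g0 phiE.
have E1 : dot b db = dot a da.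
  have := is_derive_sub (is_derive_dot ha ha) (is_derive_dot hb hb).
  move=> /(is_derive0_cst e0 (fun t ht => let: And5 h _ _ _ _ := (G t ht).1 in h)).
  by rewrite h0 h1 (dot_comm da) (dot_comm db); lra.
have E2 : dot a db + dot b da = 0.
  have := is_derive_dot ha hb.
  move=> /(is_derive0_cst e0 (fun t ht => let: And5 _ h _ _ _ := (G t ht).1 in h)).
  by rewrite h0 h1 (dot_comm da); lra.
split=> //.
  split.
  - have := is_derive_sub (is_derive_dot hc hc) (is_derive_dot ha ha).
    move=> /(is_derive0_cst e0 (fun t ht => let: And5 _ _ h _ _ := (G t ht).1 in h)).
    by rewrite h0 h2 (dot_comm da) (dot_comm dc); lra.
  - have := is_derive_dot hb hc.
    move=> /(is_derive0_cst e0 (fun t ht => let: And5 _ _ _ h _ := (G t ht).1 in h)).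
    by rewrite h1 h2 (dot_comm db); lra.
  - have := is_derive_dot hc ha.
    move=> /(is_derive0_cst e0 (fun t ht => let: And5 _ _ _ _ h := (G t ht).1 in h)).
    by rewrite h0 h2 (dot_comm dc); lra.
move=> p sg.
have cst (W : normedModType R) (k : W) : is_derive (0 : R) 1 (fun _ : R => k) 0.
  by apply: is_derive_cst.
have hp : is_derive (0 : R) 1 (fun t => graph_p al be (Psi F (gamma t)).1.1
    (Psi F (gamma t)).1.2) (2 * dot a da).
  have := is_derive_mul (is_derive_add (is_derive_add (is_derive_dot ha ha)
    (is_derive_dot hb hb)) (cst _ (al ^+ 2 + be ^+ 2))) (cst _ (2^-1 : R)).
  congr is_derive; rewrite h0 h1 (dot_comm da) (dot_comm db) E1; by field.
have hq := is_derive_add hp (cst _ (ga ^+ 2)).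
have q0 : 0 < graph_p al be (Psi F (gamma 0)).1.1 (Psi F (gamma 0)).1.2 + ga ^+ 2.
  exact: graph_q_gt0.
have hs := @is_derive_sqrt_comp R (fun t => graph_p al be (Psi F (gamma t)).1.1
  (Psi F (gamma t)).1.2 + ga ^+ 2) 0 _ q0 hq.
have := is_derive_sub (is_derive_scale hp hc)
  (is_derive_add (is_derive_scale (cst _ ga) (is_derive_add
     (is_derive_scale (cst _ al) ha) (is_derive_scale (cst _ be) hb)))
   (is_derive_scale hs (is_derive_bracket ha hb))).
move=> /(is_derive0_cst_vec e0 (fun t ht => (G t ht).2)).
rewrite h0 h1 h2 -/p -/sg !scale0r !add0r addr0 => /subr0_eq.
have -> : (2 * dot a da) / (2 * sg) = dot a da / sg.
  by rewrite -mulf_div divff ?mul1r.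
by rewrite addrC addrA.
Qed.

Lemma tangent_S_orb_proj phi v : S_orb o O phi -> tangent (S_orb o O) phi v ->
  exists xi, pr12 (Psi F v) = bracketC (pr12 (Psi F phi)) xi.
Proof.
move=> Sphi; case phiE : (Psi F phi) => [[a b] c]; case vE : (Psi F v) => [[da db] dc].
move=> tv; have [E1 E2 _ _] := tangent_S_orb Sphi tv phiE vE.
apply: orthogonal_bracketC.
- by have [+ _] := (graphP _).1 Sphi; rewrite phiE => /O12E [h1 h2]; apply: level_neq0 h1 h2.
- by rewrite /dotC /= E1 subrr.
- by rewrite /dotC_im /=.
Qed.

(** The linearized graph equation gives the third component from the first two, its coefficient
    [graph_p] being positive. *)
Lemma tangent_S_orb_inj phi u v : S_orb o O phi -> tangent (S_orb o O) phi u ->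
  tangent (S_orb o O) phi v -> pr12 (Psi F u) = pr12 (Psi F v) -> u = v.
Proof.
move=> Sphi tu tv uv; apply: (Psi_inj fF); move: uv.
case phiE : (Psi F phi) => [[a b] c]; case uE : (Psi F u) => [[x y] z].
case vE : (Psi F v) => [[x' y'] z'] [ex ey].
have [_ _ _ Eu] := tangent_S_orb Sphi tu phiE uE.
have [_ _ _ Ev] := tangent_S_orb Sphi tv phiE vE.
have pN : graph_p al be a b != 0 by rewrite gt_eqF // graph_p_gt0.
by move: Eu; rewrite ex ey /= -Ev => /addIr /(scalerI pN) ->.
Qed.

Lemma tangent_S_orb_lift phi xi : S_orb o O phi ->
  exists2 v, tangent (S_orb o O) phi v &
    pr12 (Psi F v) = bracketC (pr12 (Psi F phi)) xi.
Proof.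
move=> Sphi; have [Oz phiE] := (graphP _).1 Sphi.
have z_neq0 : pr12 (Psi F phi) != 0 by have [h1 h2] := (O12E _).1 Oz; apply: level_neq0 h1 h2.
have [gamma [s g0 gO dg]] := orbit_curve xi hO12 Oz z_neq0.
pose h := graph_map F al be ga \o gamma.
have sh : smooth_on setT h.
  exact: smooth_graph_map.
have dh : is_derive (0 : R) 1 h ('D_1 h 0).
  by apply/derivableP/diff_derivable; apply: (sh 1).1.
exists ('D_1 h 0).
  exists h, 1; split=> //.
  - by move=> k; apply: Ck_subset (sh k) => t _.
  - by rewrite /h /= g0 -phiE.
  - by move=> t _; apply: (S_orb_graph_map fF m0 OE hO12 Oz0 z0re z0im).
have d2 : is_derive (0 : R) 1 ((@pr12 R \o Psi F) \o h) (pr12 (Psi F ('D_1 h 0))).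
  apply: is_derive_linear dh; first exact: pr12_Psi_linear.
  by apply: linear_mx_continuous; apply: pr12_Psi_linear.
have E : (@pr12 R \o Psi F) \o h = gamma.
  by apply/funext => t; apply: pr12_graph_map fF _.
rewrite E in d2.
by rewrite -(@derive_val _ _ _ _ _ _ _ d2) (@derive_val _ _ _ _ _ _ _ dg).
Qed.

Lemma hamiltonian_tangent phi k v : S_orb o O phi ->
  hamiltonian_vector (@lin3 R F) (@pi_ R o F) phi k v -> tangent (S_orb o O) phi v.
Proof.
move=> Sphi; case: k => [[x1 x2] x3].
case phiE : (Psi F phi) => [[a b] c] /(hamiltonian_vectorP _ _ _ _ fF phiE) vE.
have Aa x : dot a (A_op o phi x) = dot (bracket b c) x.
  by rewrite dot_comm -A_tensor_op A_tensor_sym; have [] := A_tensor_S_orb x Sphi phiE.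
have Ab x : dot b (A_op o phi x) = dot (bracket c a) x.
  by rewrite dot_comm -A_tensor_op A_tensor_sym; have [] := A_tensor_S_orb x Sphi phiE.
have Ac x : dot c (A_op o phi x) = dot (bracket a b) x.
  by rewrite dot_comm -A_tensor_op A_tensor_sym; have [] := A_tensor_S_orb x Sphi phiE.
set da := (X in (X, _, _)) in vE; set db := (X in (_, X, _)) in vE.
set dc := (X in (_, _, X)) in vE.
have e1 : dot b db = dot a da.
  by rewrite /da /db dotBr Ab !(dotE, mxE) /=; ring.
have e2 : dot a db + dot b da = 0.
  by rewrite /da /db dotBr Aa !(dotE, mxE) /=; ring.
have e3 : dot c dc = dot a da.
  by rewrite /da /dc dotDr Ac !(dotE, mxE) /=; ring.
have e4 : dot b dc + dot c db = 0.
  by rewrite /db /dc dotBr dotDr Ab Ac !(dotE, mxE) /=; ring.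
have e5 : dot c da + dot a dc = 0.
  by rewrite /da /dc [dot a (_ + _)]dotDr Aa !(dotE, mxE) /=; ring.
have [Oz _] := (graphP phi).1 Sphi.
have ab0 : (a, b) != 0.
  by move: Oz; rewrite phiE => /O12E [h1 h2]; apply: level_neq0 h1 h2.
have d1 : dotC (a, b) (da, db) = 0 by rewrite /dotC /= e1 subrr.
(* By [e1] and [e2], (da, db) is tangent to [O12]; the lift of it is the tangent vector v' to
   compare with v. *)
have [xi xiE] := orthogonal_bracketC ab0 d1 e2.
have [v' tv'] := tangent_S_orb_lift xi Sphi.
rewrite phiE -[pr12 (a, b, c)]/(a, b) -xiE.
case vE' : (Psi F v') => [[da' db'] dc'] [da'E db'E]; subst da' db'.
have [_ _ [f3 f4 f5] E] := tangent_S_orb Sphi tv' phiE vE'.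
suff dcE : dc = dc' by have -> : v = v' by apply: (Psi_inj fF); rewrite vE vE' dcE.
have [s [sg h]] := (gramP phiE).1 Sphi.
case: (h) => [[aa bb cc] [ab bc ca] s0 [sg0 sgE] P].
have [s0'|sn] := eqVneq s 0; last first.
  apply/subr0_eq/(@dot_triple_eq0 _ a b c); rewrite ?dotBr.
  - by rewrite P mulf_neq0 // gt_eqF.
  - by move: e5 f5; lra.
  - by move: e4 f4; lra.
  - by rewrite e3 f3 subrr.
have B x y : dot x x * dot y y = dot x y * dot x y -> bracket x y = 0.
  by move=> e; apply: dot_eq0; rewrite bracket_lagrange (dot_comm y) e subrr.
have Bab : bracket a b = 0 by apply: B; rewrite aa bb ab s0'; ring.
have Bbc : bracket b c = 0 by apply: B; rewrite bb cc bc s0'; ring.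
have Bca : bracket c a = 0 by apply: B; rewrite cc aa ca s0'; ring.
have X0 : X3 (a, b, c) = (0, 0, 0) by rewrite /= Bab Bbc Bca.
have [al' [be' [ga' [w [ww m' abcE]]]]] := commuting_triple X0 ab0.
pose n := Num.sqrt (al' ^+ 2 + be' ^+ 2 + ga' ^+ 2).
have q0 : 0 < al' ^+ 2 + be' ^+ 2 + ga' ^+ 2 by rewrite ltr_pwDl ?sqr_ge0.
have n0 : 0 < n by rewrite sqrtr_gt0.
have nE : n ^+ 2 = al' ^+ 2 + be' ^+ 2 + ga' ^+ 2 by rewrite sqr_sqrtr ?ltW.
have AE x : A_op o phi x = n *: (x - dot w x *: w).
  apply: dot_inj => y; rewrite dot_comm -A_tensor_op.
  rewrite (A_tensor_rank1 fF n0 nE ww (etrans phiE abcE)).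
  by rewrite dotZr dotBr dotZr (dot_comm y x) (dot_comm y w).
have lin := critical_linearized x1 x2 x3 ww nE.
move: abcE => [aE bE cE].
have daE : da = bracket w (al' *: x1 + be' *: x2 + ga' *: x3).
  by rewrite /da aE bE cE; apply: su2_eq; rewrite !mxE /=; ring.
have dbE : db = bracket w (be' *: x1 - al' *: x2) - n *: (x3 - dot w x3 *: w).
  rewrite /db AE aE bE; congr (_ - _); apply: su2_eq; rewrite !mxE /=; ring.
have dcE : dc = bracket w (ga' *: x1 - al' *: x3) + n *: (x2 - dot w x2 *: w).
  rewrite /dc AE aE cE; congr (_ + _); apply: su2_eq; rewrite !mxE /=; ring.
rewrite /= -daE -dbE -dcE -aE -bE in lin.
have ada : dot a da = 0.
  by rewrite daE aE !(dotE, mxE) /=; ring.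
(* [commuting_triple] returns (al, be, ga) only up to a common sign, so the two triples are related
   through squares and products. *)
have sq1 : al' ^+ 2 = al ^+ 2 by move: aa; rewrite aE dotZl dotZr ww s0'; lra.
have sq2 : be' ^+ 2 = be ^+ 2 by move: bb; rewrite bE dotZl dotZr ww s0'; lra.
have sq3 : ga' ^+ 2 = ga ^+ 2 by move: cc; rewrite cE dotZl dotZr ww s0'; lra.
have pr1 : ga' * al' = ga * al by move: ca; rewrite aE cE dotZl dotZr ww; lra.
have pr2 : ga' * be' = ga * be by move: bc; rewrite bE cE dotZl dotZr ww; lra.
have pE : graph_p al be a b = al' ^+ 2 + be' ^+ 2.
  by rewrite /graph_p aa bb s0' sq1 sq2; field.
move: E; rewrite /= ada Bab pE mulr0 mul0r !scale0r !addr0 -sq3 -/n.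
rewrite scalerDr !scalerA -pr1 -pr2 -!scalerA -scalerDr -lin => /scalerI -> //.
by rewrite gt_eqF.
Qed.

(** The covector (xi.1, - xi.2, 0) is the pullback of [dotC xi] by the projection, whence the sign.
    Its Hamiltonian vector projects to [z, xi], and a tangent vector is determined by its
    projection. *)
Lemma S_orb_tangentP phi v : S_orb o O phi ->
  tangent (S_orb o O) phi v <->
  exists xi : gC, hamiltonian_vector (@lin3 R F) (@pi_ R o F) phi (xi.1, - xi.2, 0) v.
Proof.
move=> Sphi; split=> [tv|[xi]]; last exact: hamiltonian_tangent.
have [xi xiE] := tangent_S_orb_proj Sphi tv; exists xi.
case phiE : (Psi F phi) => [[a b] c]; rewrite phiE in xiE.
pose u := Psi_inv F (bracket a xi.1 + bracket b (- xi.2) + bracket c 0,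
   bracket b xi.1 - bracket a (- xi.2) - A_op o phi 0,
   bracket c xi.1 - bracket a 0 + A_op o phi (- xi.2)).
have hu : hamiltonian_vector (@lin3 R F) (@pi_ R o F) phi (xi.1, - xi.2, 0) u.
  by apply/(hamiltonian_vectorP _ _ _ _ fF phiE); rewrite (Psi_invK _ fF).
suff -> : v = u by [].
apply: (tangent_S_orb_inj Sphi tv (hamiltonian_tangent Sphi hu)).
rewrite xiE (Psi_invK _ fF) A_op0 /bracketC /=.
by congr (_, _); apply: su2_eq; rewrite !mxE /=; ring.
Qed.

Lemma S_orb_symplectic : exists omS omO12,
  [/\ induced_symplectic_form (@lin3 R F) (@pi_ R o F) (S_orb o O) omS,
      induced_symplectic_form (@dotC R) (@lie_poisson R) O12 omO12 &
      symplectic_map (S_orb o O) omS omO12 (@pr12 R \o Psi F)].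
Proof.
have [|omS hS] := @induced_form_exists R _ _ (@lin3 R F) (@pi_ R o F) (S_orb o O) _
    (fun p k k' _ => pi_anti o F p k k').
  move=> p v Sp; split=> [/(S_orb_tangentP v Sp) [xi h]|[k h]]; first by eexists; exact: h.
  exact: hamiltonian_tangent h.
have [|omO hO] := @induced_form_exists R _ _ (@dotC R) (@lie_poisson R) O12 _
    (fun p k k' _ => lie_poisson_anti p k k').
  move=> z v Oz; have [h1 h2] := (O12E z).1 Oz.
  rewrite (tangent_orbitP v hO12 Oz (level_neq0 m0 h1 h2)).
  by split=> -[xi h]; exists xi; apply/lie_poisson_hamiltonian.
exists omS, omO; split=> // p u v Sp /(S_orb_tangentP u Sp) [xi hu] /(S_orb_tangentP v Sp) [eta hv].
have D (x : M) : 'D_x (@pr12 R \o Psi F) p = pr12 (Psi F x).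
  by apply: derive_linear; [|apply: linear_mx_continuous]; apply: pr12_Psi_linear.
have [Oz _] := (graphP p).1 Sp.
have [_ hS2] := hS p Sp; rewrite (hS2 _ _ _ _ hu hv) !D.
have [_ hO2] := hO _ Oz.
case pE : (Psi F p) => [[a b] c].
have uE := (hamiltonian_vectorP _ _ _ _ fF pE).1 hu.
have vE := (hamiltonian_vectorP _ _ _ _ fF pE).1 hv.
(* Hamiltonian vectors of pulled-back covectors project to Hamiltonian vectors. On such covectors A
   does not contribute to [pi_], and what remains is the Lie-Poisson bracket. *)
have B x (zeta : gC) : Psi F x = (bracket a zeta.1 + bracket b (- zeta.2) + bracket c 0,
   bracket b zeta.1 - bracket a (- zeta.2) - A_op o p 0,
   bracket c zeta.1 - bracket a 0 + A_op o p (- zeta.2)) ->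
   hamiltonian_vector (@dotC R) (@lie_poisson R) (pr12 (Psi F p)) zeta (pr12 (Psi F x)).
  move=> ->; apply/lie_poisson_hamiltonian; rewrite pE A_op0 /bracketC /=.
  by congr (_, _); apply: su2_eq; rewrite !mxE /=; ring.
rewrite /= (hO2 _ _ _ _ (B _ _ uE) (B _ _ vE)) /pi_ pE !A_tensor_op A_op0 dot0r dot0l.
by rewrite /lie_poisson /dotC /bracketC /= !(dotE, mxE) /=; ring.
Qed.

End SymplecticGraph.

Theorem theorem5p8 (R : realType) (o : bool) (O : set (Hom_su2 R))
    (F : 'M[R]_3) (O12 : set (sl2 R)) :
  G_orbit O -> O `<=` critical_set o -> frame o F ->
  adjoint_orbit O12 -> (@pr12 R \o Psi F) @` O `<=` O12 ->
  regular_orbit O12 ->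
  (@pr12 R \o Psi F) @` S_orb o O = O12 /\
  diffeomorphism (S_orb o O) O12 (@pr12 R \o Psi F) /\
  exists omS omO12,
    [/\ induced_symplectic_form (@lin3 R F) (@pi_ R o F) (S_orb o O) omS,
        induced_symplectic_form (@dotC R) (@lie_poisson R) O12 omO12 &
        symplectic_map (S_orb o O) omS omO12 (@pr12 R \o Psi F)].
Proof.
move=> hO Ocrit fF hO12 O_O12 reg.
have [phi Ophi] : exists phi, O phi.
  case: hO => phi ->; exists phi; exists 1%:M; first exact: SU2_1.
  have Ad1 x : Ad (1%:M : 'M[R[i]]_2) x x by rewrite /Ad invmx1 mulmx1 mul1mx.
  by split; apply: Ad1.
have Oz : O12 (pr12 (Psi F phi)) by apply: O_O12; exists phi.
have z0 := regular_orbit_neq0 hO12 reg Oz.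
case phiE : (Psi F phi) Oz z0 => [[a b] c] Oz z0.
have X0 : X3 (a, b, c) = (0, 0, 0).
  by rewrite -phiE; apply/(critical_setP phi fF)/Ocrit.
(* Regularity enters here only: (a, b) != 0 yields al^2 + be^2 > 0. *)
have [al [be [ga [w [ww m0 E]]]]] := commuting_triple X0 z0.
have n0 : 0 < al ^+ 2 + be ^+ 2 + ga ^+ 2 by rewrite ltr_pwDl ?sqr_ge0.
have OE := G_orbitE fF hO Ophi (etrans phiE E) ww n0.
move: E Oz => [-> -> _] Oz.
have re : dotC (al *: w, be *: w) (al *: w, be *: w) = al ^+ 2 - be ^+ 2.
  by rewrite /dotC /= !(dotZl, dotZr) ww; ring.
have im : dot (al *: w) (be *: w) = al * be by rewrite dotZl dotZr ww mulr1.
split; [|split].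
- exact: (@S_orb_image _ _ _ _ _ _ fF m0 _ _ (al *: w, be *: w) OE hO12 Oz re im).
- exact: (@S_orb_diffeomorphism _ _ _ _ _ _ fF m0 _ _ (al *: w, be *: w) OE hO12 Oz re im).
- exact: (@S_orb_symplectic _ _ _ _ _ _ fF m0 _ _ (al *: w, be *: w) OE hO12 Oz re im).
Qed.
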